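(* Let $(\mathcal A,\pi,M,\rho)$ be a convenient anchored bundle with typical fibre $\mathbb A$, let $\mathbf p:\mathcal E\to M$ be a convenient vector bundle with typical fibre $\mathbb E$, and let $\mathcal M\subset\mathcal E$ be an open submanifold such that $\mathbf p|_{\mathcal M}:\mathcal M\to M$ is a surjective fibration with typical fibre an open subset $\mathbb O\subset\mathbb E$. Let $\mathbf T^{\mathcal A}\mathcal M$, $\hat{\mathbf p}$, $\hat\rho$, $\widetilde{\mathcal A}$, $\widetilde{\mathbf p}$ and $\mathbf p_{\widetilde{\mathcal A}}$ be as defined in the context. Then: (1) $\hat{\mathbf p}:\mathbf T^{\mathcal A}\mathcal M\to\mathcal M$ is a convenient vector bundle with typical fibre $\mathbb A\times\mathbb E$, and $(\mathbf T^{\mathcal A}\mathcal M,\hat{\mathbf p},\mathcal M,\hat\rho)$ is a convenient anchored bundle. (2) $\mathbf p_{\widetilde{\mathcal A}}:\mathbf T^{\mathcal A}\mathcal M\to\widetilde{\mathcal A}$ is a surjective bundle morphism (over $\mathrm{Id}_{\mathcal M}$) whose kernel is a subbundle of $\mathbf T^{\mathcal A}\mathcal M$. The restriction of $\hat\rho$ to $\ker\mathbf p_{\widetilde{\mathcal A}}$ is a bundle isomorphism onto the vertical bundle $V\mathcal M=\ker(T\mathbf p:T\mathcal M\to TM)$. (3) Let $V\subset M$ be open and $\mathcal V=\mathbf p^{-1}(V)\cap\mathcal M$. For each section $\mathbf X$ of $\mathbf T^{\mathcal A}\mathcal M$ over $\mathcal V$ there exists a pair $(\mathfrak a,X)$ consisting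 of a section $\mathfrak a$ of $\widetilde{\mathcal A}$ over $\mathcal V$ and a vector field $X$ on $\mathcal V$ such that $$\forall m\in\mathcal V,\qquad T\mathbf p(X(m))=\rho\big(\widetilde{\mathbf p}(\mathfrak a(m))\big).\qquad( * )$$ Conversely, a pair $(\mathfrak a,X)$ satisfying $( * )$ defines a unique section $\mathbf X$ of $\mathbf T^{\mathcal A}\mathcal M$ over $\mathcal V$, the pair associated with $\mathbf X$ is precisely $(\mathfrak a,X)$, and $\hat\rho(\mathbf X)=X$.
   Context: All objects are in the convenient setting of Kriegl–Michor (smooth manifolds modelled on convenient spaces, convenient vector bundles, kinematic tangent bundles; morphisms are smooth and fibrewise bounded linear). A convenient anchored bundle $(\mathcal A,\pi,M,\rho)$ is a convenient vector bundle $\pi:\mathcal A\to M$ together with a vector bundle morphism $\rho:\mathcal A\to TM$ over $\mathrm{Id}_M$ (the anchor). That $\mathbf p|_{\mathcal M}$ is a surjective fibration with fibre $\mathbb O$ means: $M$ is covered by chart domains $U$ over which $\mathcal A$ and $\mathcal E$ are trivial, with a trivialization $\mathcal E_U\cong U\times\mathbb E$ sending $\mathcal M_U=\mathcal M\cap\mathbf p^{-1}(U)$ onto $U\times\mathbb O$. For $m\in\mathcal M$ with $x=\mathbf p(m)$ put $$\mathbf T^{\mathcal A}_m\mathcal M=\{(a,\mu)\in\mathcal A_x\times T_m\mathcal M:\ \rho(a)=T\mathbf p(\mu)\},$$ write $(m,a,\mu)$ for its elements, and let $\mathbf T^{\mathcal A}\mathcal M=\bigcup_{m}\mathbf T^{\mathcal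 A}_m\mathcal M$, $\hat{\mathbf p}(m,a,\mu)=m$, and $\hat\rho:\mathbf T^{\mathcal A}\mathcal M\to T\mathcal M$, $\hat\rho(m,a,\mu)=(m,\mu)$. Let $\widetilde\pi:\widetilde{\mathcal A}\to\mathcal M$ be the pull-back of $\pi:\mathcal A\to M$ by $\mathbf p:\mathcal M\to M$, with canonical map $\widetilde{\mathbf p}:\widetilde{\mathcal A}\to\mathcal A$, $(m,a)\mapsto a$. Finally $\mathbf p_{\widetilde{\mathcal A}}(m,a,\mu)=(m,a)$. Sections are smooth sections. The pair associated with a section $\mathbf X$ is $(\mathbf p_{\widetilde{\mathcal A}}\circ\mathbf X,\ \hat\rho\circ\mathbf X)$. *)

(* Defs.v *)
(* Convenient calculus, manifolds and vector bundles in the sense of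
   A. Kriegl and P. W. Michor, The Convenient Setting of Global Analysis
   (cited below as KM).

   [manifold], [bundle] carry raw data; [is_manifold], [is_bundle] state
   that these data are a manifold, respectively a vector bundle. *)
From HB Require Import structures.
From mathcomp Require Import all_boot all_order all_algebra.
From mathcomp Require Import all_classical all_reals all_analysis.

Set Implicit Arguments.
Unset Strict Implicit.
Unset Printing Implicit Defensive.

Import Order.TTheory GRing.Theory Num.Theory.
Import numFieldNormedType.Exports.

Local Open Scope classical_set_scope.
Local Open Scope ring_scope.

Section ConvenientSpaces.
Context {R : realType}.

(* [d n] is the n-th derivative of [c]. The library's [derive] is restricted
   to normed spaces. *)
Definition smooth_curve (E : tvsType R) (c : R -> E) : Prop :=
  exists d : nat -> R -> E, d 0%N = c /\
    forall n t, (fun h : R => h^-1 *: (d n (t + h) - d n t)) @ 0^'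
                  --> d n.+1 t.

(* KM 2.14: c^oo-completeness, in the form: scalarwise smooth curves are
   smooth. A [tvsType] is locally convex but need not be Hausdorff. *)
Definition convenient (E : tvsType R) : Prop :=
  hausdorff_space E /\
  forall c : R -> E,
    (forall l : {linear E -> R^o}, continuous l ->
       smooth_curve (E := R^o) (fun t => l (c t))) ->
    smooth_curve c.

Definition cinf_open (E : tvsType R) (U : set E) : Prop :=
  forall c : R -> E, smooth_curve c -> open (c @^-1` U).

Definition smooth_on (E F : tvsType R) (U : set E) (f : E -> F) : Prop :=
  forall c : R -> E, smooth_curve c -> (forall t, U (c t)) ->
    smooth_curve (f \o c).

Definition vN_bounded (E : tvsType R) (B : set E) : Prop :=
  forall U : set E, nbhs (0 : E) U ->
    exists2 r : R, 0 < r & B `<=` [set r *: x | x in U].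

Definition bounded_linear (E F : tvsType R) (f : E -> F) : Prop :=
  (forall (a : R) (x y : E), f (a *: x + y) = a *: f x + f y) /\
  (forall B : set E, vN_bounded B -> vN_bounded (f @` B)).

(* df(x)(v), meaningful when the limit exists (f smooth near x). *)
Definition ddir (E F : tvsType R) (f : E -> F) (x v : E) : F :=
  xget 0 [set l | (fun h : R => h^-1 *: (f (x + h *: v) - f x)) @ 0^' --> l].

(* [j] identifies W with a c^oo-closed linear subspace of V: the smooth curves
   of W are those of V with values in the subspace. *)
Definition closed_embedding (W V : tvsType R) (j : W -> V) : Prop :=
  [/\ bounded_linear j, injective j, cinf_open (~` range j) &
      forall c : R -> W, smooth_curve (j \o c) -> smooth_curve c].

End ConvenientSpaces.

Section Manifolds.
Context {R : realType}.

(* [cmap] is relevant on [cdom] only. The model space may vary with the chart,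
   as in KM 27.1. *)
Record chart (X : Type) : Type := Chart {
  cmodel : tvsType R;
  cdom : set X;
  cmap : X -> cmodel }.

(* g \o c^-1 on the image of [c], extended by 0. *)
Definition chart_rep (X : Type) (c : chart X) (F : tvsType R) (g : X -> F) :
    cmodel c -> F :=
  fun u => if pselect (exists x, cdom c x /\ cmap c x = u) is left H
           then g (sval (cid H)) else 0.
#[global] Arguments chart_rep {X} c {F} g _.

Definition smooth_in_chart (X : Type) (c : chart X) (W : set X)
    (F : tvsType R) (g : X -> F) : Prop :=
  cinf_open (cmap c @` (cdom c `&` W)) /\
  smooth_on (cmap c @` (cdom c `&` W)) (chart_rep c g).

Record manifold : Type := Manifold {
  mpoint :> Type;
  atlas : chart mpoint -> Prop }.
#[global] Arguments atlas _ _ : clear implicits.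

(* [c] belongs to the maximal atlas generated by [atlas X]. *)
Definition is_chart (X : manifold) (c : chart X) : Prop :=
  [/\ convenient (cmodel c),
      (forall x y, cdom c x -> cdom c y -> cmap c x = cmap c y -> x = y),
      cinf_open (cmap c @` cdom c) &
      forall d, atlas X d -> smooth_in_chart c (cdom d) (cmap d) /\
                             smooth_in_chart d (cdom c) (cmap c)].
#[global] Arguments is_chart X c : clear implicits.

(* The natural topology. *)
Definition mopen (X : manifold) (U : set X) : Prop :=
  forall c, atlas X c -> cinf_open (cmap c @` (cdom c `&` U)).
#[global] Arguments mopen X U : clear implicits.

(* KM 27.1, with Hausdorff natural topology. *)
Definition is_manifold (X : manifold) : Prop :=
  [/\ forall c, atlas X c -> is_chart X c,
      forall x : X, exists2 c, atlas X c & cdom c x &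
      forall x y : X, x <> y -> exists U V : set X,
        [/\ mopen X U, mopen X V, U x, V y & U `&` V = set0]].

Definition smooth_map (X Y : manifold) (f : X -> Y) : Prop :=
  forall c d, atlas X c -> atlas Y d ->
    smooth_in_chart c (f @^-1` cdom d) (cmap d \o f).
#[global] Arguments smooth_map X Y f : clear implicits.

Definition model_manifold (E : tvsType R) : manifold :=
  @Manifold E (fun C => C = @Chart E E setT id).

Definition prod_chart (X Y : Type) (c : chart X) (d : chart Y) : chart (X * Y) :=
  @Chart (X * Y)%type (cmodel c * cmodel d)%type
    [set xy | cdom c xy.1 /\ cdom d xy.2]
    (fun xy => (cmap c xy.1, cmap d xy.2)).

Definition prod_manifold (X Y : manifold) : manifold :=
  @Manifold (X * Y)%type
    (fun C => exists c d, [/\ atlas X c, atlas Y d & C = prod_chart c d]).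

Definition sub_chart (X : Type) (U : set X) (c : chart X) : chart {x | U x} :=
  @Chart {x | U x} (cmodel c) [set x | cdom c (sval x)]
    (fun x => cmap c (sval x)).

(* Meant for U open. *)
Definition sub_manifold (X : manifold) (U : set X) : manifold :=
  @Manifold {x | U x} (fun C => exists2 c, atlas X c & C = sub_chart U c).

Definition chart_at (X : manifold) (x : X) : chart X :=
  if pselect (exists c, atlas X c /\ cdom c x) is left H then sval (cid H)
  else @Chart X R^o set0 (fun=> 0).

(* The kinematic tangent space at x is the quotient of
   {(c, v) | c a chart at x, v in its model} by (c, v) ~ (d, w) iff
   d(d \o c^-1)(c x)(v) = w (KM, section 28); an element is represented here
   by its component in the fixed chart [chart_at x]. *)
Definition tangent_space (X : manifold) (x : X) : tvsType R :=
  cmodel (chart_at x).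

Definition tderiv (X : manifold) (F : tvsType R) (g : X -> F) (x : X) :
    tangent_space x -> F :=
  ddir (chart_rep (chart_at x) g) (cmap (chart_at x) x).
#[global] Arguments tderiv {X F} g x _.

Definition tangent_map (X Y : manifold) (f : X -> Y) (x : X) :
    tangent_space x -> tangent_space (f x) :=
  tderiv (cmap (chart_at (f x)) \o f) x.
#[global] Arguments tangent_map {X Y} f x _.

End Manifolds.

Arguments chart R X : clear implicits.
Arguments manifold R : clear implicits.

Section Bundles.
Context {R : realType}.

(* A trivialization over [tdom], given by its fibre components; [tmap] is
   relevant over [tdom] only. *)
Record triv (X : Type) (F : X -> Type) : Type := Triv {
  tmodel : tvsType R;
  tdom : set X;
  tmap : forall x, F x -> tmodel }.

#[global] Arguments tmap {X F} _ x _.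

Record bundle (X : manifold R) : Type := Bundle {
  fiber :> X -> Type;
  trivs : triv fiber -> Prop }.
#[global] Arguments trivs {X} _ _.

(* The chart change of KM 29.1: (x, v) |-> g x v. *)
Definition triv_compat (X : manifold R) (F : X -> Type) (p q : triv F) : Prop :=
  exists g : sub_manifold (tdom p `&` tdom q) -> tmodel p -> tmodel q,
    [/\ forall x, bounded_linear (g x),
        forall x a, tmap q (sval x) a = g x (tmap p (sval x) a) &
        smooth_map (prod_manifold (sub_manifold (tdom p `&` tdom q))
                                  (model_manifold (tmodel p)))
                   (model_manifold (tmodel q)) (fun xv => g xv.1 xv.2)].

(* [p] belongs to the maximal vector bundle atlas. *)
Definition is_bundle_chart (X : manifold R) (B : bundle X) (p : triv B) : Prop :=
  [/\ convenient (tmodel p), mopen X (tdom p),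
      (forall x, tdom p x -> bijective (tmap p x)) &
      forall q, trivs B q -> triv_compat p q /\ triv_compat q p].
#[global] Arguments is_bundle_chart {X} B p.

Definition is_bundle (X : manifold R) (B : bundle X) : Prop :=
  [/\ is_manifold X, forall p, trivs B p -> is_bundle_chart B p &
      forall x : X, exists2 p, trivs B p & tdom p x].

Definition typical_fiber (X : manifold R) (B : bundle X) (V : tvsType R) : Prop :=
  convenient V /\
  forall x : X, exists (U : set X) (t : forall y, B y -> V),
    U x /\ is_bundle_chart B (Triv U t).
#[global] Arguments typical_fiber {X} B V.

Definition total_chart (X : manifold R) (B : bundle X) (c : chart R X)
    (p : triv B) : chart R {x & B x} :=
  @Chart R {x & B x} (cmodel c * tmodel p)%type
    [set a | cdom c (projT1 a) /\ tdom p (projT1 a)]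
    (fun a => (cmap c (projT1 a), tmap p (projT1 a) (projT2 a))).

Definition total_space (X : manifold R) (B : bundle X) : manifold R :=
  @Manifold R {x & B x}
    (fun C => exists c p, [/\ atlas X c, trivs B p & C = total_chart c p]).

(* Vector bundle morphisms over the identity. *)
Definition is_morphism (X : manifold R) (B B' : bundle X)
    (h : forall x, B x -> B' x) : Prop :=
  smooth_map (total_space B) (total_space B')
    (fun a => existT B' (projT1 a) (h (projT1 a) (projT2 a))) /\
  (forall p q x, trivs B p -> trivs B' q -> tdom p x -> tdom q x ->
     exists2 g : tmodel p -> tmodel q, bounded_linear g &
       forall a, tmap q x (h x a) = g (tmap p x a)).
#[global] Arguments is_morphism {X} B B' h.

Definition is_isomorphism (X : manifold R) (B B' : bundle X)
    (h : forall x, B x -> B' x) : Prop :=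
  is_morphism B B' h /\
  exists k : forall x, B' x -> B x,
    [/\ is_morphism B' B k, forall x a, k x (h x a) = a &
        forall x b, h x (k x b) = b].
#[global] Arguments is_isomorphism {X} B B' h.

Definition is_section (X : manifold R) (B : bundle X) (U : set X)
    (s : forall x : sub_manifold U, B (sval x)) : Prop :=
  smooth_map (sub_manifold U) (total_space B)
    (fun x => existT B (sval x) (s x)).
#[global] Arguments is_section {X} B U s.

Definition is_zero (X : manifold R) (B : bundle X) (x : X) (a : B x) : Prop :=
  exists p, [/\ trivs B p, tdom p x & tmap p x a = 0].
#[global] Arguments is_zero {X} B x a.

(* The induced structure on a family [S] of subsets of the fibres:
   its trivializations come from bundle charts of [B] that map S onto a fixed
   closed linear subspace (the range of [j]) of the model. *)
Definition restr_bundle (X : manifold R) (B : bundle X)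
    (S : forall x, set (B x)) : bundle X :=
  @Bundle X (fun x => {a : B x | S x a})
    (fun t => convenient (tmodel t) /\
      exists (p : triv B) (j : tmodel t -> tmodel p),
        [/\ is_bundle_chart B p, tdom t = tdom p, closed_embedding j &
            forall x, tdom p x ->
              (forall a, tmap p x (sval a) = j (tmap t x a)) /\
              [set tmap p x a | a in S x] = range j]).
#[global] Arguments restr_bundle {X} B S.

Definition is_subbundle (X : manifold R) (B : bundle X)
    (S : forall x, set (B x)) : Prop :=
  is_bundle (restr_bundle B S).
#[global] Arguments is_subbundle {X} B S.

Definition pullback (X Y : manifold R) (f : X -> Y) (B : bundle Y) : bundle X :=
  @Bundle X (fun x => B (f x))
    (fun t => exists2 p, trivs B p &
       t = @Triv X (fun x => B (f x)) (tmodel p) (f @^-1` tdom p)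
             (fun x => tmap p (f x))).

Definition tangent (X : manifold R) : bundle X :=
  @Bundle X (fun x => tangent_space x)
    (fun t => exists2 c, atlas X c &
       t = @Triv X (fun x => tangent_space x) (cmodel c) (cdom c)
             (tderiv (cmap c))).

(* The anchored bundle (B, rho). *)
Definition is_anchored (X : manifold R) (B : bundle X)
    (rho : forall x, B x -> tangent X x) : Prop :=
  is_bundle B /\ is_morphism B (tangent X) rho.
#[global] Arguments is_anchored {X} B rho.

End Bundles.

Arguments triv R {X} F.
Arguments tangent {R} X.

Section Prolongation.
Context {R : realType} (M : manifold R) (A E : bundle M).
Variable rho : forall x, A x -> tangent M x.
Variable N : set (total_space E).

(* p restricted to N *)
Definition base (m : sub_manifold N) : M := projT1 (sval m).

(* Surjectivity of [base] and openness of O are not included. *)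
Definition is_fibration (AA EE : tvsType R) (O : set EE) : Prop :=
  forall x : M, exists (c : chart R M)
      (a : forall y, A y -> AA) (e : forall y, E y -> EE),
    [/\ is_chart M c, cdom c x, is_bundle_chart A (Triv (cdom c) a),
        is_bundle_chart E (Triv (cdom c) e) &
        forall y (u : E y), cdom c y -> (N (existT E y u) <-> O (e y u))].

Definition prol_fiber (m : sub_manifold N) : Type :=
  {am : A (base m) * tangent (sub_manifold N) m |
    rho am.1 = tangent_map base m am.2}.

(* In bundle coordinates m = (x, e), a = (x, a), mu = (x, e, rho_x(a), z), the
   fibre component of (m, a, mu) is (a, z); z is the derivative along mu of
   the coordinate function m |-> e. *)
Definition prol_triv (p : triv R A) (q : triv R E) : triv R prol_fiber :=
  @Triv R (sub_manifold N) prol_fiber (tmodel p * tmodel q)%type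
    [set m | tdom p (base m) /\ tdom q (base m)]
    (fun m t =>
       (tmap p (base m) (sval t).1,
        tderiv (fun n : sub_manifold N => tmap q (base n) (projT2 (sval n)))
          m (sval t).2)).

Definition prolongation : bundle (sub_manifold N) :=
  @Bundle R (sub_manifold N) prol_fiber
    (fun t => exists p q,
       [/\ trivs A p, trivs E q & t = prol_triv p q]).

Definition rho_hat (m : sub_manifold N) (t : prolongation m) :
    tangent (sub_manifold N) m := (sval t).2.

Definition A_tilde : bundle (sub_manifold N) := pullback base A.

Definition p_tilde (m : sub_manifold N) (a : A_tilde m) : A (base m) := a.

Definition p_A_tilde (m : sub_manifold N) (t : prolongation m) : A_tilde m :=
  (sval t).1.

Definition ker_p_A_tilde (m : sub_manifold N) : set (prolongation m) :=
  [set t | is_zero A_tilde m (p_A_tilde t)].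

Definition vertical (m : sub_manifold N) : set (tangent (sub_manifold N) m) :=
  [set mu | tangent_map base m mu = 0].

End Prolongation.

Arguments base {R M E} N m.
Arguments is_fibration {R M} A {E} N AA {EE} O.
Arguments prolongation {R M A E} rho N.
Arguments rho_hat {R M A E} rho N m t.
Arguments A_tilde {R M} A {E} N.
Arguments p_tilde {R M} A {E} N m a.
Arguments p_A_tilde {R M A E} rho N m t.
Arguments ker_p_A_tilde {R M A E} rho N m.
Arguments vertical {R M E} N m.

(* Main.v *)
(* All smoothness is tested along smooth curves. The analytic input is that a
   smooth map f : U -> F on a c^oo-open set has directional derivatives df(x, v)
   that are linear and bounded in v, smooth in (x, v) and satisfy the chain
   rule. Composing with continuous functionals, which separate the points of a
   convenient space, reduces this to a function g on the plane that is smooth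
   along smooth curves (Boman): a smooth curve through fast converging points
   shows that the iterated directional derivatives of g are locally bounded; by
   Djokovic's polarization of finite differences the mixed differences are then
   bounded as well, so that the difference quotients of g in the second variable
   have locally bounded derivatives of all orders in the first variable, and
   their limit is smooth.

   For the prolongation, a curve (m, a, mu) is smooth in the bundle
   coordinates (a, z) iff (m, a) is smooth in A and (m, mu) is smooth in the
   tangent bundle of N, because in a chart mu has components (rho(a), z). *)
Require Import Defs.
From mathcomp Require Import all_boot all_order all_algebra.
From mathcomp Require Import all_classical all_reals all_analysis.
From mathcomp Require Import ring lra zify.

Set Implicit Arguments.
Unset Strict Implicit.
Unset Printing Implicit Defensive.

Import Order.TTheory GRing.Theory Num.Theory.
Import numFieldNormedType.Exports.

Local Open Scope ring_scope.
Local Open Scope classical_set_scope.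

(** * Smooth functions of one real variable *)

(** Smoothness along curves gives, a priori, no continuity in the topology of a product, not even
    for a function on the plane. The basic uniform statements are therefore proved by contradiction:
    counterexamples with growing constants are scaled to size 2^-(j^2) and threaded onto one smooth
    curve that visits the j-th of them at time 2^-j. This one device gives local boundedness of
    derivatives, squares inside preimages of c^oo-open sets, and boundedness of linear maps that
    preserve smooth curves. Because of the last of these, chart changes and morphisms only have to
    be shown linear on fibres and smooth along curves. Hadamard's quotient is needed to write a
    curve as c 0 + t *: w t; the integral that would show its smoothness is replaced by Riemann sums
    and the same limit theorem as for difference quotients. On a manifold a curve can be read in a
    chart only near a given time, so smoothness is a property of germs; a smooth change of parameter
    with small range turns germs into total curves. *)

Definition has_deriv (R : realType) (E : tvsType R) (c : R -> E) (t : R) (l : E) :=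
  (fun h : R => h^-1 *: (c (t + h) - c t)) @ 0^' --> l.

Definition smoothR (R : realType) (f : R -> R) := smooth_curve (E := R^o) f.

Section SmoothCurves.
Context {R : realType}.
Implicit Types (E : tvsType R) (f g : R -> R) (t : R).

(** Coinduction: a choice of derivative inside P, iterated from c, is the sequence of derivatives
    that [smooth_curve] asks for. It serves wherever a class of curves is closed under
    differentiation (glued functions, limits, images under linear maps). *)
Lemma smooth_coind E (P : (R -> E) -> Prop) :
  (forall c, P c -> exists2 d, P d & forall t, has_deriv c t (d t)) ->
  forall c, P c -> smooth_curve c.
Proof.
move=> H c Pc.
pose T := {c | P c}.
have nx (u : T) : {v : T | forall t, has_deriv (sval u) t (sval v t)}.
  case: u => u Pu /=; apply: cid; case: (H u Pu) => v Pv uv.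
  by exists (exist _ v Pv).
pose s n := iter n (fun u => sval (nx u)) (exist _ c Pc : T).
exists (fun n => sval (s n)); split => // n t.
exact: (svalP (nx (s n)) t).
Qed.

Lemma smooth_curveD E (c : R -> E) : smooth_curve c ->
  exists2 d, smooth_curve d & forall t, has_deriv c t (d t).
Proof.
case=> d [<- dP]; exists (d 1%N); last by move=> t; exact: dP.
by exists (fun n => d n.+1); split.
Qed.

Lemma has_derivR f t (l : R) : has_deriv (E := R^o) f t l <-> is_derive t 1 f l.
Proof.
have -> : has_deriv (E := R^o) f t l <->
    (fun h : R => h^-1 *: ((f \o shift t) (h *: 1) - f t)) @ 0^' --> (l : R^o).
  rewrite /has_deriv.
  suff -> : (fun h : R => h^-1 *: (f (t + h) - f t : R^o)) =
     (fun h : R => h^-1 *: ((f \o shift t) (h *: (1 : R)) - f t : R^o)) by [].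
  by apply/funext => h /=; rewrite /shift /= /GRing.scale /= mulr1 (addrC t).
split=> [H|[]].
  apply: DeriveDef; first by apply/cvg_ex; exists l.
  by apply: cvg_lim => //; exact: Rhausdorff.
by move=> H <-; exact: H.
Qed.

(** Differentiability n times, with nothing asked of the n-th derivative itself. At finite order the
    product, chain and reciprocal rules follow by induction on n; [smoothR] is the conjunction of
    all orders. *)
Fixpoint Ck n f : Prop :=
  if n is m.+1 then (forall t, derivable f t 1) /\ Ck m (derive1 f) else True.

Lemma is_derive_derive1 f t (l : R) : is_derive t 1 f l -> derive1 f t = l.
Proof. by move=> H; rewrite derive1E; apply: derive_val. Qed.

Lemma derivable_is_derive f t : derivable f t 1 -> is_derive t 1 f (derive1 f t).
Proof. by move=> H; rewrite derive1E; apply: DeriveDef. Qed.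

Lemma smoothR_der f t : smoothR f -> is_derive t 1 f (derive1 f t).
Proof.
move=> /smooth_curveD[g _ fg].
by apply: derivable_is_derive; have /has_derivR[] := fg t.
Qed.

Lemma smoothR_derive1 f : smoothR f -> smoothR (derive1 f).
Proof.
move=> /smooth_curveD[g sg fg]; suff -> : derive1 f = g by [].
by apply/funext => t; apply: is_derive_derive1; apply/has_derivR.
Qed.

Lemma smoothRP f : smoothR f <-> forall n, Ck n f.
Proof.
split=> [sf n|].
  elim: n f sf => //= n IH f sf; split; last by apply/IH/smoothR_derive1.
  by move=> t; have [] := smoothR_der t sf.
apply: (@smooth_coind (R^o) (fun f => forall n, Ck n f)) => {}f fC.
exists (derive1 f); first by move=> n; have [] := fC n.+1.
move=> t; apply/has_derivR/derivable_is_derive.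
by have [] := fC 1%N.
Qed.

Lemma CkW n f : Ck n.+1 f -> Ck n f.
Proof. by elim: n f => //= n IH f [? /IH]. Qed.

Lemma derive1_ext f (g : R -> R) : (forall t, is_derive t 1 f (g t)) -> derive1 f = g.
Proof. by move=> H; apply/funext => t; apply: is_derive_derive1. Qed.

Lemma CkS n f g : (forall t, is_derive t 1 f (g t)) -> Ck n g -> Ck n.+1 f.
Proof.
move=> H Cg; split; last by rewrite (derive1_ext H).
by move=> t; have [] := H t.
Qed.

Lemma Ck_der n f t : Ck n.+1 f -> is_derive t 1 f (derive1 f t).
Proof. by move=> [/(_ t) df _]; apply: derivable_is_derive. Qed.

Lemma Ck_cst n (a : R) : Ck n (fun=> a).
Proof.
by elim: n a => //= n IH a; apply: (@CkS n _ (fun=> 0)).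
Qed.

Lemma CkD n f g : Ck n f -> Ck n g -> Ck n (fun x => f x + g x).
Proof.
elim: n f g => // n IH f g Cf Cg.
have H : Ck n (fun x => derive1 f x + derive1 g x) by apply: IH; [case: Cf|case: Cg].
apply: CkS H => t; have Df := Ck_der t Cf; have Dg := Ck_der t Cg.
exact: is_deriveD.
Qed.

Lemma CkM n f g : Ck n f -> Ck n g -> Ck n (fun x => f x * g x).
Proof.
elim: n f g => // n IH f g Cf Cg.
have H : Ck n (fun x => f x * derive1 g x + g x * derive1 f x).
  by apply: CkD; apply: IH; (first [by case: Cf|by case: Cg|exact: CkW]).
apply: CkS H => t; have Df := Ck_der t Cf; have Dg := Ck_der t Cg.
exact: is_deriveM.
Qed.

Lemma Ck_comp n f g : Ck n f -> Ck n g -> Ck n (fun x => f (g x)).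
Proof.
elim: n f g => // n IH f g Cf Cg.
have H : Ck n (fun x => derive1 f (g x) * derive1 g x).
  apply: CkM; last by case: Cg.
  by apply: IH; [case: Cf|exact: CkW].
apply: CkS H => t; have Df := Ck_der (g t) Cf; have Dg := Ck_der t Cg.
exact: is_derive1_comp.
Qed.

Lemma CkV n f : (forall t, f t != 0) -> Ck n f -> Ck n (fun x => (f x)^-1).
Proof.
move=> f0; elim: n => // n IH Cf.
have H : Ck n (fun x => - 1 * ((f x)^-1 * (f x)^-1) * derive1 f x).
  apply: CkM; last by case: Cf.
  apply: CkM; last by apply: CkM; apply: IH; exact: CkW.
  exact: Ck_cst.
apply: CkS H => t; have Df := Ck_der t Cf.
have H : derivable (fun x => (f x)^-1) t 1 by apply: derivableV.
have := derivableP H; rewrite (deriveV (f0 t)); last by case: Df.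
move=> {}H; apply: (is_derive_eq H).
by rewrite derive_val /GRing.scale /= -expr2 exprVn mulN1r.
Qed.

Lemma smoothR_cst (a : R) : smoothR (fun=> a).
Proof. by apply/smoothRP => n; exact: Ck_cst. Qed.

Lemma smoothR_id : smoothR (fun x : R => x).
Proof.
by apply/smoothRP => -[|n] //; apply: (@CkS _ _ (fun=> 1)) (Ck_cst n 1).
Qed.

Lemma smoothRD f g : smoothR f -> smoothR g -> smoothR (fun x => f x + g x).
Proof. by move=> /smoothRP sf /smoothRP sg; apply/smoothRP => n; exact: CkD. Qed.

Lemma smoothRM f g : smoothR f -> smoothR g -> smoothR (fun x => f x * g x).
Proof. by move=> /smoothRP sf /smoothRP sg; apply/smoothRP => n; exact: CkM. Qed.

Lemma smoothR_comp f g : smoothR f -> smoothR g -> smoothR (fun x => f (g x)).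
Proof.
by move=> /smoothRP sf /smoothRP sg; apply/smoothRP => n; exact: Ck_comp.
Qed.

Lemma smoothRV f :
  (forall t, f t != 0) -> smoothR f -> smoothR (fun x => (f x)^-1).
Proof. by move=> f0 /smoothRP sf; apply/smoothRP => n; exact: CkV. Qed.

Lemma smoothRN f : smoothR f -> smoothR (fun x => - f x).
Proof.
move=> sf; have -> : (fun x => - f x) = (fun x => -1 * f x).
  by apply/funext => x; rewrite mulN1r.
by apply: smoothRM => //; exact: smoothR_cst.
Qed.

Lemma smoothRB f g : smoothR f -> smoothR g -> smoothR (fun x => f x - g x).
Proof. by move=> sf sg; apply: smoothRD => //; exact: smoothRN. Qed.

Lemma smoothR_derive1n n f : smoothR f -> smoothR (derive1n n f).
Proof.
by elim: n => // n IH sf; rewrite derive1nS; exact/smoothR_derive1/IH.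
Qed.

Lemma smoothR_dern n f t : smoothR f -> is_derive t 1 (derive1n n f) (derive1n n.+1 f t).
Proof. by move=> sf; rewrite derive1nS; exact/smoothR_der/smoothR_derive1n. Qed.

Lemma smoothR_cont f : smoothR f -> continuous f.
Proof.
move=> sf t; apply: differentiable_continuous; apply/derivable1_diffP.
by have [] := smoothR_der t sf.
Qed.

Lemma nearRP (t : R) (P : R -> Prop) :
  (exists2 e, 0 < e & forall s, `|s - t| < e -> P s) <-> \forall s \near t, P s.
Proof.
split=> [[e e0 He]|/nbhs_ballP[e /= e0 He]].
  by apply/nbhs_ballP; exists e => //= s; rewrite /ball /= distrC; exact: He.
by exists e => // s se; apply: He; rewrite /ball /= distrC.
Qed.

Lemma derive1n_near n f g t :
  (\forall s \near t, f s = g s) -> derive1n n f t = derive1n n g t.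
Proof.
move=> fg; suff : \forall s \near t, derive1n n f s = derive1n n g s.
  by move=> /nbhs_singleton.
elim: n => [//|n IH]; rewrite !derive1nS.
have := near_join IH; apply: filterS => s H.
by rewrite !derive1E; exact: near_eq_derive.
Qed.

(** The difference quotient differs from l by at most C |h|. Derivatives at points where no formula
    is at hand (flat, glued and limit functions) are all found through such a quadratic
    remainder. *)
Lemma is_derive_quad f t (l e C : R) : 0 < e ->
  (forall h, `|h| < e -> `|f (t + h) - f t - l * h| <= C * h ^+ 2) ->
  is_derive t 1 f l.
Proof.
move=> e0 H; apply/has_derivR; rewrite /has_deriv.
apply/cvgrPdist_le => /= eps eps0.
have C0 : 0 < `|C| + 1 by rewrite ltr_wpDl.
near=> h.
have h0 : h != 0 by near: h; exact: nbhs_dnbhs_neq.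
have he : `|h| < e by near: h; apply: dnbhs0_lt.
have hC : `|h| < eps / (`|C| + 1) by near: h; apply: dnbhs0_lt; rewrite divr_gt0.
have -> : l - h^-1 *: (f (t + h) - f t : R^o) = - (h^-1 * (f (t + h) - f t - l * h)).
  by rewrite /GRing.scale /=; field.
rewrite normrN normrM normfV ler_pdivrMl ?normr_gt0 //.
apply: le_trans (H _ he) _.
rewrite -real_normK ?num_real // expr2 mulrA mulrC ler_pM2l ?normr_gt0 //.
rewrite ltr_pdivlMr // in hC.
have : C <= `|C| by exact: ler_norm.
have := normr_ge0 h; nra.
Unshelve. all: by end_near. Qed.

(** The mean value theorem, applied to f and then to its derivative, which accounts for M in place
    of M / 2. *)
Lemma taylor2 f (M : R) (a h : R) : smoothR f ->
  (forall s, `|s - a| <= `|h| -> `|derive1n 2 f s| <= M) ->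
  `|f (a + h) - f a - derive1 f a * h| <= M * h ^+ 2.
Proof.
move=> sf HM.
have wc (g : R -> R) (u v : R) : smoothR g -> {within `[u, v], continuous g}.
  by move=> sg; exact/continuous_subspaceT/smoothR_cont.
have mvt (g : R -> R) (u v : R) : smoothR g ->
    exists2 c, `|c - u| <= `|v - u| & g v - g u = derive1 g c * (v - u).
  move=> sg; have [uv|vu] := leP u v.
    have [] := @MVT_segment R g (derive1 g) u v uv _ (wc g u v sg).
      by move=> x _; exact: smoothR_der.
    move=> c; rewrite in_itv /= => /andP[uc cv] ->; exists c => //.
    by rewrite !ger0_norm ?subr_ge0 // lerB.
  have [] := @MVT_segment R g (derive1 g) v u (ltW vu) _ (wc g v u sg).
    by move=> x _; exact: smoothR_der.
  move=> c; rewrite in_itv /= => /andP[vc cu] H; exists c.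
    by rewrite !ler0_norm ?subr_le0 // ?(ltW vu) // lerN2 lerB.
  by rewrite -opprB H -mulrN opprB.
have [c ch] := mvt f a (a + h) sf.
have := mvt _ a c (smoothR_derive1 sf); case=> d dc Hd.
rewrite [a + h - a]addrC addKr => ->.
rewrite [a + h - a]addrC addKr in ch.
rewrite -mulrBl Hd !normrM -(real_normK (num_real h)) expr2 mulrA.
apply: ler_wpM2r => //; apply: ler_pM => //.
by apply: HM; exact: le_trans dc ch.
Qed.

End SmoothCurves.

(** * Flat functions, bumps and cutoffs *)

Section Bump.
Context {R : realType}.
Implicit Types (f g : R -> R) (s t x : R).

(** The functions x^-k exp(-1/x), extended by 0 to x <= 0, are closed under differentiation up to
    linear combinations, so one induction on the order proves all of them smooth. *)
Definition flat (k : nat) (x : R) : R :=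
  if 0 < x then x^-1 ^+ k * expR (- x^-1) else 0.

(** For x > 0 and y = 1/x this is y^(k+2) <= (k+2)! exp y, a single term of the exponential series.
    The factor x^2 makes the derivative at 0 vanish. *)
Lemma flat_bound k x : `|flat k x| <= (k.+2)`!%:R * x ^+ 2.
Proof.
rewrite /flat; case: ifPn => [x0|_]; last first.
  by rewrite normr0 mulr_ge0 // sqr_ge0.
have y0 : 0 < x^-1 by rewrite invr_gt0.
rewrite ger0_norm; last by rewrite mulr_ge0 ?expR_ge0 // exprn_ge0 // ltW.
have -> : x ^+ 2 = (x^-1 ^+ 2)^-1 by rewrite exprVn invrK.
rewrite ler_pdivlMr ?exprn_gt0 // mulrAC -exprD addn2 expRN.
rewrite ler_pdivrMr ?expR_gt0 // mulrC -ler_pdivrMr ?ltr0n ?fact_gt0 //.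
by apply: le_trans (expR_ge1Dxn k.+1 (ltW y0)); rewrite lerDr.
Qed.

Lemma flat_deriv k x :
  is_derive x 1 (flat k) (flat k.+2 x - k%:R * flat k.+1 x).
Proof.
have [x0|x0|<-] := ltgtP 0 x; last first.
- have -> : flat k.+2 0 - k%:R * flat k.+1 0 = 0.
    by rewrite /flat ltxx mulr0 subrr.
  apply: (@is_derive_quad _ _ _ _ 1 (k.+2)`!%:R) => // h _.
  rewrite add0r mul0r subr0 [flat k 0]/flat ltxx subr0; exact: flat_bound.
- have -> : flat k.+2 x - k%:R * flat k.+1 x = 0.
    by rewrite /flat (lt_gtF x0) mulr0 subrr.
  apply: (@near_eq_is_derive _ _ _ (fun=> 0)).
  apply/nearRP; exists (- x); first by rewrite oppr_gt0.
  move=> s sx; rewrite /flat ltNge; have -> // : s <= 0.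
  by have := ler_norm (s - x); lra.
have Hi : is_derive x 1 (fun x : R => x^-1) (- x ^- 2).
  have H : derivable (fun x : R => x^-1) x 1.
    by apply: derivableV => //; rewrite gt_eqF.
  have := derivableP H; rewrite (@deriveV _ _ id) ?gt_eqF //.
  by rewrite derive_id /GRing.scale /= mulr1.
have He : is_derive x 1 (fun x : R => expR (- x^-1)) (expR (- x^-1) * x ^- 2).
  have Hn : is_derive x 1 (fun x : R => - x^-1) (- - x ^- 2) by exact: is_deriveN.
  rewrite -[x ^- 2]opprK.
  exact: (@is_derive1_comp _ (@expR R) (fun x : R => - x^-1)).
have Hk : is_derive x 1 (fun x : R => x^-1 ^+ k) (k%:R * x^-1 ^+ k.-1 * - x ^- 2).
  have Hx : is_derive x^-1 1 (fun y : R => y ^+ k) (k%:R * x^-1 ^+ k.-1).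
    have := derivableP (@exprn_derivable R k x^-1 1).
    by rewrite exp_derive /GRing.scale /= mulr1.
  exact: (@is_derive1_comp _ (fun y : R => y ^+ k) (fun x : R => x^-1)).
apply: (@near_eq_is_derive _ _ _ (fun x : R => x^-1 ^+ k * expR (- x^-1))).
  apply/nearRP; exists x => // s sx; rewrite /flat ifT //.
  by have := ler_norm (x - s); rewrite distrC; lra.
apply: (is_derive_eq (is_deriveM Hk He)).
rewrite /flat x0 /GRing.scale /= -!exprVn; case: (k) => [|m] /=.
  by rewrite !mul0r mulr0 subr0 addr0 expr0; ring.
by rewrite !exprS; ring.
Qed.

Lemma smoothR_flat k : smoothR (flat k).
Proof.
apply/smoothRP => n; elim: n k => // n IH k.
have H : Ck n (fun x => flat k.+2 x + (- k%:R) * flat k.+1 x).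
  by apply: CkD => //; apply: CkM => //; exact: Ck_cst.
by apply: CkS H => t; apply: (is_derive_eq (flat_deriv k t)); rewrite mulNr.
Qed.

Definition smooth_step (x : R) := flat 0 x / (flat 0 x + flat 0 (1 - x)).

Lemma flat_gt0 k x : 0 < x -> 0 < flat k x.
Proof.
by move=> x0; rewrite /flat x0 mulr_gt0 ?expR_gt0 // exprn_gt0 // invr_gt0.
Qed.

Lemma flat_ge0 k x : 0 <= flat k x.
Proof.
have [/flat_gt0/ltW //|x0] := ltP 0 x.
by rewrite /flat ltNge x0.
Qed.

Lemma flat_eq0 k x : x <= 0 -> flat k x = 0.
Proof. by move=> x0; rewrite /flat ltNge x0. Qed.

Lemma step_den_gt0 x : 0 < flat 0 x + flat 0 (1 - x).
Proof.
have [x0|x0] := ltP 0 x; first by rewrite ltr_pwDl ?flat_gt0 ?flat_ge0.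
by rewrite ltr_wpDl ?flat_ge0 // flat_gt0 //; lra.
Qed.

Lemma smoothR_step : smoothR smooth_step.
Proof.
apply: smoothRM; first exact: smoothR_flat.
apply: smoothRV => [t|]; first by rewrite gt_eqF // step_den_gt0.
apply: smoothRD; first exact: smoothR_flat.
apply: smoothR_comp; first exact: smoothR_flat.
by apply: smoothRB; [exact: smoothR_cst|exact: smoothR_id].
Qed.

(** The argument 2 (1 - x^2) is at least 1 for |x| <= 1/2 and at most 0 for |x| >= 1: an even bump,
    equal to 1 on the inner half of [-1, 1] and to 0 outside. *)
Definition plateau (x : R) := smooth_step (2 * (1 - x * x)).

Lemma smoothR_plateau : smoothR plateau.
Proof.
apply: smoothR_comp; first exact: smoothR_step.
apply: smoothRM; first exact: smoothR_cst.
apply: smoothRB; first exact: smoothR_cst.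
by apply: smoothRM; exact: smoothR_id.
Qed.

Lemma plateau1 x : `|x| <= 2^-1 -> plateau x = 1.
Proof.
move=> xh; rewrite /plateau /smooth_step (@flat_eq0 0 (1 - _)).
  rewrite addr0 divff // gt_eqF // flat_gt0 //.
  by rewrite -expr2 -real_normK ?num_real //; have := normr_ge0 x; nra.
by rewrite -expr2 -real_normK ?num_real //; have := normr_ge0 x; nra.
Qed.

Lemma plateau0 x : 1 <= `|x| -> plateau x = 0.
Proof.
move=> xh; rewrite /plateau /smooth_step flat_eq0 ?mul0r //.
by rewrite -expr2 -real_normK ?num_real //; have := normr_ge0 x; nra.
Qed.

Lemma plateau_ge0 x : 0 <= plateau x.
Proof. by rewrite divr_ge0 ?flat_ge0 // ltW // step_den_gt0. Qed.

Lemma plateau_le1 x : plateau x <= 1.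
Proof.
by rewrite /plateau /smooth_step ler_pdivrMr ?step_den_gt0 // mul1r lerDl flat_ge0.
Qed.

(** Precomposition with f keeps the parameter in [-e, e] without changing germs at 0; this is how a
    locally defined curve or planar map is made total. *)
Lemma cutoff (e : R) : 0 < e -> exists2 f, smoothR f &
  (forall t, `|f t| <= e) /\ (forall t, `|t| < e / 2 -> f t = t).
Proof.
move=> e0; exists (fun t => t * plateau (t / e)); last split => t.
- apply: smoothRM; first exact: smoothR_id.
  apply: smoothR_comp; first exact: smoothR_plateau.
  by apply: smoothRM; [exact: smoothR_id|exact: smoothR_cst].
- have [te|et] := ltP `|t| e.
    rewrite normrM (ger0_norm (plateau_ge0 _)).
    by have := plateau_le1 (t / e); have := plateau_ge0 (t / e); have := normr_ge0 t; nra.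
  rewrite plateau0 ?mulr0 ?normr0 ?(ltW e0) //.
  by rewrite normrM normfV (gtr0_norm e0) ler_pdivlMr // mul1r.
- move=> te; rewrite plateau1 ?mulr1 // normrM normfV (gtr0_norm e0).
  by rewrite ler_pdivrMr // mulrC ltW.
Qed.

End Bump.

(** * Smooth curves through fast converging sequences *)

Section CurveLemma.
Context {R : realType}.
Implicit Types (f g : R -> R) (s t x : R).

(* The curve passes its j-th point at time [node j], on the interval [piece j] of
   length 2 / [speed j]; [tiny] decays faster than every power of [speed]
   grows, so that all derivatives stay bounded near 0. *)
Definition node (j : nat) : R := 2^-1 ^+ j.
Definition speed (j : nat) : R := 2 ^+ (j + 2).
Definition tiny (j : nat) : R := 2^-1 ^+ (j ^ 2).

Lemma node_gt0 j : 0 < node j.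
Proof. by rewrite exprn_gt0 // invr_gt0. Qed.

Lemma speed_gt0 j : 0 < speed j.
Proof. by rewrite exprn_gt0. Qed.

Lemma tiny_gt0 j : 0 < tiny j.
Proof. by rewrite exprn_gt0 // invr_gt0. Qed.

Lemma node_speed j : node j * speed j = 4.
Proof. by rewrite /node /speed exprD mulrA -exprMn mulVf // expr1n; ring. Qed.

(** The exponent (j + 2) k - j^2 is bounded independently of j because j k <= j^2 + k^2. *)
Lemma tiny_speed j k : tiny j * speed j ^+ k <= 2 ^+ (k ^ 2 + 2 * k).
Proof.
rewrite /tiny /speed exprVn -exprM ler_pdivrMl ?exprn_gt0 // -exprD.
by rewrite ler_eXn2l ?ltr1n //; nia.
Qed.

Lemma ler_half i j : (i <= j)%N -> (2^-1 : R) ^+ j <= 2^-1 ^+ i.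
Proof. by move=> ij; apply: ler_wiXn2l => //; lra. Qed.

Lemma node_lt (e : R) : 0 < e -> exists J, forall j, (J <= j)%N -> node j < e.
Proof.
move=> e0; pose J := Num.bound e^-1; exists J => j Jj.
apply: le_lt_trans (ler_half Jj) _.
rewrite exprVn invf_plt ?posrE ?exprn_gt0 //.
have H : e^-1 < J%:R by apply: archi_boundP; rewrite invr_ge0 ltW.
apply: lt_le_trans H _; rewrite -natrX ler_nat ltnW // ltn_expl //.
Qed.

Lemma node_cvg : node @ \oo --> (0 : R).
Proof.
apply/cvgrPdist_lt => e e0; have [J HJ] := node_lt e0.
exists J => // j Jj; rewrite sub0r normrN gtr0_norm ?node_gt0 //; exact: HJ.
Qed.

Definition piece j : set R := [set t | `|speed j * (t - node j)| <= 1].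

(** Since node j * speed j = 4, [piece j] is the interval [3/4, 5/4] scaled by 2^-j, and 5/4 of
    2^-(j+1) is less than 3/4 of 2^-j. *)
Lemma piece_disjoint i j t : piece i t -> piece j t -> i = j.
Proof.
wlog ij : i j / (i < j)%N => [H pi pj|].
  by have [ij|ji|//] := ltngtP i j; [exact: H|symmetry; exact: H].
rewrite /piece /= => pi pj; exfalso.
have H k : `|speed k * (t - node k)| <= 1 -> `|t - node k| <= node k / 4.
  rewrite normrM gtr0_norm ?speed_gt0 // -(node_speed k) => H.
  have s0 := speed_gt0 k; have n0 := node_gt0 k.
  by rewrite ler_pdivlMr ?mulr_gt0 //; nra.
have n : node j <= node i / 2.
  by rewrite /node -exprSr; exact: ler_half.
move: (H _ pi) (H _ pj); rewrite !ler_norml => /andP[? ?] /andP[? ?].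
by have := node_gt0 i; lra.
Qed.

Lemma piece_node j : piece j (node j).
Proof. by rewrite /piece /= subrr mulr0 normr0. Qed.

(** The default index 0 at times outside all pieces is harmless: the functions indexed by [pidx]
    vanish off their own piece. *)
Definition pidx t : nat := xget 0%N [set j | piece j t].

Lemma pidxE j t : piece j t -> pidx t = j.
Proof.
move=> pj; rewrite /pidx; case: xgetP => [i _ pi|/(_ j)//].
exact: piece_disjoint pi pj.
Qed.

Lemma pidx0 : ~ piece (pidx 0) 0.
Proof.
rewrite /piece /= sub0r mulrN normrN ger0_norm.
  by rewrite mulrC node_speed; lra.
by rewrite mulr_ge0 // ltW // ?speed_gt0 ?node_gt0.
Qed.

Lemma derive1n_cst k (a : R) t : derive1n k.+1 (fun=> a) t = 0.
Proof.
elim: k t => [|k IH] t; first by rewrite derive1n1; exact: derive1_cst.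
rewrite derive1nS (_ : derive1n k.+1 _ = fun=> 0); last exact/funext.
exact: derive1_cst.
Qed.

Lemma derive1n0_near k f t :
  (\forall s \near t, f s = 0) -> derive1n k f t = 0.
Proof.
move=> /(derive1n_near k) ->; case: k => // k; exact: derive1n_cst.
Qed.

Lemma derive1n_off_piece j k f t :
  (forall s, ~ piece j s -> f s = 0) -> ~ piece j t -> derive1n k f t = 0.
Proof.
move=> f0 /negP; rewrite -ltNge => pt; apply: derive1n0_near.
have : continuous (fun s => `|speed j * (s - node j)|).
  move=> s; apply: cvg_norm; move: s; apply: smoothR_cont; apply: smoothRM; first exact: smoothR_cst.
  by apply: smoothRB; [exact: smoothR_id|exact: smoothR_cst].
move=> /(_ t) /cvgr_gt /(_ _ pt); apply: filterS => s; rewrite ltNge => /negP.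
exact: f0.
Qed.

(** The derivative is glued from the derivatives, which satisfy the same hypotheses, so coinduction
    applies. The delicate time is 0, where the pieces accumulate; the uniform bound on second
    derivatives gives a quadratic remainder there as elsewhere. *)
Lemma smooth_glue (psi : nat -> R -> R) :
  (forall j, smoothR (psi j)) ->
  (forall k, exists C, forall j t, `|derive1n k (psi j) t| <= C) ->
  (forall j t, ~ piece j t -> psi j t = 0) ->
  smoothR (fun t => psi (pidx t) t).
Proof.
move=> s1 s2 s3; pose P f := exists psi,
  [/\ forall j, smoothR (psi j),
      forall k, exists C, forall j t, `|derive1n k (psi j) t| <= C,
      forall j t, ~ piece j t -> psi j t = 0 & f = fun t => psi (pidx t) t].
apply: (@smooth_coind R R^o P); last by exists psi.
move=> {s1 s2 s3}f [{}psi [s1 s2 s3 ->]].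
exists (fun t => derive1 (psi (pidx t)) t).
  exists (fun j => derive1 (psi j)); split => //.
  - by move=> j; exact: smoothR_derive1.
  - move=> k; have [C HC] := s2 k.+1; exists C => j t; rewrite -derive1Sn; exact: HC.
  - by move=> j t /(derive1n_off_piece 1 (s3 j)); rewrite derive1n1.
move=> t; apply/has_derivR; have [C HC] := s2 2%N.
have C0 : 0 <= C by exact: le_trans (HC 0%N 0).
apply: (@is_derive_quad _ _ _ _ 1 (C + C)) => // h _.
have T j : `|psi j (t + h) - psi j t - derive1 (psi j) t * h| <= C * h ^+ 2.
  by apply: taylor2 => // s _; exact: HC.
have h0 : 0 <= C * h ^+ 2 by rewrite mulr_ge0 // sqr_ge0.
have [<-|ij] := pselect (pidx t = pidx (t + h)).
  by rewrite mulrDl; apply: le_trans (T _) _; rewrite lerDl.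
have off i s : pidx s <> i -> psi i s = 0 /\ derive1 (psi i) s = 0.
  move=> si; have pi : ~ piece i s by move=> /pidxE.
  by split; [exact: s3|rewrite -derive1n1; exact: (derive1n_off_piece _ (s3 i))].
have [z1 _] := off (pidx t) (t + h) (fun e => ij (esym e)).
have [z2 z3] := off (pidx (t + h)) t ij.
(* For different indices the function of t vanishes at t + h, and that of t + h vanishes at t
   together with its derivative; the remainder splits into two Taylor remainders, whence C + C. *)
have -> : psi (pidx (t + h)) (t + h) - psi (pidx t) t - derive1 (psi (pidx t)) t * h =
  (psi (pidx t) (t + h) - psi (pidx t) t - derive1 (psi (pidx t)) t * h) +
  (psi (pidx (t + h)) (t + h) - psi (pidx (t + h)) t
     - derive1 (psi (pidx (t + h))) t * h) by rewrite z1 z2 z3; ring.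
by rewrite mulrDl; apply: le_trans (ler_normD _ _) _; rewrite lerD.
Qed.

Lemma derive1n_affine k (c a b : R) f t : smoothR f ->
  derive1n k (fun t => c * f (a * (t - b))) t =
  c * a ^+ k * derive1n k f (a * (t - b)).
Proof.
move=> sf; elim: k t => [|k IH] t; first by rewrite expr0 mulr1.
rewrite derive1nS (_ : derive1n k _ = fun t => c * a ^+ k * derive1n k f (a * (t - b)));
  last exact/funext.
apply: is_derive_derive1.
have Ha : is_derive t 1 (fun t : R => a * (t - b)) a.
  have : is_derive t 1 (fun t : R => a *: (t - b)) (a *: (1 - 0)).
    by apply: is_deriveZ; apply: is_deriveB.
  by rewrite subr0 /GRing.scale /= mulr1.
have Hf := smoothR_dern k (a * (t - b)) sf.
have H : is_derive t 1 (fun t => derive1n k f (a * (t - b)))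
   (derive1n k.+1 f (a * (t - b)) * a).
  exact: (@is_derive1_comp _ (derive1n k f) (fun t : R => a * (t - b))).
have := @is_deriveZ R R^o R^o _ (c * a ^+ k) _ _ _ H.
by move=> {}H; apply: (is_derive_eq H); rewrite /GRing.scale /= exprSr; ring.
Qed.

Definition flat_ends f := smoothR f /\ (forall t, 1 <= `|t| -> f t = 0).

Lemma flat_ends_bounded k f : flat_ends f ->
  exists C, forall t, `|derive1n k f t| <= C.
Proof.
move=> [sf f0]; pose g t := `|derive1n k f t|.
have cg : continuous g.
  by move=> t; apply: cvg_norm; exact: smoothR_cont (smoothR_derive1n k sf) t.
have [|c _ Hc] := @EVT_max R g (-1) 1 _ (continuous_subspaceT cg); first by lra.
exists (g c) => t; have [t1|t1] := leP `|t| 1.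
  by apply: Hc; rewrite in_itv /= -ler_norml.
rewrite (_ : derive1n k f t = 0) ?normr0 ?normr_ge0 //.
apply: derive1n0_near; have := @norm_continuous _ _ t => /cvgr_gt /(_ _ t1).
by apply: filterS => s /ltW; exact: f0.
Qed.

(** The special curve lemma of convenient calculus for scalar coefficients: the k-th derivative on
    piece j is at most a constant times tiny j * speed j ^+ k, which [tiny_speed] bounds uniformly
    in j. *)
Lemma smooth_curve_lemma (beta : R -> R) (lam : nat -> R) (L : R) :
  flat_ends beta -> (forall j, `|lam j| <= L * tiny j) ->
  smoothR (fun t => lam (pidx t) * beta (speed (pidx t) * (t - node (pidx t)))).
Proof.
move=> [sb b0] Hlam.
apply: (@smooth_glue (fun j t => lam j * beta (speed j * (t - node j)))).
- move=> j; apply: smoothRM; first exact: smoothR_cst.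
  apply: smoothR_comp => //; apply: smoothRM; first exact: smoothR_cst.
  by apply: smoothRB; [exact: smoothR_id|exact: smoothR_cst].
- move=> k; have [B HB] := @flat_ends_bounded k beta (conj sb b0).
  exists (L * 2 ^+ (k ^ 2 + 2 * k) * B) => j t; rewrite derive1n_affine //.
  have B0 : 0 <= B by exact: le_trans (HB 0).
  have L0 : 0 <= L.
    have := le_trans (normr_ge0 _) (Hlam 0%N).
    by rewrite pmulr_lge0 ?tiny_gt0.
  rewrite normrM ler_pM // normrM normrX (gtr0_norm (speed_gt0 j)).
  apply: (@le_trans _ _ (L * tiny j * speed j ^+ k)).
    by apply: ler_wpM2r => //; rewrite exprn_ge0 // ltW // speed_gt0.
  by rewrite -mulrA ler_wpM2l // tiny_speed.
- move=> j t /negP; rewrite -ltNge => /ltW tj; rewrite b0 ?mulr0 //.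
Qed.

Lemma flat_ends_plateau : flat_ends (@plateau R).
Proof. by split; [exact: smoothR_plateau|exact: plateau0]. Qed.

Lemma flat_ends_idplateau : flat_ends (fun t => t * @plateau R t).
Proof.
split; first by apply: smoothRM; [exact: smoothR_id|exact: smoothR_plateau].
by move=> t t1; rewrite plateau0 ?mulr0.
Qed.

End CurveLemma.

(** * Boman's theorem in the plane *)

Section Boman.
Context {R : realType}.
Implicit Types (f phi : R -> R) (g : R -> R -> R) (s t x y : R).

Definition smooth2 g := forall a b : R -> R, smoothR a -> smoothR b ->
  smoothR (fun r => g (a r) (b r)).

(** In the rescaled time z = speed j * (t - node j) the function is affine on the inner half of
    [piece j], where the plateau is 1. Two such functions share their nodes, hence form a plane
    curve that follows a prescribed line near each node and is at the origin at time 0. *)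
Lemma line_curve (x u : nat -> R) :
  (forall j, `|x j| <= tiny j) -> (forall j, `|u j| <= tiny j) ->
  exists a : R -> R, [/\ smoothR a, a 0 = 0 & forall j t,
    `|speed j * (t - node j)| <= 2^-1 -> a t = x j + u j * (speed j * (t - node j))].
Proof.
move=> hx hu.
pose z t := speed (pidx t) * (t - node (pidx t)).
exists (fun t => x (pidx t) * plateau (z t) + u (pidx t) * (z t * plateau (z t))).
split.
- apply: smoothRD.
    by apply: (smooth_curve_lemma (L := 1) flat_ends_plateau) => j; rewrite mul1r.
  by apply: (smooth_curve_lemma (L := 1) flat_ends_idplateau) => j; rewrite mul1r.
- have /negP := @pidx0 R; rewrite -ltNge => /ltW H.
  by rewrite plateau0 // !mulr0 addr0.
- move=> j t H; have pj : piece j t by rewrite /piece /=; lra.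
  by rewrite /z (pidxE pj) plateau1 // !mulr1.
Qed.

(** Otherwise there are lines through points within [tiny j] of the origin along which the n-th
    derivative exceeds j / (tiny j * speed j)^n. One smooth curve follows the j-th line near
    [node j] with speed factor tiny j * speed j; along it the n-th derivative of g exceeds j at
    [node j], although it is continuous at 0. *)
Lemma boman_bound g n : smooth2 g -> exists2 d : R, 0 < d & exists C : R,
  forall x y u v : R, `|x| <= d -> `|y| <= d -> `|u| <= 1 -> `|v| <= 1 ->
  `|derive1n n (fun t : R => g (x + t * u) (y + t * v)) 0| <= C.
Proof.
move=> sg; apply: contrapT => H.
have H1 j : exists w : R * R * (R * R),
   [/\ `|w.1.1| <= tiny j, `|w.1.2| <= tiny j, `|w.2.1| <= 1, `|w.2.2| <= 1 &
    j%:R < (tiny j * speed j) ^+ n *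
    `|derive1n n (fun t : R => g (w.1.1 + t * w.2.1) (w.1.2 + t * w.2.2)) 0|].
  apply: contrapT => Hj; apply: H; exists (tiny j); first exact: tiny_gt0.
  exists (j%:R / (tiny j * speed j) ^+ n) => x y u v hx hy hu hv.
  rewrite ler_pdivlMr ?exprn_gt0 ?mulr_gt0 ?tiny_gt0 ?speed_gt0 // mulrC leNgt.
  by apply/negP => Hlt; apply: Hj; exists (x, y, (u, v)).
have {H1}/choice[w Hw] := H1.
have [a [sa a0 aE]] : exists a : R -> R, [/\ smoothR a, a 0 = 0 & forall j t,
    `|speed j * (t - node j)| <= 2^-1 ->
    a t = (w j).1.1 + (tiny j * (w j).2.1) * (speed j * (t - node j))].
  apply: line_curve => j; have [] // := Hw j; move=> _ _ H1 _ _.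
  by rewrite normrM (gtr0_norm (tiny_gt0 j)) ler_piMr // ltW // tiny_gt0.
have [b [sb b0 bE]] : exists a : R -> R, [/\ smoothR a, a 0 = 0 & forall j t,
    `|speed j * (t - node j)| <= 2^-1 ->
    a t = (w j).1.2 + (tiny j * (w j).2.2) * (speed j * (t - node j))].
  apply: line_curve => j; have [] // := Hw j; move=> _ _ _ H1 _.
  by rewrite normrM (gtr0_norm (tiny_gt0 j)) ler_piMr // ltW // tiny_gt0.
pose G t := g (a t) (b t).
have sG : smoothR G by exact: sg.
have GE j : j%:R < `|derive1n n G (node j)|.
  have [_ _ _ _ Hj] := Hw j; apply: (lt_le_trans Hj).
  set psi := (fun t : R => _).
  have spsi : smoothR psi.
    by apply: sg; apply: smoothRD; try exact: smoothR_cst;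
      apply: smoothRM; [exact: smoothR_id|exact: smoothR_cst|
      exact: smoothR_id|exact: smoothR_cst].
  have : derive1n n G (node j) =
      derive1n n (fun t => 1 * psi (tiny j * speed j * (t - node j))) (node j).
    apply: derive1n_near; apply/nearRP; exists (2^-1 / speed j).
      by rewrite divr_gt0 ?speed_gt0.
    move=> s; rewrite ltr_pdivlMr ?speed_gt0 // => hs.
    have hs' : `|speed j * (s - node j)| <= 2^-1.
      by rewrite normrM gtr0_norm ?speed_gt0 // mulrC ltW.
    rewrite /G (aE j) // (bE j) // mul1r /psi; congr g; ring.
  move=> ->; rewrite derive1n_affine // subrr mulr0 mul1r normrM ler_wpM2r //.
  exact: ler_norm.
have cv : derive1n n G (node j) @[j --> \oo] --> derive1n n G 0.
  exact: (cvg_comp _ _ node_cvg (@smoothR_cont _ _ (smoothR_derive1n n sG) 0)).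
set L := derive1n n G 0 in cv; have L1 : `|L| < `|L| + 1 by rewrite ltrDl.
have [J _ HJ] := cvgr_norm_lt _ cv _ L1.
pose K := maxn J (Num.bound (`|L| + 1)).
have := HJ K (leq_maxl _ _); have := GE K => /= h1 h2.
have h3 : `|L| + 1 < (Num.bound (`|L| + 1))%:R by apply: archi_boundP; rewrite addr_ge0.
have h4 : (Num.bound (`|L| + 1))%:R <= K%:R :> R by rewrite ler_nat leq_maxr.
by have := lt_trans (lt_le_trans h3 h4) (lt_trans h1 h2); rewrite ltxx.
Qed.

End Boman.

(** * Finite differences and polarization *)

Section Differences.
Context {R : realType}.
Implicit Types (f phi : R -> R) (g : R -> R -> R) (s t x y : R).

(* (1 - shift)^n, of sign (-1)^n with respect to the forward difference. *)
Fixpoint fd n (e : R) phi x : R :=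
  if n is m.+1 then fd m e phi x - fd m e phi (x + e) else phi x.

(** The weights are the signed binomials (-1)^j binom(n, j). They depend on n alone, so the same sum
    can be formed along any direction of the plane. *)
Lemma fd_weights n : exists w : nat -> R, w 0%N = 1 /\
  forall e phi x, fd n e phi x = \sum_(j < n.+1) w j * phi (x + j%:R * e).
Proof.
elim: n => [|n [w [w0 IH]]].
  by exists (fun=> 1); split=> // e phi x; rewrite big_ord1 mul1r mul0r addr0.
exists (fun j => (if (j <= n)%N then w j else 0) - (if j is i.+1 then w i else 0)).
split=> [|e phi x]; first by rewrite subr0.
rewrite /= !IH.
under [RHS]eq_bigr do rewrite mulrBl.
rewrite sumrB; congr (_ - _).
  rewrite [RHS]big_ord_recr /= ltnn mul0r addr0.
  by apply: eq_bigr => i _; rewrite -ltnS ltn_ord.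
rewrite [RHS]big_ord_recl /= mul0r add0r.
apply: eq_bigr => i _; congr (_ * phi _).
by rewrite /bump /= add1n mulrSr; ring.
Qed.

Lemma fdB n e phi x :
  fd n e (fun t => phi t - phi (t + e)) x = fd n e phi x - fd n e phi (x + e).
Proof. by elim: n x => //= n IH x; rewrite !IH. Qed.

Lemma fd_sub n e (phi psi : R -> R) x :
  fd n e (fun t => phi t - psi t) x = fd n e phi x - fd n e psi x.
Proof. by elim: n x => //= n IH x; rewrite !IH; ring. Qed.

Lemma derive1nB n f (h : R -> R) t : smoothR f -> smoothR h ->
  derive1n n (fun t => f t - h t) t = derive1n n f t - derive1n n h t.
Proof.
move=> sf sh; elim: n t => // n IH t.
rewrite derive1nS (_ : derive1n n _ = fun t => derive1n n f t - derive1n n h t);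
  last exact/funext.
apply: is_derive_derive1.
have Hf := smoothR_dern n t sf; have Hg := smoothR_dern n t sh.
exact: is_deriveB.
Qed.

Lemma derive1n_shift n f (b t : R) : smoothR f ->
  derive1n n (fun t => f (t + b)) t = derive1n n f (t + b).
Proof.
move=> sf; have -> : (fun t => f (t + b)) = (fun t => 1 * f (1 * (t - - b))).
  by apply/funext => u; rewrite !mul1r opprK.
by rewrite derive1n_affine // expr1n !mul1r opprK.
Qed.

(** Iterated mean value theorem: the induction hypothesis is applied to phi t - phi (t + e), and the
    mean value theorem to the n-th derivative of phi. *)
Lemma fd_mvt n (e : R) phi x : 0 < e -> smoothR phi ->
  exists2 xi, x <= xi <= x + n%:R * e &
    fd n e phi x = (- e) ^+ n * derive1n n phi xi.
Proof.
move=> e0; elim: n phi x => [|n IH] phi x sphi.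
  by exists x; rewrite ?mul0r ?addr0 ?lexx // expr0 mul1r.
have ss : smoothR (fun t => phi (t + e)).
  by apply: smoothR_comp => //; apply: smoothRD; [exact: smoothR_id|exact: smoothR_cst].
have [] := IH (fun t => phi t - phi (t + e)) x; first exact: smoothRB.
move=> z /andP[xz zx]; rewrite fdB derive1nB // derive1n_shift //.
have sn := smoothR_derive1n n sphi.
have [] := @MVT_segment R (derive1n n phi) (derive1n n.+1 phi) z (z + e).
- by rewrite lerDl ltW.
- by move=> u _; exact: smoothR_dern.
- exact/continuous_subspaceT/smoothR_cont.
move=> c; rewrite in_itv /= => /andP[zc cz] H E; exists c.
  by apply/andP; split; [lra|rewrite -natr1; lra].
rewrite /= E -opprB H exprSr; ring.
Qed.

Fixpoint mixed (l : seq (R * R)) g x y : R :=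
  if l is h :: l' then mixed l' g x y - mixed l' g (x + h.1) (y + h.2) else g x y.

Lemma mixed0 l g x y : (0, 0) \in l -> mixed l g x y = 0.
Proof.
elim: l x y => //= h l IH x y; rewrite in_cons => /orP[/eqP <-|H].
  by rewrite /= !addr0 subrr.
by rewrite !IH // subrr.
Qed.

Lemma mixed_nseq k e g x y :
  mixed (nseq k (e, 0)) g x y = fd k e (fun t => g t y) x.
Proof. by elim: k x => //= k IH x; rewrite addr0 !IH. Qed.

(* The factors [1 - j * c] come from Djokovic's polarization identity: expanding
   a mixed difference along h_1, ..., h_n, the terms with j >= 1 of the pure
   n-th differences in the directions - sum_i h_i / i cancel. *)
Definition polar (j : R) (h : R * R * R) : R * R :=
  ((1 - j * h.2) * h.1.1, (1 - j * h.2) * h.1.2).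

(** To be evaluated in two ways. At p = q = 0 and with weights 1/i, the increments annihilated by
    [polar] leave only the term j = 0, a mixed difference; unfolded over l it is a signed sum of 2 ^
    size l pure differences, each along one direction. *)
Definition polar_sum n (w : nat -> R) l g x y (p q : R) : R :=
  \sum_(j < n.+1) w j * mixed (map (polar j%:R) l) g (x + j%:R * p) (y + j%:R * q).

Lemma polar_sum_cons n w h l g x y p q :
  polar_sum n w (h :: l) g x y p q = polar_sum n w l g x y p q -
    polar_sum n w l g (x + h.1.1) (y + h.1.2) (p - h.2 * h.1.1) (q - h.2 * h.1.2).
Proof.
rewrite /polar_sum -sumrB; apply: eq_bigr => j _ /=; rewrite mulrBr.
by congr (_ - _ * mixed _ g _ _); rewrite /polar /=; ring.
Qed.

(** Removing one increment moves the base point by at most e and, since h.2 <= 1, the direction by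
    at most e; this is the slack of size l times e in the four bounds. The number of summands
    doubles each time. *)
Lemma polar_sum_bound n (w : nat -> R) (l : seq (R * R * R)) g (e rho sigma K : R) :
  (forall x y p q : R, `|x| <= rho -> `|y| <= rho -> `|p| <= sigma -> `|q| <= sigma ->
     `|\sum_(j < n.+1) w j * g (x + j%:R * p) (y + j%:R * q)| <= K) ->
  (forall h, h \in l -> [/\ `|h.1.1| <= e, `|h.1.2| <= e & 0 <= h.2 <= 1]) ->
  forall x y p q : R,
    `|x| + (size l)%:R * e <= rho -> `|y| + (size l)%:R * e <= rho ->
    `|p| + (size l)%:R * e <= sigma -> `|q| + (size l)%:R * e <= sigma ->
  `|polar_sum n w l g x y p q| <= 2 ^+ size l * K.
Proof.
move=> HK; elim: l => [|h l IH] Hl x y p q.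
  by rewrite !mul0r !addr0 expr0 mul1r /polar_sum; exact: HK.
have [h1 h2 /andP[h3 h4]] := Hl h (mem_head _ _).
have e0 : 0 <= e by exact: le_trans h1.
have {}IH := IH (fun k kl => Hl k (@mem_behead _ (h :: l) k kl)).
rewrite /= -natr1 mulrDl mul1r => xr yr pr qr.
rewrite polar_sum_cons exprS -mulrA mulrDl mul1r.
apply: le_trans (ler_normB _ _) _; apply: lerD.
  by apply: IH; lra.
have sub (a b c : R) : `|a| <= c -> `|b| <= e -> `|a - h.2 * b| <= c + e.
  move=> ac be; apply: le_trans (ler_normB _ _) _; apply: lerD => //.
  by rewrite normrM (ger0_norm h3); apply: le_trans be; rewrite ler_piMl.
have ad (a b c : R) : `|a| <= c -> `|b| <= e -> `|a + b| <= c + e.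
  by move=> ac be; apply: le_trans (ler_normD _ _) _; apply: lerD.
have X1 := ad x _ _ (lexx _) h1; have X2 := ad y _ _ (lexx _) h2.
have X3 := sub p _ _ (lexx _) h1; have X4 := sub q _ _ (lexx _) h2.
by apply: IH; lra.
Qed.

(** One difference in y and k in x make a mixed difference of order n = k + 1. Polarization reduces
    it to pure n-th differences, which [fd_mvt] turns into n-th directional derivatives, bounded by
    [boman_bound]. *)
Lemma mixed_bound g k : smooth2 g -> exists2 d : R, 0 < d & exists C : R,
  forall e x y : R, 0 < e -> e <= d -> `|x| <= d -> `|y| <= d ->
  `|fd k e (fun t => g t y) x - fd k e (fun t => g t (y + e)) x| <= C * e ^+ k.+1.
Proof.
move=> sg; have [d1 d10 [C1 HC1]] := boman_bound k.+1 sg.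
pose n := k.+1; have [w [w0 Hw]] := fd_weights n.
have n1 : 1 <= n%:R :> R by rewrite ler1n.
(* Base points move by at most n e and are then followed along n steps of length at most n e, so all
   points stay in the square of radius d1 as soon as d (1 + n + n^2) <= d1. *)
exists (d1 / (n%:R + 1) ^+ 2).
  by rewrite divr_gt0 // exprn_gt0 //; lra.
exists (2 ^+ n * (C1 * n%:R ^+ n)) => e x y e0 ed xd yd.
have ed1 : e * (n%:R + 1) ^+ 2 <= d1.
  by rewrite -ler_pdivlMr // exprn_gt0 //; lra.
have xd1 : `|x| * (n%:R + 1) ^+ 2 <= d1.
  by rewrite -ler_pdivlMr // exprn_gt0 //; lra.
have yd1 : `|y| * (n%:R + 1) ^+ 2 <= d1.
  by rewrite -ler_pdivlMr // exprn_gt0 //; lra.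
(* The weights run through 1/i for i = 1, ..., n, so that for every j between 1 and n some factor 1
   - j/i vanishes. *)
pose l : seq (R * R * R) :=
  ((0, e), (n%:R)^-1) :: [seq ((e, 0), (i%:R)^-1) | i <- iota 1 k].
have sl : size l = n by rewrite /= size_map size_iota.
have room z : `|z| <= d1 / (n%:R + 1) ^+ 2 ->
    `|z| + n%:R * e <= d1 - n%:R * (n%:R * e).
  set d := d1 / _ => zd.
  have -> : d1 = d * (n%:R + 1) ^+ 2.
    by rewrite /d divfK // expf_neq0 // gt_eqF //; lra.
  have n0 : 0 <= n%:R :> R by exact: ler0n.
  have e1 := ler_wpM2l n0 ed; have e2 := ler_wpM2l n0 e1; rewrite -/d in e1 e2.
  have d0 : 0 <= d by exact: le_trans zd.
  have := mulr_ge0 n0 d0; rewrite expr2; lra.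
pose sigma := n%:R * e; pose rho := d1 - n%:R * sigma.
have sigma0 : 0 < sigma by rewrite mulr_gt0 //; lra.
have HK (x' y' p q : R) : `|x'| <= rho -> `|y'| <= rho -> `|p| <= sigma -> `|q| <= sigma ->
    `|\sum_(j < n.+1) w j * g (x' + j%:R * p) (y' + j%:R * q)| <= C1 * n%:R ^+ n * e ^+ n.
  move=> xr yr pr qr; pose psi t := g (x' + t * p) (y' + t * q).
  have sA (a b : R) : smoothR (fun t => a + t * b).
    apply: smoothRD; first exact: smoothR_cst.
    by apply: smoothRM; [exact: smoothR_id|exact: smoothR_cst].
  have spsi : smoothR psi by exact: sg.
  have -> : \sum_(j < n.+1) w j * g (x' + j%:R * p) (y' + j%:R * q) = fd n 1 psi 0.
    by rewrite Hw; apply: eq_bigr => j _; rewrite add0r mulr1.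
  have [xi] := @fd_mvt n 1 psi 0 ltr01 spsi.
  rewrite add0r mulr1 => /andP[xi0 xin] ->.
  rewrite normrM normrX normrN normr1 expr1n mul1r.
  pose X := x' + xi * p; pose Y := y' + xi * q.
  (* The direction (p, q) is divided by sigma to meet the unit bound of [boman_bound]; undoing this
     contributes sigma^n = n^n e^n. *)
  pose Psi r := g (X + r * (p / sigma)) (Y + r * (q / sigma)).
  have -> : psi = fun s => 1 * Psi (sigma * (s - xi)).
    have c (a : R) s : a + s * p = a + xi * p + sigma * (s - xi) * (p / sigma).
      by field; rewrite gt_eqF.
    have c' (a : R) s : a + s * q = a + xi * q + sigma * (s - xi) * (q / sigma).
      by field; rewrite gt_eqF.
    by apply/funext => s; rewrite mul1r /psi /Psi /X /Y -c -c'.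
  rewrite derive1n_affine; last exact: sg.
  rewrite subrr mulr0 mul1r normrM normrX (gtr0_norm sigma0) /sigma exprMn.
  rewrite mulrC -[leRHS]mulrA; apply: ler_wpM2r.
    by rewrite mulr_ge0 // exprn_ge0 // ltW.
  have nm (a p' : R) : `|a| <= rho -> `|p'| <= sigma -> `|a + xi * p'| <= d1.
    move=> ar ps; apply: le_trans (ler_normD _ _) _.
    have : `|xi * p'| <= n%:R * sigma by rewrite normrM ger0_norm // ler_pM.
    by rewrite /rho in ar; lra.
  apply: HC1; rewrite ?nm // normrM normfV (gtr0_norm sigma0) ler_pdivrMr // mul1r //.
have := @polar_sum_bound n w l g e rho sigma _ HK _ x y 0 0.
have -> : polar_sum n w l g x y 0 0 =
    fd k e (fun t => g t y) x - fd k e (fun t => g t (y + e)) x.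
  rewrite /polar_sum big_ord_recl w0 mul1r big1 ?addr0; last first.
    move=> j _; rewrite mixed0 ?mulr0 //; apply/mapP.
    have jn : (j.+1%:R : R) != 0 by rewrite pnatr_eq0.
    have [jk|kj] := ltnP j k.
      exists ((e, 0), (j.+1%:R)^-1).
        rewrite in_cons; apply/orP; right; apply/mapP; exists j.+1 => //.
        by rewrite mem_iota /= add1n ltnS.
      by rewrite lift0 /polar /= mulfV // subrr !mul0r.
    exists ((0, e), (n%:R)^-1); first exact: mem_head.
    have Ej : j.+1 = n by apply/eqP; rewrite eqn_leq !ltnS kj -ltnS ltn_ord.
    by rewrite lift0 Ej /polar /= mulfV ?subrr ?mul0r // -Ej.
  rewrite /= /polar /= !mul0r !addr0 subr0 !mul1r.
  have -> : [seq polar 0 i | i <- [seq ((e, 0), (i%:R)^-1) | i <- iota 1 k]] =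
      nseq k (e, 0).
    rewrite -map_comp; apply/eqP; rewrite -[k in nseq k](size_iota 1 k).
    elim: (iota 1 k) => //= a s /eqP ->.
    by rewrite /polar /= !mul0r subr0 !mul1r.
  by rewrite !mixed_nseq addr0.
rewrite sl => H; rewrite -[_ * e ^+ _]mulrA; apply: H => [h||||].
- rewrite in_cons => /orP[/eqP ->|/mapP[i]] /=.
    rewrite normr0 (gtr0_norm e0) lexx (ltW e0) invr_ge0 ler0n.
    by rewrite invf_le1 ?ltr0n.
  rewrite mem_iota => /andP[i1 _] -> /=.
  rewrite normr0 (gtr0_norm e0) lexx (ltW e0) invr_ge0 ler0n.
  by rewrite invf_le1 ?ltr0n // ler1n.
- by rewrite /rho /sigma; exact: room.
- by rewrite /rho /sigma; exact: room.
- by rewrite normr0 add0r.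
- by rewrite normr0 add0r.
Qed.

(** If the bound failed at x, it would fail near x. With [0, tau] split into N steps eta,
    telescoping [mixed_bound] bounds the k-th difference of step eta by C tau eta^k, whereas
    [fd_mvt] makes it eta^k times a derivative of absolute value above C tau. *)
Lemma derive1n_diff_bound g k : smooth2 g -> exists2 d : R, 0 < d & exists C : R,
  forall x tau : R, 0 < tau -> tau <= d -> `|x| <= d ->
  `|derive1n k (fun s => g s tau - g s 0) x| <= C * tau.
Proof.
move=> sg; have [d d0 [C HC]] := mixed_bound k sg.
exists d => //; exists C => x tau t0 td xd.
have sg1 (y : R) : smoothR (fun s => g s y).
  by apply: sg; [exact: smoothR_id|exact: smoothR_cst].
pose G s := g s tau - g s 0; have sG : smoothR G by exact: smoothRB.
rewrite -/G leNgt; apply/negP => lt.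
have ck : continuous (fun s => `|derive1n k G s|).
  by move=> s; apply: cvg_norm; exact: (@smoothR_cont _ _ (smoothR_derive1n k sG) s).
have /nearRP[e e0 He] : \forall s \near x, C * tau < `|derive1n k G s|.
  exact: (cvgr_gt _ (ck x) _ lt).
(* N is large enough for k * eta < e, which keeps the intermediate point of [fd_mvt] where the bound
   is violated. *)
pose N := (Num.bound (k%:R * tau / e)).+1; pose eta := tau / N%:R.
have N0 : 0 < N%:R :> R by rewrite ltr0n.
have eta0 : 0 < eta by rewrite divr_gt0.
have Neta : N%:R * eta = tau by rewrite /eta mulrC divfK // gt_eqF.
have keta : k%:R * eta < e.
  have H : k%:R * tau / e < N%:R.
    apply: (@lt_trans _ _ (Num.bound (k%:R * tau / e))%:R); last by rewrite ltr_nat.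
    by apply: archi_boundP; rewrite divr_ge0 ?mulr_ge0 // ltW.
  by rewrite /eta mulrA ltr_pdivrMr // [e * _]mulrC -ltr_pdivrMr.
have [xi /andP[xi1 xi2] Hxi] := @fd_mvt k eta G x eta0 sG.
have tele (m : nat) : fd k eta (fun s => g s 0) x - fd k eta (fun s => g s (m%:R * eta)) x =
    \sum_(i < m) (fd k eta (fun s => g s (i%:R * eta)) x
       - fd k eta (fun s => g s (i%:R * eta + eta)) x).
  elim: m => [|m IH]; first by rewrite big_ord0 mul0r subrr.
  by rewrite big_ord_recr /= -IH -natr1 mulrDl mul1r; ring.
have B : `|fd k eta G x| <= C * tau * eta ^+ k.
  rewrite fd_sub distrC -Neta tele.
  apply: le_trans (ler_norm_sum _ _ _) _.
  apply: (@le_trans _ _ (\sum_(i < N) C * eta ^+ k.+1)).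
    apply: ler_sum => i _.
    have eN : i%:R * eta <= d.
      apply: le_trans td; rewrite -Neta ler_wpM2r // ?(ltW eta0) // ler_nat.
      exact: ltnW.
    apply: HC => //.
      apply: le_trans td; rewrite -Neta ler_peMl // ?(ltW eta0) // ler1n //.
    by rewrite ger0_norm // mulr_ge0 // ltW.
  rewrite sumr_const card_ord -mulr_natl exprS le_eqVlt; apply/orP; left.
  by apply/eqP; ring.
move: B; rewrite Hxi normrM normrX normrN (gtr0_norm eta0) mulrC.
rewrite ler_pM2r ?exprn_gt0 //; apply/negP; rewrite -ltNge.
by apply: He; rewrite ger0_norm; lra.
Qed.

End Differences.

(** * Limits of smooth functions, Boman's theorem and Hadamard's quotient *)

Section Limits.
Context {R : realType}.
Implicit Types (f phi h : R -> R) (g : R -> R -> R) (s t x y : R).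

Definition bounded_derivs (F : nat -> R -> R) := forall k (s0 : R),
  exists2 d : R, 0 < d & exists (C : R) (M : nat), forall m (s : R),
    (M <= m)%N -> `|s - s0| <= d -> `|derive1n k (F m) s| <= C.

Lemma smoothR_coind (P : (R -> R) -> Prop) :
  (forall f, P f -> exists2 h, P h & forall t, is_derive t 1 f (h t)) ->
  forall f, P f -> smoothR f.
Proof.
move=> H; apply: (@smooth_coind R R^o P) => f /H[h Ph fh].
by exists h => // t; exact/has_derivR.
Qed.

(** For fixed small eta the quotients (F m (s0 + eta) - F m s0) / eta converge and lie within C eta
    of the derivatives, which are therefore Cauchy. Their limit inherits the quadratic remainder, so
    it is the derivative, and it is again a limit of the same kind. *)
Lemma limit_smooth (F : nat -> R -> R) h : (forall m, smoothR (F m)) ->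
  bounded_derivs F -> (forall s, F m s @[m --> \oo] --> h s) -> smoothR h.
Proof.
move=> sF bF Fh; pose P f := exists F : nat -> R -> R, [/\ forall m, smoothR (F m),
  bounded_derivs F & forall s, F m s @[m --> \oo] --> f s].
apply: (@smoothR_coind P); last by exists F.
move=> {F sF bF Fh}f [F [sF bF Ff]].
have quad s0 : exists2 d : R, 0 < d & exists2 C : R, 0 <= C & exists M : nat,
    forall m eta, (M <= m)%N -> `|eta| <= d ->
    `|F m (s0 + eta) - F m s0 - derive1 (F m) s0 * eta| <= C * eta ^+ 2.
  have [d d0 [C [M HM]]] := bF 2%N s0; exists d => //; exists C.
    by apply: le_trans (HM M s0 (leqnn _) _) => //; rewrite subrr normr0 ltW.
  exists M => m eta Mm ed; apply: taylor2 => // s seta.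
  by apply: HM => //; exact: le_trans seta ed.
have cv s0 : cvg (derive1 (F m) s0 @[m --> \oo]).
  apply: cauchy_cvg; apply: cauchy_exP => e e0.
  have [d d0 [C C0 [M HM]]] := quad s0.
  pose eta := Num.min d (e / (2 * (C + 1))).
  have C1 : 0 < 2 * (C + 1) by lra.
  have eta0 : 0 < eta by rewrite lt_min d0 divr_gt0.
  have etad : eta <= d by rewrite ge_min lexx.
  have Ceta : C * eta < e / 2.
    have H : eta * (2 * (C + 1)) <= e by rewrite -ler_pdivlMr // ge_min lexx orbT.
    by nra.
  pose y : R := (f (s0 + eta) - f s0) / eta; exists y.
  have Q : (F m (s0 + eta) - F m s0) / eta @[m --> \oo] --> y.
    by apply: cvgMl; apply: cvgB; exact: Ff.
  have e2 : 0 < e / 2 by rewrite divr_gt0.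
  have /cvgrPdist_lt /(_ _ e2) [J _ HJ] := Q.
  exists (maxn J M) => // m /=; rewrite geq_max => /andP[Jm Mm].
  rewrite /ball /=; have := HJ m Jm => /= h1.
  have := HM m eta Mm; rewrite (gtr0_norm eta0) => /(_ etad) h2.
  set q := (F m (s0 + eta) - F m s0) / eta in h1.
  have h3 : `|q - derive1 (F m) s0| <= C * eta.
    rewrite -(ler_pM2r eta0) -{1}(gtr0_norm eta0) -normrM mulrBl.
    by rewrite /q divfK ?gt_eqF // -mulrA -expr2.
  have := ler_distD q y (derive1 (F m) s0); lra.
pose f' s0 := lim (derive1 (F m) s0 @[m --> \oo]).
have cvf' s0 : derive1 (F m) s0 @[m --> \oo] --> f' s0 by exact: cv.
exists f'.
  exists (fun m => derive1 (F m)); split => //.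
  - by move=> m; exact: smoothR_derive1.
  - move=> k s0; have [d d0 [C [M HM]]] := bF k.+1 s0.
    by exists d => //; exists C, M => m s Mm sd; rewrite -derive1Sn; exact: HM.
move=> s0; have [d d0 [C C0 [M HM]]] := quad s0.
apply: (@is_derive_quad _ _ _ _ d C) => // eta etad.
have : `|F m (s0 + eta) - F m s0 - derive1 (F m) s0 * eta| @[m --> \oo] -->
     `|f (s0 + eta) - f s0 - f' s0 * eta|.
  by apply: cvg_norm; apply: cvgB; [apply: cvgB; exact: Ff|exact: cvgMl].
move=> /cvgr_to_le; apply; exists M => // m Mm; apply: HM => //; exact: ltW.
Qed.

Lemma derive_seq f t (l : R) : is_derive t 1 f l ->
  (f (t + m.+1%:R^-1) - f t) / m.+1%:R^-1 @[m --> \oo] --> l.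
Proof.
move=> /has_derivR H.
have : (m.+1%:R^-1 : R) @[m --> \oo] --> (0 : R)^'.
  move=> A /= /nbhs_ballP[e /= e0 He].
  have := @cvg_harmonic R => /cvgr0_norm_lt /(_ _ e0).
  apply: filterS => m /= me; apply: He; last by rewrite /= invr_eq0 pnatr_eq0.
  by rewrite /ball /= sub0r normrN.
move=> /(cvg_comp _ _) /(_ H); apply: cvg_trans.
by apply: near_eq_cvg; near=> m; rewrite /= /GRing.scale /= mulrC.
Unshelve. all: by end_near. Qed.

Lemma smooth2_shift g x y : smooth2 g -> smooth2 (fun s t => g (x + s) (y + t)).
Proof.
move=> sg a b sa sb; apply: (sg (fun r => x + a r) (fun r => y + b r)).
  by apply: smoothRD => //; exact: smoothR_cst.
by apply: smoothRD => //; exact: smoothR_cst.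
Qed.

Lemma smooth2l g y : smooth2 g -> smoothR (fun s => g s y).
Proof. by move=> sg; apply: sg; [exact: smoothR_id|exact: smoothR_cst]. Qed.

Lemma smooth2r g x : smooth2 g -> smoothR (g x).
Proof. by move=> sg; apply: (sg (fun=> x)); [exact: smoothR_cst|exact: smoothR_id]. Qed.

Theorem boman g : smooth2 g -> smoothR (fun s => derive1 (g s) 0).
Proof.
move=> sg.
apply: (@limit_smooth (fun m s => m.+1%:R * (g s m.+1%:R^-1 - g s 0))).
- move=> m; apply: smoothRM; first exact: smoothR_cst.
  by apply: smoothRB; exact: smooth2l.
- move=> k s0.
  have [d d0 [C HC]] := derive1n_diff_bound k (smooth2_shift s0 0 sg).
  (* From this index on the step 1/(m+1) is at most d. *)
  exists d => //; exists C, (Num.bound d^-1) => m s Mm sd.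
  pose Psi r := g (s0 + r) (0 + m.+1%:R^-1) - g (s0 + r) (0 + 0).
  have -> : (fun s => m.+1%:R * (g s m.+1%:R^-1 - g s 0)) =
      fun s => m.+1%:R * Psi (1 * (s - s0)).
    by apply/funext => r; rewrite /Psi mul1r !add0r [s0 + _]addrC subrK.
  rewrite derive1n_affine; last first.
    by apply: smoothRB; apply: smooth2l (smooth2_shift s0 0 sg).
  rewrite expr1n mulr1 mul1r normrM gtr0_norm ?ltr0n //.
  rewrite -ler_pdivlMl ?ltr0n // mulrC; apply: HC => //.
  rewrite -[d]invrK lef_pV2 ?posrE ?ltr0n ?invr_gt0 //.
  have /ltW H : d^-1 < (Num.bound d^-1)%:R by apply: archi_boundP; rewrite invr_ge0 ltW.
  by apply: le_trans H _; rewrite ler_nat (leq_trans Mm).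
- move=> s; have := derive_seq (smoothR_der 0 (smooth2r s sg)).
  apply: cvg_trans; apply: near_eq_cvg; near=> m.
  by rewrite add0r invrK mulrC.
Unshelve. all: by end_near. Qed.

(** The quotient along the diagonal minus the two partial quotients is a mixed second difference
    divided by eta, of size C eta by [mixed_bound]. The additivity of directional derivatives rests
    on this. *)
Lemma smooth2_diag g : smooth2 g ->
  derive1 (fun r => g r r) 0 = derive1 (fun r => g r 0) 0 + derive1 (g 0) 0.
Proof.
move=> sg.
have sd : smoothR (fun r => g r r) by apply: sg; exact: smoothR_id.
have H1 := derive_seq (smoothR_der 0 sd).
have H2 := derive_seq (smoothR_der 0 (smooth2l 0 sg)).
have H3 := derive_seq (smoothR_der 0 (smooth2r 0 sg)).
have H := cvgB (cvgB H1 H2) H3.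
apply/eqP; rewrite -subr_eq0 opprD addrA; apply/eqP.
apply: (@cvg_unique _ (@Rhausdorff R) _ _ _ _ (H _ _)).
have [d d0 [C HC]] := mixed_bound 1 sg.
apply/cvgr0Pnorm_le => e e0.
have ed : 0 < Num.min d (e / (`|C| + 1)).
  by rewrite lt_min d0 divr_gt0 // ltr_wpDl.
have := @cvg_harmonic R => /cvgr0_norm_lt /(_ _ ed).
apply: filterS => m /=; rewrite gtr0_norm ?invr_gt0 ?ltr0n // lt_min => /andP[md mC].
set eta := m.+1%:R^-1 in md mC *.
have eta0 : 0 < eta by rewrite invr_gt0 ltr0n.
have := HC eta 0 0 eta0 (ltW md); rewrite normr0 => /(_ (ltW d0) (ltW d0)) /=.
rewrite !add0r => HH.
change (`|(g (0 + eta) (0 + eta) - g 0 0) / eta - (g (0 + eta) 0 - g 0 0) / eta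
  - (g 0 (0 + eta) - g 0 0) / eta| <= e).
rewrite !add0r -!mulrBl normrM normfV (gtr0_norm eta0) ler_pdivrMr //.
have -> : g eta eta - g 0 0 - (g eta 0 - g 0 0) - (g 0 eta - g 0 0) =
  g 0 0 - g eta 0 - (g 0 eta - g eta eta) by ring.
apply: le_trans HH _.
rewrite expr2 mulrA ler_pM2r //.
rewrite ltr_pdivlMr ?ltr_wpDl // in mC.
have := ler_norm C; nra.
Qed.

Definition hadamard f (t : R) : R := if t == 0 then derive1 f 0 else (f t - f 0) / t.

Lemma smoothR_sum n (F : 'I_n -> R -> R) : (forall i, smoothR (F i)) ->
  smoothR (fun t => \sum_(i < n) F i t).
Proof.
elim: n F => [|n IH] F sF.
  rewrite (_ : (fun t => _) = fun=> 0); first exact: smoothR_cst.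
  by apply/funext => t; rewrite big_ord0.
rewrite (_ : (fun t => _) = fun t => \sum_(i < n) F (widen_ord (leqnSn n) i) t + F ord_max t).
  by apply: smoothRD => //; exact: IH.
by apply/funext => t; rewrite big_ord_recr.
Qed.

Lemma derive1n_sum k n (F : 'I_n -> R -> R) t : (forall i, smoothR (F i)) ->
  derive1n k (fun t => \sum_(i < n) F i t) t = \sum_(i < n) derive1n k (F i) t.
Proof.
elim: n F => [|n IH] F sF.
  rewrite big_ord0; apply: derive1n0_near; near=> s; exact: big_ord0.
rewrite big_ord_recr /= -IH //.
rewrite (_ : (fun t => _) = fun t => \sum_(i < n) F (widen_ord (leqnSn n) i) t - (- F ord_max t)).
  rewrite derive1nB //; [|exact: smoothR_sum|exact: smoothRN].
  congr (_ + _); rewrite -[LHS]add0r -(derive1n0_near k (f := fun=> 0) (t := t)); last first.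
    by near=> s.
  rewrite -derive1nB //; [|exact: smoothR_cst|exact: smoothRN].
  by congr (derive1n _ _ _); apply/funext => s; rewrite sub0r opprK.
by apply/funext => s; rewrite big_ord_recr /= opprK.
Unshelve. all: by end_near. Qed.

Lemma smoothR_bounded f (r : R) : smoothR f ->
  exists B, forall t, `|t| <= r -> `|f t| <= B.
Proof.
move=> sf; have [r0|r0] := leP 0 r; last first.
  by exists 0 => t tr; have := le_lt_trans (le_trans (normr_ge0 t) tr) r0; rewrite ltxx.
have cg : continuous (fun t => `|f t|).
  by move=> t; apply: cvg_norm; exact: (@smoothR_cont _ _ sf t).
have [|c _ Hc] := @EVT_max R _ (- r) r _ (continuous_subspaceT cg).
  by rewrite ge0_cp.
by exists `|f c| => t tr; apply: Hc; rewrite in_itv /= -ler_norml.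
Qed.

(** The quotient is the integral of f'(u t) over u in [0, 1]. Its Riemann sums are smooth in t, and
    as 0 <= i/(m+1) <= 1 their k-th derivatives are bounded by those of f of order k + 1;
    [limit_smooth] applies. *)
Theorem smoothR_hadamard f : smoothR f -> smoothR (hadamard f).
Proof.
move=> sf; have sf' := smoothR_derive1 sf.
pose G m (i : 'I_m.+1) t := m.+1%:R^-1 * derive1 f (i%:R / m.+1%:R * (t - 0)).
have sG m (i : 'I_m.+1) : smoothR (G m i).
  apply: smoothRM; first exact: smoothR_cst.
  apply: smoothR_comp => //; apply: smoothRM; first exact: smoothR_cst.
  by apply: smoothRB; [exact: smoothR_id|exact: smoothR_cst].
have frac m (i : 'I_m.+1) : 0 <= (i%:R / m.+1%:R : R) <= 1.
  rewrite divr_ge0 //= ler_pdivrMr ?ltr0n // mul1r ler_nat; exact: ltnW.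
apply: (@limit_smooth (fun m t => \sum_(i < m.+1) G m i t)).
- by move=> m; exact: smoothR_sum.
- move=> k s0; have [B HB] := @smoothR_bounded _ (`|s0| + 1) (smoothR_derive1n k sf').
  exists 1 => //; exists B, 0%N => m s _ ss0; rewrite derive1n_sum //.
  have s1 : `|s| <= `|s0| + 1.
    by rewrite -lerBlDl; apply: le_trans ss0; exact: lerB_dist.
  apply: le_trans (ler_norm_sum _ _ _) _.
  apply: (@le_trans _ _ (\sum_(i < m.+1) m.+1%:R^-1 * B)); last first.
    by rewrite sumr_const card_ord -[leLHS]mulr_natl mulrA mulfV ?mul1r ?pnatr_eq0.
  apply: ler_sum => i _; rewrite derive1n_affine // subr0.
  have /andP[f0 f1] := frac m i.
  have m0 : 0 <= (m.+1%:R^-1 : R) by rewrite invr_ge0.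
  rewrite normrM normrM (ger0_norm m0) normrX (ger0_norm f0) -mulrA ler_wpM2l //.
  have Hi : `|derive1n k (derive1 f) (i%:R / m.+1%:R * s)| <= B.
    apply: HB; rewrite normrM (ger0_norm f0); apply: le_trans s1.
    by rewrite ler_piMl.
  apply: le_trans Hi; rewrite ler_piMl //.
  by rewrite exprn_ile1.
- move=> t; have [B HB] := @smoothR_bounded _ `|t| (smoothR_derive1n 2 sf).
  have [->|t0] := eqVneq t 0.
    rewrite /hadamard eqxx (_ : (fun m => _) = fun=> derive1 f 0); first exact: cvg_cst.
    apply/funext => m; rewrite (eq_bigr (fun=> m.+1%:R^-1 * derive1 f 0)); last first.
      by move=> i _; rewrite /G subr0 mulr0.
    by rewrite sumr_const card_ord -[LHS]mulr_natl mulrA mulfV ?mul1r ?pnatr_eq0.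
  rewrite /hadamard (negbTE t0).
  apply/cvgrPdist_le => e e0.
  have B0 : 0 <= B by apply: le_trans (HB 0 _) => //; rewrite normr0.
  have ed : 0 < e / (B * `|t| + 1).
    by rewrite divr_gt0 // ltr_wpDl // mulr_ge0.
  have := @cvg_harmonic R => /cvgr0_norm_lt /(_ _ ed).
  apply: filterS => m /=; rewrite gtr0_norm ?invr_gt0 ?ltr0n // => mC.
  have m0 : (m.+1%:R : R) != 0 by rewrite pnatr_eq0.
  (* Convergence of the Riemann sums: f t - f 0 is telescoped over steps of length u, and Taylor's
     bound on each step leaves a total error of order 1/m. *)
  pose u := t / m.+1%:R.
  have tele (n : nat) : f (n%:R * u) - f 0 =
      \sum_(i < n) (f (i%:R * u + u) - f (i%:R * u)).
    elim: n => [|n IH]; first by rewrite big_ord0 mul0r subrr.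
    by rewrite big_ord_recr /= -IH -natr1 mulrDl mul1r; ring.
  have E : f t - f 0 = \sum_(i < m.+1) (f (i%:R * u + u) - f (i%:R * u)).
    by rewrite -tele /u mulrC divfK.
  have E2 : (f t - f 0) / t - \sum_(i < m.+1) G m i t =
     t^-1 * \sum_(i < m.+1) (f (i%:R * u + u) - f (i%:R * u) - derive1 f (i%:R * u) * u).
    rewrite E mulr_suml mulr_sumr -sumrB; apply: eq_bigr => i _.
    rewrite /G subr0 /u.
    have -> : i%:R / m.+1%:R * t = i%:R * (t / m.+1%:R) by field.
    by move: (m.+1%:R : R) m0 => a a0; field; rewrite t0 a0.
  rewrite E2 normrM normfV ler_pdivrMl ?normr_gt0 //.
  apply: le_trans (ler_norm_sum _ _ _) _.
  apply: (@le_trans _ _ (\sum_(i < m.+1) B * u ^+ 2)).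
    apply: ler_sum => i _; apply: taylor2 => // s su; apply: HB.
    have /andP[f0 _] := frac m i.
    have -> : s = (s - i%:R * u) + i%:R * u by rewrite subrK.
    apply: le_trans (ler_normD _ _) _.
    apply: (@le_trans _ _ (`|u| + `|i%:R * u|)); first by rewrite lerD2r.
    have uE : `|u| = `|t| / m.+1%:R.
      by rewrite /u normrM normfV (@ger0_norm _ m.+1%:R).
    rewrite [`|i%:R * u|]normrM (ger0_norm (ler0n R i)) uE.
    rewrite -{1}[`|t| / _]mul1r -mulrDl mulrCA -[leRHS]mulr1 ler_wpM2l //.
    by rewrite ler_pdivrMr ?ltr0n // mul1r nat1r ler_nat ltn_ord.
  rewrite sumr_const card_ord -[leLHS]mulr_natl /u.
  have -> : m.+1%:R * (B * (t / m.+1%:R) ^+ 2) = (B * t ^+ 2) / m.+1%:R by field.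
  rewrite ltr_pdivlMr ?ltr_wpDl ?mulr_ge0 // in mC.
  have m1 : 0 < (m.+1%:R^-1 : R) by rewrite invr_gt0.
  have -> : B * t ^+ 2 / m.+1%:R = `|t| * (m.+1%:R^-1 * (B * `|t|)).
    by rewrite -(real_normK (num_real t)); field.
  apply: ler_wpM2l => //; rewrite mulrDr mulr1 in mC.
  by apply: le_trans (ltW mC); rewrite lerDl ltW.
Qed.

End Limits.

(** * Convenient vector spaces *)

Section TvsLimits.
Context {R : realType} {E F : tvsType R}.

Lemma tvs_cvgD (T : Type) (G : set_system T) (FG : Filter G) (f g : T -> E) a b :
  f @ G --> a -> g @ G --> b -> (fun x => f x + g x) @ G --> a + b.
Proof. move=> fa gb; exact: (cvg_comp2 fa gb (@add_continuous E (a, b))). Qed.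

Lemma tvs_cvgZ (T : Type) (G : set_system T) (FG : Filter G) (f : T -> R)
  (g : T -> E) (a : R) b :
  f @ G --> (a : R^o) -> g @ G --> b -> (fun x => f x *: g x) @ G --> a *: b.
Proof. move=> fa gb; exact: (cvg_comp2 fa gb (@scale_continuous R E (a, b))). Qed.

Lemma has_deriv_unique (c : R -> E) t a b : hausdorff_space E ->
  has_deriv c t a -> has_deriv c t b -> a = b.
Proof. by move=> hE ca cb; exact: (cvg_unique hE ca cb). Qed.

Lemma has_deriv_near (c d : R -> E) t a :
  (\forall s \near t, c s = d s) -> has_deriv c t a -> has_deriv d t a.
Proof.
move=> /nearRP[e e0 He]; apply: cvg_trans; apply: near_eq_cvg.
have He' h : `|h| < e -> c (t + h) = d (t + h).
  by move=> he; apply: He; rewrite addrC addKr.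
near=> h; rewrite He'; last by near: h; exact: dnbhs0_lt.
by rewrite -[in c t](addr0 t) He' ?normr0 ?addr0.
Unshelve. all: by end_near. Qed.

Lemma has_deriv_cst (a : E) t : has_deriv (fun=> a) t 0.
Proof.
rewrite /has_deriv (_ : (fun h : R => _) = fun=> 0); first exact: cvg_cst.
by apply/funext => h; rewrite subrr scaler0.
Qed.

Lemma has_deriv_linear (l : E -> F) (c : R -> E) t a :
  (forall (r : R) x y, l (r *: x + y) = r *: l x + l y) -> {for a, continuous l} ->
  has_deriv c t a -> has_deriv (l \o c) t (l a).
Proof.
move=> ll lc ca.
have H := cvg_comp _ _ ca lc; apply: cvg_trans H; apply: near_eq_cvg.
near=> h => /=.
have l0 : l 0 = 0.
  have := ll 1 0 0; rewrite !scale1r addr0 => /eqP.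
  by rewrite -subr_eq0 opprD addrA subrr sub0r oppr_eq0 => /eqP.
have lZ (r : R) x : l (r *: x) = r *: l x by have := ll r x 0; rewrite !addr0 l0 addr0.
rewrite lZ; congr (_ *: _); rewrite addrC -scaleN1r ll scaleN1r addrC //.
Unshelve. all: by end_near. Qed.

Lemma has_deriv_cont (c : R -> E) t a : has_deriv c t a -> {for t, continuous c}.
Proof.
move=> ca.
have H : (fun h : R => c t + h *: (h^-1 *: (c (t + h) - c t))) @ 0^' --> c t.
  rewrite -[X in _ --> X]addr0 -(scale0r a).
  apply: tvs_cvgD; first exact: cvg_cst.
  apply: tvs_cvgZ => //; exact: nbhs_dnbhs.
move=> U /= cU; have /H := cU.
rewrite !nbhs_simpl /= => /nbhs_ballP[e /= e0 He].
apply/nearRP; exists e => // s se /=.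
have [->|st] := eqVneq s t; first exact: nbhs_singleton cU.
have st0 : s - t != 0 by rewrite subr_eq0.
have := He (s - t); rewrite /ball /= sub0r normrN => /(_ se st0).
by rewrite scalerA divff // scale1r !(addrC t) subrK addrC subrK.
Qed.

Lemma smooth_curve_cont (c : R -> E) : smooth_curve c -> continuous c.
Proof. by move=> /smooth_curveD[d _ dc] t; exact: has_deriv_cont (dc t). Qed.

Lemma smooth_curve_linear (l : E -> F) (c : R -> E) :
  (forall (r : R) x y, l (r *: x + y) = r *: l x + l y) -> continuous l ->
  smooth_curve c -> smooth_curve (l \o c).
Proof.
move=> ll lc sc; pose P c' := exists2 c : R -> E, smooth_curve c & c' = l \o c.
apply: (@smooth_coind _ _ P); last by exists c.
move=> _ [{sc}c sc ->]; have [d sd cd] := smooth_curveD sc.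
by exists (l \o d); [exists d|move=> t; apply: has_deriv_linear => //; exact: lc].
Qed.

End TvsLimits.

Section Convenient.
Context {R : realType}.
Implicit Types (E F : tvsType R).

Lemma smooth_curve_scalar E (l : {linear E -> R^o}) (c : R -> E) :
  continuous l -> smooth_curve c -> smoothR (fun t => l (c t)).
Proof. by move=> lc; apply: smooth_curve_linear => // r x y; rewrite linearP. Qed.

Lemma has_deriv_scalar E (l : {linear E -> R^o}) (c : R -> E) t a :
  continuous l -> has_deriv c t a -> is_derive t 1 (fun t => l (c t) : R) (l a).
Proof.
move=> lc ca; apply/has_derivR; apply: (has_deriv_linear (l := l)) => //.
  by move=> r x y; rewrite linearP.
exact: lc.
Qed.

Lemma convenient_smooth E (c : R -> E) : convenient E ->
  (forall l : {linear E -> R^o}, continuous l -> smoothR (fun t => l (c t))) ->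
  smooth_curve c.
Proof. by move=> [_ H]; exact: H. Qed.

(* If no functional separates x from y, the curve equal to x at 0 and to y
   elsewhere is scalarwise constant, hence smooth, hence continuous. *)
Lemma convenient_separated E (x y : E) : convenient E ->
  (forall l : {linear E -> R^o}, continuous l -> l x = l y) -> x = y.
Proof.
move=> cE lxy; pose c (t : R) := if t == 0 then x else y.
have sc : smooth_curve c.
  apply: convenient_smooth => // l lc; rewrite (_ : (fun t => _) = fun=> l x).
    exact: smoothR_cst.
  by apply/funext => t; rewrite /c; case: ifP => // _; rewrite lxy.
have cx : c t @[t --> (0 : R)^'] --> x.
  have : c t @[t --> (0 : R)] --> c 0 by exact: smooth_curve_cont.
  rewrite {2}/c eqxx; apply: cvg_trans; apply: cvg_app; exact: nbhs_dnbhs.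
have cy : c t @[t --> (0 : R)^'] --> y.
  have H : (fun=> y) t @[t --> (0 : R)^'] --> y by exact: cvg_cst.
  apply: cvg_trans H; apply: near_eq_cvg; near=> t; rewrite /c.
  have /negbTE -> // : t != 0 by near: t; exact: nbhs_dnbhs_neq.
exact: (cvg_unique (proj1 cE) cx cy).
Unshelve. all: by end_near. Qed.

Lemma smooth_curve_cst E (a : E) : smooth_curve (fun _ : R => a).
Proof.
apply: (@smooth_coind _ _ (fun c => exists a, c = fun=> a)); last by exists a.
by move=> _ [b ->]; exists (fun=> 0); [exists 0|move=> t; exact: has_deriv_cst].
Qed.

Lemma smooth_curve_add E (c d : R -> E) : convenient E ->
  smooth_curve c -> smooth_curve d -> smooth_curve (fun t => c t + d t).
Proof.
move=> cE sc sd; apply: convenient_smooth => // l lc.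
under [X in smoothR X]eq_fun do rewrite linearD.
by apply: smoothRD; exact: smooth_curve_scalar.
Qed.

Lemma smooth_curve_scale E (a : R -> R) (c : R -> E) : convenient E ->
  smoothR a -> smooth_curve c -> smooth_curve (fun t => a t *: c t).
Proof.
move=> cE sa sc; apply: convenient_smooth => // l lc.
under [X in smoothR X]eq_fun do rewrite linearZ.
by apply: smoothRM => //; exact: smooth_curve_scalar.
Qed.

Lemma smooth_curve_comp E (c : R -> E) (a : R -> R) : convenient E ->
  smooth_curve c -> smoothR a -> smooth_curve (fun t => c (a t)).
Proof.
move=> cE sc sa; apply: convenient_smooth => // l lc.
by apply: (smoothR_comp (f := fun t => l (c t))) => //; exact: smooth_curve_scalar.
Qed.

Lemma smooth_curve_pair E F (c : R -> E) (d : R -> F) :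
  smooth_curve c -> smooth_curve d ->
  smooth_curve (fun t => (c t, d t) : (E * F)%type).
Proof.
move=> [c' [<- cc]] [d' [<- dd]].
exists (fun n t => (c' n t, d' n t)); split=> // n t.
exact: (cvg_pair (cc n t) (dd n t)).
Qed.

Lemma smooth_curve_fst E F (c : R -> (E * F)%type) :
  smooth_curve c -> smooth_curve (fun t => (c t).1).
Proof.
apply: (@smooth_curve_linear _ (E * F)%type E fst) => //.
by move=> x; exact: cvg_fst.
Qed.

Lemma smooth_curve_snd E F (c : R -> (E * F)%type) :
  smooth_curve c -> smooth_curve (fun t => (c t).2).
Proof.
apply: (@smooth_curve_linear _ (E * F)%type F snd) => //.
by move=> x; exact: cvg_snd.
Qed.

Lemma convenient_prod E F : convenient E -> convenient F -> convenient (E * F)%type.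
Proof.
move=> cE cF; split.
  move=> [p1 p2] [q1 q2] cl; congr pair.
    apply: (proj1 cE) => A B pA qB.
    have h1 : nbhs (p1, p2) (fst @^-1` A) by exact: cvg_fst.
    have h2 : nbhs (q1, q2) (fst @^-1` B) by exact: cvg_fst.
    case: (cl _ _ h1 h2) => -[x y] [/= ? ?].
    by exists x.
  apply: (proj1 cF) => A B pA qB.
  have h1 : nbhs (p1, p2) (snd @^-1` A) by exact: cvg_snd.
  have h2 : nbhs (q1, q2) (snd @^-1` B) by exact: cvg_snd.
  case: (cl _ _ h1 h2) => -[x y] [/= ? ?].
  by exists y.
move=> c Hc.
have -> : c = fun t => ((c t).1, (c t).2) by apply/funext => t; case: (c t).
apply: smooth_curve_pair; apply: convenient_smooth => // l lc.
  apply: (Hc [the {linear (E * F)%type -> R^o} of l \o fst]) => x.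
  by apply: continuous_comp; [exact: cvg_fst|exact: lc].
apply: (Hc [the {linear (E * F)%type -> R^o} of l \o snd]) => x.
by apply: continuous_comp; [exact: cvg_snd|exact: lc].
Qed.

End Convenient.

(** * Germs of smooth curves *)

Section LocalSmoothness.
Context {R : realType}.
Implicit Types (E F : tvsType R) (t s : R).

(** A chart sees a curve only near a given time, whereas [smooth_curve] and [smooth_on] speak of
    total curves. A germ is therefore smooth when some total smooth curve represents it. *)
Definition sm_at E (c : R -> E) t :=
  exists2 d : R -> E, smooth_curve d & \forall s \near t, c s = d s.

Lemma sm_at_smooth E (c : R -> E) t : smooth_curve c -> sm_at c t.
Proof. by move=> sc; exists c => //; near=> s. Unshelve. all: by end_near. Qed.

Lemma sm_at_near E (c d : R -> E) t :
  (\forall s \near t, c s = d s) -> sm_at c t -> sm_at d t.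
Proof. by move=> cd [e se ce]; exists e => //; near=> s; rewrite -(near cd s) ?(near ce s).
Unshelve. all: by end_near. Qed.

Lemma smoothR_local (f : R -> R) :
  (forall t, exists2 g, smoothR g & \forall s \near t, f s = g s) -> smoothR f.
Proof.
apply: (@smoothR_coind R (fun f => forall t, exists2 g, smoothR g &
  \forall s \near t, f s = g s)) => {}f Hf.
have D t g : smoothR g -> (\forall s \near t, f s = g s) ->
    is_derive t 1 f (derive1 g t).
  move=> sg fg; apply: near_eq_is_derive (smoothR_der t sg).
  by near=> s; rewrite (near fg s).
exists (derive1 f) => t; have [g sg fg] := Hf t.
  exists (derive1 g); first exact: smoothR_derive1.
  by have := near_join fg; apply: filterS => s /(D _ _ sg)/is_derive_derive1.
by rewrite (is_derive_derive1 (D _ _ sg fg)); exact: D.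
Unshelve. all: by end_near. Qed.

Lemma smooth_curve_local E (c : R -> E) : convenient E ->
  (forall t, sm_at c t) -> smooth_curve c.
Proof.
move=> cE H; apply: convenient_smooth => // l lc; apply: smoothR_local => t.
have [d sd cd] := H t; exists (fun t => l (d t)); first exact: smooth_curve_scalar.
by near=> s; rewrite (near cd s).
Unshelve. all: by end_near. Qed.

Lemma smoothR_translate (a : R) : smoothR (fun t => t + a).
Proof. by apply: smoothRD; [exact: smoothR_id|exact: smoothR_cst]. Qed.

Lemma sm_at_shift E (c : R -> E) t : convenient E ->
  sm_at c t <-> sm_at (fun s => c (s + t)) 0.
Proof.
move=> cE; split=> [[d sd /nearRP[e e0 He]]|[d sd /nearRP[e e0 He]]].
  exists (fun s => d (s + t)); first exact: smooth_curve_comp (smoothR_translate t).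
  by apply/nearRP; exists e => // s; rewrite subr0 => se; apply: He; rewrite addrK.
exists (fun s => d (s + - t)); first exact: smooth_curve_comp (smoothR_translate _).
apply/nearRP; exists e => // s se.
by have := He (s - t); rewrite subr0 subrK; apply.
Qed.

Lemma sm_at_cont E (c : R -> E) t : sm_at c t -> {for t, continuous c}.
Proof.
move=> [d sd cd]; have H : d s @[s --> t] --> d t by exact: smooth_curve_cont.
have ct : c t = d t by exact: nbhs_singleton cd.
rewrite /prop_for /= /continuous_at ct; apply: cvg_trans H; apply: near_eq_cvg.
by near=> s; rewrite (near cd s).
Unshelve. all: by end_near. Qed.

Lemma sm_at_deriv E (c : R -> E) t : sm_at c t -> exists l, has_deriv c t l.
Proof.
move=> [d sd cd]; have [d' _ dd'] := smooth_curveD sd; exists (d' t).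
by apply: has_deriv_near (dd' t); near=> s; rewrite (near cd s).
Unshelve. all: by end_near. Qed.

Lemma sm_at_near_open E (O : set E) (c : R -> E) t : cinf_open O ->
  sm_at c t -> O (c t) -> \forall s \near t, O (c s).
Proof.
move=> oO [d sd cd] Oc.
have od : nbhs t (d @^-1` O).
  by apply: open_nbhs_nbhs; split; [exact: oO|rewrite /= -(nbhs_singleton cd)].
by near=> s; rewrite (near cd s) //; near: s.
Unshelve. all: by end_near. Qed.

(** Cutting off the parameter: c \o a has the same germ at t as c and stays where P holds at all
    times. This bridges the gap between germs and [smooth_on], which tests total curves inside a
    subset. *)
Lemma reparam (P : R -> Prop) t : (\forall s \near t, P s) ->
  exists2 a, smoothR a & (\forall s \near t, a s = s) /\ forall s, P (a s).
Proof.
move=> /nearRP[e e0 He]; have e2 : 0 < e / 2 by rewrite divr_gt0.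
have [a sa [ae aid]] := cutoff e2.
exists (fun s => a (s + - t) + t).
  apply: smoothRD; last exact: smoothR_cst.
  by apply: smoothR_comp => //; exact: smoothR_translate.
split=> [|s].
  apply/nearRP; exists (e / 2 / 2); first by rewrite divr_gt0.
  by move=> s se; rewrite aid // subrK.
by apply: He; rewrite addrK; apply: le_lt_trans (ae _) _; lra.
Qed.

Lemma smooth_on_sm_at E F (O : set E) (f : E -> F) (c : R -> E) t :
  convenient E -> cinf_open O -> smooth_on O f -> sm_at c t -> O (c t) ->
  sm_at (f \o c) t.
Proof.
move=> cE oO sf sc Oc; have [d sd cd] := sc.
have Od : \forall s \near t, O (d s).
  have := sm_at_near_open oO sc Oc; move=> H.
  by near=> s; rewrite -(near cd s) //; near: s.
have [a sa [aid Oa]] := reparam Od.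
exists (f \o (fun s => d (a s))).
  by apply: sf => //; exact: smooth_curve_comp.
by near=> s; rewrite /= (near cd s) // (near aid s).
Unshelve. all: by end_near. Qed.

Lemma smooth_onI E F (O : set E) (f : E -> F) : convenient F ->
  (forall (c : R -> E) t, sm_at c t -> O (c t) -> sm_at (f \o c) t) -> smooth_on O f.
Proof.
move=> cF H c sc Oc; apply: smooth_curve_local => // t.
by apply: H => //; exact: sm_at_smooth.
Qed.

Lemma sm_at_pairP E F (c : R -> E) (d : R -> F) t :
  sm_at (fun s => (c s, d s) : (E * F)%type) t <-> sm_at c t /\ sm_at d t.
Proof.
split=> [[p sp cp]|[[c' sc cc] [d' sd dd]]].
  split; [exists (fun s => (p s).1); first exact: smooth_curve_fst|
          exists (fun s => (p s).2); first exact: smooth_curve_snd];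
  by near=> s; rewrite -(near cp s).
exists (fun s => (c' s, d' s)); first exact: smooth_curve_pair.
by near=> s; rewrite (near cc s) // (near dd s).
Unshelve. all: by end_near. Qed.

End LocalSmoothness.

(** * Planar maps into convenient spaces *)

Section Planar.
Context {R : realType}.
Implicit Types (E F : tvsType R) (t s : R).

Definition planar E (p : R -> R -> E) := forall a b : R -> R,
  smoothR a -> smoothR b -> smooth_curve (fun r => p (a r) (b r)).

Lemma planar_scalar E (l : {linear E -> R^o}) (p : R -> R -> E) : continuous l ->
  planar p -> smooth2 (fun s t => l (p s t)).
Proof. by move=> lc pp a b sa sb; apply: smooth_curve_scalar => //; exact: pp. Qed.

Lemma planar_reparam E (p : R -> R -> E) (a b : R -> R) : smoothR a -> smoothR b ->
  planar p -> planar (fun s t => p (a s) (b t)).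
Proof.
move=> sa sb pp u v su sv.
by apply: (pp (fun r => a (u r)) (fun r => b (v r))); exact: smoothR_comp.
Qed.

(** Boman's theorem read through continuous functionals: the derivative is first taken pointwise in
    s, then its smoothness in s is tested scalarwise. *)
Lemma planar_deriv E (p : R -> R -> E) : convenient E -> planar p ->
  exists2 h, smooth_curve h & forall s, has_deriv (p s) 0 (h s).
Proof.
move=> cE pp.
have /choice[h Hh] : forall s, exists l, has_deriv (p s) 0 l.
  move=> s; have sp : smooth_curve (p s).
    by apply: (pp (fun=> s)); [exact: smoothR_cst|exact: smoothR_id].
  by have [d _ dd] := smooth_curveD sp; exists (d 0).
exists h => //; apply: convenient_smooth => // l lc.
have -> : (fun t => l (h t)) = fun s => derive1 (fun t => l (p s t) : R) 0.
  apply/funext => s; apply/esym/is_derive_derive1.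
  exact: has_deriv_scalar.
by apply: boman; exact: planar_scalar.
Qed.

Lemma planar_diag E (p : R -> R -> E) a b : convenient E -> planar p ->
  has_deriv (fun r => p r 0) 0 a -> has_deriv (p 0) 0 b ->
  has_deriv (fun r => p r r) 0 (a + b).
Proof.
move=> cE pp pa pb.
have sd : smooth_curve (fun r => p r r) by apply: pp; exact: smoothR_id.
have [d _ dd] := smooth_curveD sd.
suff -> : a + b = d 0 by exact: dd.
apply: convenient_separated => // l lc; rewrite linearD.
have := smooth2_diag (planar_scalar lc pp).
rewrite (is_derive_derive1 (has_deriv_scalar lc pa)).
rewrite (is_derive_derive1 (has_deriv_scalar lc pb)).
by rewrite (is_derive_derive1 (has_deriv_scalar lc (dd 0))).
Qed.

(** The preimage of O under p is only known to be open along curves. If it contained no square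
    around the origin, points outside it with coordinates at most [tiny j] would lie on one smooth
    curve through the origin, on which membership in O is an open condition. *)
Lemma planar_localize E (O : set E) (p : R -> R -> E) : cinf_open O -> planar p ->
  O (p 0 0) -> exists2 a, smoothR a &
    (\forall s \near (0 : R), a s = s) /\ forall s t, O (p (a s) (a t)).
Proof.
move=> oO pp O0.
have [e e0 He] : exists2 e : R, 0 < e &
    forall s t, `|s| <= e -> `|t| <= e -> O (p s t).
  apply: contrapT => H.
  have H1 (j : nat) : exists w : R * R,
      [/\ `|w.1| <= tiny j, `|w.2| <= tiny j & ~ O (p w.1 w.2)].
    apply: contrapT => Hj; apply: H; exists (tiny j); first exact: tiny_gt0.
    by move=> s t hs ht; apply: contrapT => nO; apply: Hj; exists (s, t).
  have {H1}/choice[w Hw] := H1.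
  have z (j : nat) : `|0 : R| <= tiny j by rewrite normr0 ltW // tiny_gt0.
  have [|j|a [sa a0 aE]] := @line_curve R (fun j => (w j).1) (fun=> 0).
  - by move=> j; have [] := Hw j.
  - exact: z.
  have [|j|b [sb b0 bE]] := @line_curve R (fun j => (w j).2) (fun=> 0).
  - by move=> j; have [] := Hw j.
  - exact: z.
  have : \forall r \near (0 : R), O (p (a r) (b r)).
    apply: open_nbhs_nbhs; split; first exact: (oO _ (pp _ _ sa sb)).
    by rewrite /= a0 b0.
  move=> /nearRP[e e0 He]; have [J HJ] := node_lt e0.
  have [_ _] := Hw J; apply.
  have := He (node J); rewrite subr0 gtr0_norm ?node_gt0 // => /(_ (HJ J (leqnn _))).
  by rewrite (aE J) ?(bE J) ?subrr ?mulr0 ?addr0 ?normr0.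
have [a sa [ae aid]] := cutoff e0; exists a => //; split=> [|s t]; last exact: He.
apply/nearRP; exists (e / 2); first by rewrite divr_gt0.
by move=> s; rewrite subr0; exact: aid.
Qed.

End Planar.

(** * Derivatives of smooth maps *)

Section Differentials.
Context {R : realType}.
Implicit Types (E F : tvsType R) (t s : R).

Definition is_linear E F (f : E -> F) :=
  forall (r : R) x y, f (r *: x + y) = r *: f x + f y.

Lemma is_linear0 E F (f : E -> F) : is_linear f -> f 0 = 0.
Proof.
move=> lf; have := lf 1 0 0; rewrite !scale1r addr0 => /eqP.
by rewrite -subr_eq0 opprD addrA subrr sub0r oppr_eq0 => /eqP.
Qed.

Lemma is_linearZ E F (f : E -> F) (r : R) x : is_linear f -> f (r *: x) = r *: f x.
Proof. by move=> lf; have := lf r x 0; rewrite !addr0 is_linear0 // addr0. Qed.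

Lemma is_linearD E F (f : E -> F) x y : is_linear f -> f (x + y) = f x + f y.
Proof. by move=> lf; have := lf 1 x y; rewrite !scale1r. Qed.

Lemma is_linearB E F (f : E -> F) x y : is_linear f -> f (x - y) = f x - f y.
Proof. by move=> lf; rewrite is_linearD // -scaleN1r is_linearZ // scaleN1r. Qed.

Lemma ddirP E F (f : E -> F) x v l : convenient F ->
  has_deriv (fun t : R => f (x + t *: v)) 0 l -> ddir f x v = l.
Proof.
move=> [hF _]; rewrite /has_deriv => H.
have {}H : (fun h : R => h^-1 *: (f (x + h *: v) - f x)) @ 0^' --> l.
  apply: cvg_trans H; apply: near_eq_cvg; near=> h.
  by rewrite add0r scale0r addr0.
rewrite /ddir; case: xgetP => [m _ Hm|/(_ l)//].
exact: (cvg_unique hF Hm H).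
Unshelve. all: by end_near. Qed.

Lemma has_deriv_shift E (c : R -> E) t l :
  has_deriv (fun s => c (s + t)) 0 l <-> has_deriv c t l.
Proof.
rewrite /has_deriv.
suff -> : (fun h : R => h^-1 *: (c (0 + h + t) - c (0 + t))) =
  (fun h : R => h^-1 *: (c (t + h) - c t)) by [].
by apply/funext => h; rewrite !add0r (addrC h).
Qed.

Definition vhadamard E (c : R -> E) (v : E) t :=
  if t == 0 then v else t^-1 *: (c t - c 0).

Lemma vhadamardE E (c : R -> E) v t : c t = c 0 + t *: vhadamard c v t.
Proof.
rewrite /vhadamard; case: eqVneq => [->|t0]; first by rewrite scale0r addr0.
by rewrite scalerA divff // scale1r addrC subrK.
Qed.

Lemma smooth_vhadamard E (c : R -> E) v : convenient E -> smooth_curve c ->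
  has_deriv c 0 v -> smooth_curve (vhadamard c v).
Proof.
move=> cE sc cv; apply: convenient_smooth => // l lc.
have -> : (fun t => l (vhadamard c v t)) = hadamard (fun t => l (c t) : R).
  apply/funext => t; rewrite /hadamard /vhadamard; case: eqVneq => _.
    by rewrite (is_derive_derive1 (has_deriv_scalar lc cv)).
  by rewrite linearZ linearB /= mulrC.
by apply: smoothR_hadamard; exact: smooth_curve_scalar.
Qed.

Lemma planar_ray E (x : E) (w : R -> E) : convenient E -> smooth_curve w ->
  planar (fun s t => x + s *: w t).
Proof.
move=> cE sw a b sa sb; apply: smooth_curve_add => //; first exact: smooth_curve_cst.
by apply: smooth_curve_scale => //; exact: smooth_curve_comp.
Qed.

(* Hadamard: c r = c 0 + r *: w r; apply additivity on the diagonal to the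
   planar map (s, t) |-> c 0 + s *: w t, which is constant for s = 0. *)
Lemma chain_rule E F (O : set E) (f : E -> F) (c : R -> E) t v :
  convenient E -> convenient F -> cinf_open O -> smooth_on O f ->
  sm_at c t -> O (c t) -> has_deriv c t v -> has_deriv (f \o c) t (ddir f (c t) v).
Proof.
move=> cE cF oO sf sc Oc cv.
wlog : c t sc Oc cv / t = 0 /\ smooth_curve c => [W|].
  have [d sd /nearRP[e e0 He]] : sm_at (fun s => c (s + t)) 0.
    exact: (proj1 (sm_at_shift c t cE) sc).
  have d0 : c t = d 0 by have := He 0; rewrite subrr normr0 add0r; exact.
  have dc : \forall s \near (0 : R), d s = c (s + t).
    by apply/nearRP; exists e => // s se; rewrite He.
  apply/has_deriv_shift; rewrite d0; apply: (@has_deriv_near _ _ (f \o d)).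
    by near=> s; rewrite /= (near dc s).
  apply: W => //; [exact: sm_at_smooth|by rewrite -d0|].
  have := proj2 (has_deriv_shift c t v) cv; apply: has_deriv_near.
  by near=> s; rewrite (near dc s).
move=> [t0 {}sc]; subst t.
pose w := vhadamard c v; have sw : smooth_curve w by exact: smooth_vhadamard.
have w0 : w 0 = v by rewrite /w /vhadamard eqxx.
pose p s t := c 0 + s *: w t.
have pp : planar p by exact: planar_ray.
have [|a sa [aid Oa]] := planar_localize oO pp.
  by rewrite /p scale0r addr0.
have a0 : a 0 = 0 by exact: nbhs_singleton aid.
pose g s t := f (p (a s) (a t)).
have pg : planar g.
  by move=> u u' su su'; apply: sf => //; apply: (planar_reparam sa sa pp).
have [h sh hh] := planar_deriv cF (p := fun s t => g t s) (fun u u' su su' => pg u' u su' su).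
have D1 : has_deriv (fun r => g r 0) 0 (h 0) := hh 0.
have E1 : ddir f (c 0) v = h 0.
  apply: ddirP => //; apply: has_deriv_near D1.
  by near=> s; rewrite /g /p a0 w0 (near aid s).
have D2 : has_deriv (g 0) 0 0.
  rewrite (_ : g 0 = fun=> f (c 0)); first exact: has_deriv_cst.
  by apply/funext => s; rewrite /g /p a0 scale0r addr0.
have := planar_diag cF pg D1 D2; rewrite addr0 E1; apply: has_deriv_near.
by near=> s; rewrite /g /p /= (near aid s) // -vhadamardE.
Unshelve. all: by end_near. Qed.

Lemma smooth_ray E (x v : E) : convenient E -> smooth_curve (fun t : R => x + t *: v).
Proof.
move=> cE; apply: smooth_curve_add => //; first exact: smooth_curve_cst.
by apply: smooth_curve_scale; [|exact: smoothR_id|exact: smooth_curve_cst].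
Qed.

Lemma has_deriv_ray E (x v : E) : has_deriv (fun t : R => x + t *: v) 0 v.
Proof.
have H : (fun=> v) h @[h --> (0 : R)^'] --> v by exact: cvg_cst.
apply: cvg_trans H; apply: near_eq_cvg; near=> h.
have h0 : h != 0 by near: h; exact: nbhs_dnbhs_neq.
by rewrite add0r scale0r addr0 [x + _]addrC addrK scalerA mulVf // scale1r.
Unshelve. all: by end_near. Qed.

(** The derivative in r, at r = 0, of the planar map (s, r) |-> f (x s + r *: v s), so its
    smoothness in s is an instance of [planar_deriv]. *)
Lemma ddir_smooth E F (O : set E) (f : E -> F) (x v : R -> E) t :
  convenient E -> convenient F -> cinf_open O -> smooth_on O f ->
  sm_at x t -> sm_at v t -> O (x t) -> sm_at (fun s => ddir f (x s) (v s)) t.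
Proof.
move=> cE cF oO sf sx sv Ox.
have [x' sx' xx] := sx; have [v' sv' vv] := sv.
pose p s r := x' (s + t) + r *: v' (s + t).
have st : smoothR (fun s => s + t) by exact: smoothR_translate.
have pp : planar p.
  move=> a b sa sb; apply: smooth_curve_add => //.
    by apply: smooth_curve_comp => //; exact: (smoothR_comp st).
  apply: smooth_curve_scale => //; apply: smooth_curve_comp => //.
  exact: (smoothR_comp st).
have [|a sa [aid Oa]] := planar_localize oO pp.
  by rewrite /p scale0r addr0 add0r -(nbhs_singleton xx).
have a0 : a 0 = 0 by exact: nbhs_singleton aid.
pose g s r := f (p (a s) (a r)).
have pg : planar g.
  by move=> u u' su su'; apply: sf => //; apply: (planar_reparam sa sa pp).
have [h sh hh] := planar_deriv cF pg.
apply/sm_at_shift => //; exists h => //.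
have xx' : \forall s \near (0 : R), x (s + t) = x' (s + t).
  by move/nearRP: xx => [e e0 He]; apply/nearRP; exists e => // s; rewrite subr0 => se;
     apply: He; rewrite addrK.
have vv' : \forall s \near (0 : R), v (s + t) = v' (s + t).
  by move/nearRP: vv => [e e0 He]; apply/nearRP; exists e => // s; rewrite subr0 => se;
     apply: He; rewrite addrK.
near=> s; apply: ddirP => //; apply: has_deriv_near (hh s).
near=> r; rewrite /g /p (near aid r) //.
have -> : a s = s by near: s.
by rewrite (near xx' s) // (near vv' s).
Unshelve. all: by end_near. Qed.

Lemma has_derivZ E (c : R -> E) (r : R) l : convenient E -> smooth_curve c ->
  has_deriv c 0 l -> has_deriv (fun t => c (r * t)) 0 (r *: l).
Proof.
move=> cE sc cl.
have sr : smooth_curve (fun t => c (r * t)).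
  by apply: smooth_curve_comp => //; apply: smoothRM; [exact: smoothR_cst|exact: smoothR_id].
have [d _ dd] := smooth_curveD sr; suff -> : r *: l = d 0 by exact: dd.
apply: convenient_separated => // u uc; rewrite linearZ /=.
rewrite -(is_derive_derive1 (has_deriv_scalar uc (dd 0))).
rewrite -(is_derive_derive1 (has_deriv_scalar uc cl)).
have := @derive1n_affine R 1 1 r 0 (fun t => u (c t) : R) 0 (smooth_curve_scalar uc sc).
rewrite !derive1n1 subr0 mulr0 expr1 mul1r => H.
transitivity (r * derive1 (fun t => u (c t) : R) 0) => //; rewrite -H.
by congr (derive1 _ _); apply/funext => t; rewrite mul1r subr0.
Qed.

(** On the diagonal, (s, t) |-> f (x + (r s) v + t w) runs in the direction r v + w, while its
    partial derivatives are r df(x, v) and df(x, w). *)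
Lemma ddir_linear E F (O : set E) (f : E -> F) x :
  convenient E -> convenient F -> cinf_open O -> smooth_on O f -> O x ->
  is_linear (ddir f x).
Proof.
move=> cE cF oO sf Ox r v w.
pose p s t := x + (r * s) *: v + t *: w.
have pp : planar p.
  move=> a b sa sb; apply: smooth_curve_add => //.
    apply: smooth_curve_add => //; first exact: smooth_curve_cst.
    apply: smooth_curve_scale => //; last exact: smooth_curve_cst.
    by apply: smoothRM => //; exact: smoothR_cst.
  by apply: smooth_curve_scale => //; exact: smooth_curve_cst.
have [|a sa [aid Oa]] := planar_localize oO pp.
  by rewrite /p mulr0 !scale0r !addr0.
have a0 : a 0 = 0 by exact: nbhs_singleton aid.
pose g s t := f (p (a s) (a t)).
have pg : planar g.
  by move=> u u' su su'; apply: sf => //; apply: (planar_reparam sa sa pp).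
have DD u : has_deriv (f \o (fun t : R => x + t *: u)) 0 (ddir f x u).
  have -> : ddir f x u = ddir f (x + (0 : R) *: u) u by rewrite scale0r addr0.
  apply: (chain_rule cE cF oO sf).
  - exact/sm_at_smooth/smooth_ray.
  - by rewrite scale0r addr0.
  - exact: has_deriv_ray.
have D2 : has_deriv (g 0) 0 (ddir f x w).
  apply: has_deriv_near (DD w); near=> t.
  by rewrite /g /p a0 mulr0 scale0r addr0 (near aid t).
have D1 : has_deriv (fun s => g s 0) 0 (r *: ddir f x v).
  have [d sd /nearRP[e e0 He]] : sm_at (f \o (fun t : R => x + t *: v)) 0.
    apply: (smooth_on_sm_at cE oO sf); last by rewrite scale0r addr0.
    exact/sm_at_smooth/smooth_ray.
  have dv : has_deriv d 0 (ddir f x v).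
    by apply: has_deriv_near (DD v); apply/nearRP; exists e.
  have sdr : \forall s \near (0 : R), d (r * s) = f (x + (r * s) *: v).
    apply/nearRP; exists (e / (`|r| + 1)); first by rewrite divr_gt0 // ltr_wpDl.
    move=> s; rewrite !subr0 ltr_pdivlMr ?ltr_wpDl // => se; rewrite -He // subr0 normrM.
    by apply: le_lt_trans se; rewrite mulrDr mulr1 mulrC lerDl.
  have H := @has_derivZ F d r _ cF sd dv.
  apply: (has_deriv_near _ H); near=> s.
  by rewrite /g /p a0 scale0r addr0 (near aid s) // (near sdr s).
apply: ddirP => //; apply: has_deriv_near (planar_diag cF pg D1 D2).
near=> t; by rewrite /g /p (near aid t) // scalerDr addrA scalerA [r * t]mulrC.
Unshelve. all: by end_near. Qed.

(** The scalar curve lemma applied to every l \o c: the bound on the l (b j) may depend on l,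
    because convenience turns scalarwise smoothness into smoothness. *)
Lemma tiny_weighted_curve E (b : nat -> E) : convenient E ->
  (forall l : {linear E -> R^o}, continuous l ->
     exists L : R, forall j, `|l (b j) : R| <= L) ->
  exists c : R -> E, [/\ smooth_curve c, c 0 = 0 & forall j, c (node j) = tiny j *: b j].
Proof.
move=> cE Hb.
pose c t := (tiny (pidx t) * plateau (speed (pidx t) * (t - node (pidx t)))) *: b (pidx t).
exists c; split.
- apply: convenient_smooth => // l lc; have [L HL] := Hb l lc.
  have -> : (fun t => l (c t)) = fun t => (fun j => tiny j * l (b j)) (pidx t) *
      plateau (speed (pidx t) * (t - node (pidx t))).
    by apply/funext => t; rewrite linearZ /= /GRing.scale /=; ring.
  apply: (@smooth_curve_lemma R (@plateau R) (fun j => tiny j * l (b j)) L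
    (@flat_ends_plateau R)) => j.
  by rewrite normrM gtr0_norm ?tiny_gt0 // mulrC ler_wpM2r // ltW // tiny_gt0.
- have /negP := @pidx0 R; rewrite -ltNge => /ltW H.
  by rewrite /c plateau0 // mulr0 scale0r.
- move=> j; rewrite /c (pidxE (piece_node j)) subrr mulr0 plateau1 ?mulr1 //.
  by rewrite normr0.
Qed.

(** If U fails to absorb f B, there are b j in B with tiny j *: f (b j) outside U. A smooth curve c
    passes through tiny j *: b j at [node j] and through 0 at time 0, so f \o c would leave U
    arbitrarily close to time 0. *)
Lemma linear_smooth_bounded E F (f : E -> F) : convenient E -> is_linear f ->
  (forall c : R -> E, smooth_curve c -> smooth_curve (f \o c)) -> bounded_linear f.
Proof.
move=> cE lf sf; split=> // B vB U U0; apply: contrapT => H.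
have /choice[b Hb] (j : nat) : exists b, B b /\ ~ U (tiny j *: f b).
  apply: contrapT => Hj; apply: H; exists (tiny j)^-1; first by rewrite invr_gt0 tiny_gt0.
  move=> _ [b Bb <-]; exists (tiny j *: f b).
    by apply: contrapT => nU; apply: Hj; exists b.
  by rewrite scalerA mulVf ?scale1r // gt_eqF // tiny_gt0.
have [|c [sc c0 cj]] := @tiny_weighted_curve E b cE.
  move=> l lc; have U1 : nbhs (0 : E) (l @^-1` [set r | `|r : R| < 1]).
    apply: lc; rewrite linear0; apply/nearRP; exists 1 => // s.
    by rewrite subr0.
  have [r r0 Hr] := vB _ U1; exists r => j.
  have [x /= x1 <-] := Hr _ (proj1 (Hb j)).
  by rewrite linearZ /= normrM gtr0_norm // ler_piMr ?(ltW r0) // ltW.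
have : \forall s \near (0 : R), U (f (c s)).
  have := @smooth_curve_cont R F _ (sf _ sc) 0; apply.
  by rewrite /= c0 is_linear0.
move=> /nearRP[e e0 He]; have [J HJ] := node_lt e0.
have [_] := Hb J; apply; rewrite -is_linearZ // -cj; apply: He.
by rewrite subr0 gtr0_norm ?node_gt0 //; exact: HJ.
Qed.

(** The map (t, r) |-> r *: c t is continuous and vanishes for r = 0; compactness of the segment
    gives one r > 0 that works for all t. *)
Lemma curve_segment_bounded E (c : R -> E) (a b : R) : smooth_curve c ->
  vN_bounded (c @` `[a, b]).
Proof.
move=> sc U U0.
have /compact_near_coveringP H := @segment_compact R a b.
have {}H := H R (nbhs (0 : R)) (fun r t => U (r *: c t)) _.
have : \forall r \near (0 : R), `[a, b] `<=` (fun t => U (r *: c t)).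
  apply: H => t _.
  have K : (fun z : R * R => z.2 *: c z.1) @ (nbhs t, nbhs (0 : R)) --> (0 : E).
    rewrite -(scale0r (c t)); apply: tvs_cvgZ; first exact: cvg_snd.
    have ct : c s @[s --> t] --> c t by exact: smooth_curve_cont.
    by apply: (cvg_comp _ _ _ ct); exact: cvg_fst.
  exact: K U0.
move=> /nearRP[e e0 He]; exists (e / 2)^-1; first by rewrite invr_gt0 divr_gt0.
have e2 : e / 2 != 0 by rewrite gt_eqF // divr_gt0.
move=> _ [t tab <-]; exists ((e / 2) *: c t).
  by apply: He tab; rewrite subr0 gtr0_norm ?divr_gt0 //; lra.
by rewrite scalerA mulVf // scale1r.
Qed.

(* Hadamard twice: c (t + h) = c t + h *: (c' t + h *: r h), and r is bounded on
   [-1, 1]. *)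
Lemma bounded_linear_smooth E F (f : E -> F) (c : R -> E) : convenient E ->
  bounded_linear f -> smooth_curve c -> smooth_curve (f \o c).
Proof.
move=> cE [lf bf] sc; pose P d := exists2 c : R -> E, smooth_curve c & d = f \o c.
apply: (@smooth_coind _ _ P); last by exists c.
move=> _ [{sc}c sc ->]; have [c' sc' cc'] := smooth_curveD sc.
exists (f \o c'); first by exists c'.
move=> t.
have sct : smooth_curve (fun s => c (s + t)).
  by apply: smooth_curve_comp => //; exact: smoothR_translate.
pose w := vhadamard (fun s => c (s + t)) (c' t).
have sw : smooth_curve w by apply: smooth_vhadamard => //; apply/has_deriv_shift.
have [w' _ ww'] := smooth_curveD sw.
pose r := vhadamard w (w' 0).
have sr : smooth_curve r by exact: smooth_vhadamard.
have E1 h : c (t + h) - c t = h *: (c' t + h *: r h).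
  have -> : c' t + h *: r h = w h.
    by rewrite (vhadamardE w (w' 0)); congr (_ + _); rewrite /w /vhadamard eqxx.
  have := vhadamardE (fun s => c (s + t)) (c' t) h.
  by rewrite add0r [t + h]addrC => ->; rewrite [c t + _]addrC addrK.
have K : (fun h : R => f (c' t) + h *: f (r h)) h @[h --> (0 : R)^'] --> f (c' t).
  rewrite -[X in _ --> X]addr0; apply: tvs_cvgD; first exact: cvg_cst.
  move=> U U0; rewrite /= nbhs_simpl.
  have S : (fun z : R^o * F => z.1 *: z.2) @ (nbhs (0 : R), nbhs (0 : F)) --> (0 : F).
    by rewrite -[X in _ --> X](scale0r (0 : F)); exact: (@scale_continuous R F (0, 0)).
  have [[A V] [/= A0 V0] AV] := S _ U0.
  have [rho rho0 Hr] := bf _ (curve_segment_bounded (-1) 1 sr) _ V0.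
  move/nearRP: A0 => [e e0 He].
  apply: nbhs_dnbhs; apply/nearRP; exists (Num.min 1 (e / rho)).
    by rewrite lt_min ltr01 divr_gt0.
  move=> h; rewrite subr0 lt_min => /andP[h1 he].
  have [|u Vu fu] := Hr (f (r h)).
    exists (r h) => //; exists h => //=.
    by rewrite in_itv /= -ler_norml ltW.
  rewrite /= -fu scalerA; apply: (AV (h * rho, u)); split=> //=; apply: He.
  by rewrite subr0 normrM (gtr0_norm rho0) -ltr_pdivlMr.
apply: cvg_trans K; apply: near_eq_cvg; near=> h => /=.
have h0 : h != 0 by near: h; exact: nbhs_dnbhs_neq.
by rewrite -(is_linearB _ _ lf) E1 (is_linearZ h _ lf) scalerA mulVf // scale1r
  (is_linearD _ _ lf) (is_linearZ h _ lf).
Unshelve. all: by end_near. Qed.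

Lemma bounded_linear_sm_at E F (f : E -> F) (c : R -> E) t : convenient E ->
  bounded_linear f -> sm_at c t -> sm_at (f \o c) t.
Proof.
move=> cE bf [d sd cd]; exists (f \o d); first exact: bounded_linear_smooth.
by near=> s; rewrite /= (near cd s).
Unshelve. all: by end_near. Qed.


End Differentials.

(** * Manifolds tested along curves *)

Section Charts.
Context {R : realType}.

(* Smoothness of a curve at t, read in the chart c ([csm]) and on a manifold
   ([msm], below). *)
Definition csm (X : Type) (c : chart R X) (g : R -> X) (t : R) :=
  (\forall s \near t, cdom c (g s)) /\ sm_at (cmap c \o g) t.

(** The part of [is_chart] that does not refer to an atlas. *)
Definition good_chart (X : Type) (c : chart R X) :=
  [/\ convenient (cmodel c),
      (forall x y, cdom c x -> cdom c y -> cmap c x = cmap c y -> x = y) &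
      cinf_open (cmap c @` cdom c)].

Lemma csm_near (X : Type) (c : chart R X) (g h : R -> X) t :
  (\forall s \near t, g s = h s) -> csm c g t -> csm c h t.
Proof.
move=> gh [dg sg]; split; first by near=> s; rewrite -(near gh s) //; near: s.
by apply: sm_at_near sg; near=> s; rewrite /= (near gh s).
Unshelve. all: by end_near. Qed.

Lemma chart_repE (X : Type) (c : chart R X) (F : tvsType R) (f : X -> F) x :
  good_chart c -> cdom c x -> chart_rep c f (cmap c x) = f x.
Proof.
move=> [_ ci _] cx; rewrite /chart_rep; case: pselect => [H|[]]; last by exists x.
by case: (cid H) => y /= [cy /ci ->].
Qed.

Lemma chart_lift (X : Type) (c : chart R X) (u : R -> cmodel c) t x :
  good_chart c -> sm_at u t -> cdom c x -> cmap c x = u t ->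
  exists g : R -> X, [/\ csm c g t, g t = x & \forall s \near t, cmap c (g s) = u s].
Proof.
move=> [cc ci co] su cx xu.
have /choice[g Hg] : forall s, exists y, (cmap c @` cdom c) (u s) ->
    cdom c y /\ cmap c y = u s.
  move=> s; have [[y cy yu]|n] := pselect ((cmap c @` cdom c) (u s)); first by exists y.
  by exists x.
have Iu : \forall s \near t, (cmap c @` cdom c) (u s).
  by apply: sm_at_near_open => //; exists x.
have gu : \forall s \near t, cmap c (g s) = u s.
  by near=> s; have [|//] := Hg s; near: s.
exists g; split => //.
- split; first by near=> s; have [|//] := Hg s; near: s.
  by apply: sm_at_near su; near=> s; rewrite /= (near gu s).
- have [|gt gut] := Hg t; first exact: nbhs_singleton Iu.
  by apply: ci => //; rewrite gut.
Unshelve. all: by end_near. Qed.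

Lemma open_nearP (U : set R) : (forall t, U t -> \forall s \near t, U s) -> open U.
Proof. by move=> H; rewrite openE => t /H. Qed.

Lemma chart_openP (X : Type) (c : chart R X) (W : set X) : good_chart c ->
  cinf_open (cmap c @` (cdom c `&` W)) <->
  forall g t, csm c g t -> W (g t) -> \forall s \near t, W (g s).
Proof.
move=> gc; have [cc ci co] := gc; split=> [oW g t [dg sg] Wg|H u su].
  have : \forall s \near t, (cmap c @` (cdom c `&` W)) ((cmap c \o g) s).
    apply: sm_at_near_open => //; exists (g t) => //; split=> //.
    exact: nbhs_singleton dg.
  move=> K; near=> s.
  have [x [cx Wx] xg] : (cmap c @` (cdom c `&` W)) ((cmap c \o g) s) by near: s.
  have -> // : g s = x by apply: ci => //; near: s.
apply: open_nearP => t [x [cx Wx] xu].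
have [g [sg gx gu]] := chart_lift gc (sm_at_smooth t su) cx xu.
have Wg : \forall s \near t, W (g s) by apply: H => //; rewrite gx.
case: sg => dg _; near=> s.
exists (g s); last by near: s.
by split; near: s.
Unshelve. all: by end_near. Qed.

(** Trades [chart_rep] and its default value for curves in X. Openness of the domain, a part of
    [smooth_in_chart], becomes the clause that g stays in W. *)
Lemma smooth_in_chartP (X : Type) (c : chart R X) (W : set X) (F : tvsType R)
    (f : X -> F) : good_chart c -> convenient F ->
  smooth_in_chart c W f <->
  forall g t, csm c g t -> W (g t) ->
    (\forall s \near t, W (g s)) /\ sm_at (f \o g) t.
Proof.
move=> gc cF; have [cc ci co] := gc; split=> [[oW sW] g t gt Wg|H].
  split; first by move/(chart_openP _ gc): oW; apply.
  have [dg sg] := gt.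
  apply: (@sm_at_near _ _ (chart_rep c f \o (cmap c \o g))).
    by near=> s; rewrite /= chart_repE //; near: s.
  apply: (smooth_on_sm_at cc oW) => //; exists (g t) => //; split=> //.
  exact: nbhs_singleton dg.
split; first by apply/(chart_openP _ gc) => g t gt Wg; have [] := H g t gt Wg.
apply: smooth_onI => // u t su [x [cx Wx] xu].
have [g [sg gx gu]] := chart_lift gc su cx xu.
have [|_ sf] := H g t sg; first by rewrite gx.
apply: sm_at_near sf; case: sg => dg _; near=> s.
rewrite /= -(near gu s) // chart_repE //; near: s; exact: dg.
Unshelve. all: by end_near. Qed.

End Charts.

Section ManifoldCurves.
Context {R : realType}.
Implicit Types X Y : manifold R.

Definition atlased X := (forall c, atlas X c -> is_chart X c) /\
  (forall x : X, exists2 c, atlas X c & cdom c x).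

Definition msm X (g : R -> X) t := exists2 c, atlas X c & csm c g t.

(* [atlased] is [is_manifold] without the Hausdorff property. *)
Lemma manifold_atlased X : is_manifold X -> atlased X.
Proof. by case. Qed.

Lemma is_chart_good X c : is_chart X c -> good_chart c.
Proof. by case. Qed.

Lemma is_chartI X c : good_chart c ->
  (forall d, atlas X d -> [/\ good_chart d,
     (forall g t, csm c g t -> cdom d (g t) -> csm d g t) &
     (forall g t, csm d g t -> cdom c (g t) -> csm c g t)]) ->
  is_chart X c.
Proof.
move=> gc H; have [cc ci co] := gc; split=> // d /H[gd cd dc]; have [cd' _ _] := gd.
by split; [apply/(smooth_in_chartP _ _ gc)|apply/(smooth_in_chartP _ _ gd)].
Qed.

Lemma is_chart_csm X c d g t : is_chart X c -> is_chart X d -> atlas X d ->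
  (csm c g t -> cdom d (g t) -> csm d g t) /\ (csm d g t -> cdom c (g t) -> csm c g t).
Proof.
move=> hc hd ad; have [cc _ _ /(_ _ ad)[H1 H2]] := hc; have [cd _ _ _] := hd.
move/(smooth_in_chartP _ _ (is_chart_good hc) cd): H1 => H1.
by move/(smooth_in_chartP _ _ (is_chart_good hd) cc): H2 => H2; split=> ? ?;
  [exact: H1|exact: H2].
Qed.

Lemma msm_csm X c g t : atlased X -> is_chart X c -> msm g t -> cdom c (g t) ->
  csm c g t.
Proof.
move=> [aX _] hc [d ad dg] cg.
by have [_] := is_chart_csm g t hc (aX _ ad) ad; apply.
Qed.

Lemma csm_msm X c g t : atlased X -> is_chart X c -> csm c g t -> msm g t.
Proof.
move=> [aX cX] hc cg; have [d ad dg] := cX (g t); exists d => //.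
by have [H _] := is_chart_csm g t hc (aX _ ad) ad; exact: H.
Qed.

Lemma msm_near X (g h : R -> X) t :
  (\forall s \near t, g s = h s) -> msm g t -> msm h t.
Proof. by move=> gh [c ac cg]; exists c => //; exact: csm_near cg. Qed.

Lemma msm_cst X (x : X) t : atlased X -> msm (fun=> x) t.
Proof.
move=> [_ /(_ x)[c ac cx]]; exists c => //; split; first by near=> s.
exact/sm_at_smooth/smooth_curve_cst.
Unshelve. all: by end_near. Qed.

Lemma mopenP X (U : set X) : atlased X ->
  mopen X U <-> forall g t, msm g t -> U (g t) -> \forall s \near t, U (g s).
Proof.
move=> aX; split=> [oU g t [c ac cg]|H c ac].
  exact: ((chart_openP U (is_chart_good (aX.1 _ ac))).1 (oU c ac)).
apply/(chart_openP _ (is_chart_good (aX.1 _ ac))) => g t cg.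
by apply: H; exists c.
Qed.

Lemma mopen_cdom X c : atlased X -> is_chart X c -> mopen X (cdom c).
Proof. by move=> aX hc; apply/mopenP => // g t /(msm_csm aX hc) H /H[]. Qed.

Lemma mopenI X (U V : set X) : atlased X -> mopen X U -> mopen X V -> mopen X (U `&` V).
Proof.
move=> aX /(mopenP _ aX) oU /(mopenP _ aX) oV; apply/mopenP => // g t gt [Ug Vg].
have h1 := oU _ _ gt Ug; have h2 := oV _ _ gt Vg.
by near=> s; split; near: s.
Unshelve. all: by end_near. Qed.

(** Charts on both sides enter only through the curves read in them, so smooth maps are those that
    preserve smooth germs of curves. Later smoothness claims are all proved in this form. *)
Lemma smooth_mapP X Y (f : X -> Y) : atlased X -> atlased Y ->
  smooth_map X Y f <-> forall g t, msm g t -> msm (f \o g) t.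
Proof.
move=> aX aY; split=> [sf g t [c ac cg]|H c d ac ad].
  have [d ad dfg] := aY.2 (f (g t)); exists d => //.
  have := sf c d ac ad; move/(smooth_in_chartP _ _ (is_chart_good (aX.1 _ ac))).
  have [cd _ _ _] := aY.1 _ ad; move=> /(_ cd) H.
  exact: H.
have [cd _ _ _] := aY.1 _ ad.
apply/(smooth_in_chartP _ _ (is_chart_good (aX.1 _ ac))) => // g t cg dfg.
have : msm (f \o g) t by apply: H; exists c.
by move=> /(msm_csm aY (aY.1 _ ad)) /(_ dfg).
Qed.

Lemma sval_inj (T : Type) (P : T -> Prop) : injective (@sval T P).
Proof. by move=> [x Px] [y Py] /= e; subst y; congr exist; exact: Prop_irrelevance. Qed.

Lemma msm_sub X (U : set X) (g : R -> sub_manifold U) t :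
  msm g t <-> msm (fun s => sval (g s)) t.
Proof.
split=> [[_ [c ac ->] cg]|[c ac cg]]; first by exists c.
by exists (sub_chart U c) => //; exists c.
Qed.

Lemma is_chart_sub X (U : set X) c : atlased X -> mopen X U -> is_chart X c ->
  is_chart (sub_manifold U) (sub_chart U c).
Proof.
move=> aX oU hc.
have gs d : is_chart X d -> good_chart (sub_chart U d).
  move=> hd; have [cd di od _] := hd; split => //=.
    by move=> x y dx dy /di => /(_ dx dy)/sval_inj.
  have -> : (fun x : {x | U x} => cmap d (sval x)) @` [set x | cdom d (sval x)] =
      cmap d @` (cdom d `&` U).
    rewrite eqEsubset; split=> [_ [x dx <-]|_ [x [dx Ux] <-]].
      by exists (sval x) => //; split=> //; exact: svalP.
    by exists (exist _ x Ux).
  apply/(chart_openP _ (is_chart_good hd)) => g t dg.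
  by move/(mopenP _ aX): oU; apply; exact: csm_msm dg.
apply: is_chartI; first exact: gs.
move=> _ [d ad ->]; split; first exact/gs/aX.1.
  move=> g t cg dg.
  exact: ((is_chart_csm (fun s => sval (g s)) t hc (aX.1 _ ad) ad).1 cg dg).
move=> g t dg cg.
exact: ((is_chart_csm (fun s => sval (g s)) t hc (aX.1 _ ad) ad).2 dg cg).
Qed.

Lemma atlased_sub X (U : set X) : atlased X -> mopen X U -> atlased (sub_manifold U).
Proof.
move=> aX oU; split=> [_ [c ac ->]|x]; first by apply: is_chart_sub => //; exact: aX.1.
by have [c ac cx] := aX.2 (sval x); exists (sub_chart U c) => //; exists c.
Qed.

Lemma csm_prod (X Y : Type) (c : chart R X) (d : chart R Y) (g : R -> X * Y) t :
  csm (prod_chart c d) g t <-> csm c (fun s => (g s).1) t /\ csm d (fun s => (g s).2) t.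
Proof.
split=> [[dg /sm_at_pairP[s1 s2]]|[[d1 s1] [d2 s2]]].
  by split; split=> //; near=> s; have [] : cdom c (g s).1 /\ cdom d (g s).2 by near: s.
split; last exact/sm_at_pairP.
by near=> s; split; near: s.
Unshelve. all: by end_near. Qed.

Lemma good_chart_prod (X Y : Type) (c : chart R X) (d : chart R Y) :
  good_chart c -> good_chart d -> good_chart (prod_chart c d).
Proof.
move=> [cc ci co] [dc di od]; split; first exact: convenient_prod.
  by move=> [x y] [x' y'] [/= cx dy] [/= cx' dy'] [/ci -> // /di ->].
move=> u su; apply: open_nearP => t [[x y] [/= cx dy] xyu].
have s1 : sm_at (fun s => (u s).1) t by exact/sm_at_smooth/smooth_curve_fst.
have s2 : sm_at (fun s => (u s).2) t by exact/sm_at_smooth/smooth_curve_snd.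
have o1 : \forall s \near t, (cmap c @` cdom c) (u s).1.
  by apply: (sm_at_near_open co s1); exists x => //; rewrite -xyu.
have o2 : \forall s \near t, (cmap d @` cdom d) (u s).2.
  by apply: (sm_at_near_open od s2); exists y => //; rewrite -xyu.
near=> s.
have [x' cx' x'u] : (cmap c @` cdom c) (u s).1 by near: s.
have [y' dy' y'u] : (cmap d @` cdom d) (u s).2 by near: s.
by exists (x', y') => //=; rewrite x'u y'u; case: (u s).
Unshelve. all: by end_near. Qed.

Lemma msm_prod X Y (g : R -> prod_manifold X Y) t :
  msm g t <-> msm (fun s => (g s).1) t /\ msm (fun s => (g s).2) t.
Proof.
split=> [[_ [c [d [ac ad ->]]] /csm_prod[cg dg]]|[[c ac cg] [d ad dg]]].
  by split; [exists c|exists d].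
by exists (prod_chart c d); [exists c, d|exact/csm_prod].
Qed.

Lemma atlased_prod X Y : atlased X -> atlased Y -> atlased (prod_manifold X Y).
Proof.
move=> aX aY; split=> [_ [c [d [ac ad ->]]]|[x y]]; last first.
  have [c ac cx] := aX.2 x; have [d ad dy] := aY.2 y.
  by exists (prod_chart c d) => //; exists c, d.
have gX c' : atlas X c' -> good_chart c' by move=> /aX.1/is_chart_good.
have gY c' : atlas Y c' -> good_chart c' by move=> /aY.1/is_chart_good.
apply: is_chartI; first by apply: good_chart_prod; [exact: gX|exact: gY].
move=> _ [c' [d' [ac' ad' ->]]]; split.
- by apply: good_chart_prod; [exact: gX|exact: gY].
- move=> g t /csm_prod[cg dg] [c'g d'g]; apply/csm_prod; split.
    exact: ((is_chart_csm _ _ (aX.1 _ ac) (aX.1 _ ac') ac').1 cg c'g).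
  exact: ((is_chart_csm _ _ (aY.1 _ ad) (aY.1 _ ad') ad').1 dg d'g).
- move=> g t /csm_prod[cg dg] [c'g d'g]; apply/csm_prod; split.
    exact: ((is_chart_csm _ _ (aX.1 _ ac) (aX.1 _ ac') ac').2 cg c'g).
  exact: ((is_chart_csm _ _ (aY.1 _ ad) (aY.1 _ ad') ad').2 dg d'g).
Qed.

Lemma msm_model (E : tvsType R) (g : R -> model_manifold E) t :
  msm g t <-> sm_at (g : R -> E) t.
Proof.
split=> [[_ -> [_ sg]] //|sg]; exists (@Chart R E E setT id) => //; split=> //.
by near=> s.
Unshelve. all: by end_near. Qed.

Lemma atlased_model (E : tvsType R) : convenient E -> atlased (model_manifold E).
Proof.
move=> cE; have gE : good_chart (@Chart R E E setT id).
  split=> //= c sc; apply: open_nearP => t _; near=> s; by exists (c s).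
split=> [_ ->|x]; last by exists (@Chart R E E setT id).
by apply: is_chartI => // _ ->.
Unshelve. all: by end_near. Qed.

End ManifoldCurves.

(** * Vector bundles tested along curves *)

Section BundleCurves.
Context {R : realType}.
Implicit Types (X Y : manifold R) (s t : R).

Definition tcoord (X : Type) (F : X -> Type) (p : triv R F) (g : R -> {x & F x}) (s : R) :=
  tmap p (projT1 (g s)) (projT2 (g s)).

Lemma lift_sub X (U : set X) (g : R -> X) t : (\forall s \near t, U (g s)) ->
  exists b : R -> sub_manifold U, \forall s \near t, sval (b s) = g s.
Proof.
move=> Ug; have Ut := nbhs_singleton Ug.
exists (fun s => if pselect (U (g s)) is left H then exist U (g s) H else exist U (g t) Ut).
near=> s; case: pselect => // -[]; near: s; exact: Ug.
Unshelve. all: by end_near. Qed.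

Lemma injective_surjective_bijective (S T : Type) (f : S -> T) :
  injective f -> (forall y, exists x, f x = y) -> bijective f.
Proof.
by move=> fi /choice[g gK]; exists g => // x; apply: fi; rewrite gK.
Qed.

Lemma is_linear_comp (E F G : tvsType R) (f : E -> F) (g : F -> G) :
  is_linear f -> is_linear g -> is_linear (g \o f).
Proof. by move=> lf lg r x y /=; rewrite lf lg. Qed.

Section TrivCompat.
Context X (F : X -> Type) (p q : triv R F).
Hypotheses (aX : atlased X) (oD : mopen X (tdom p `&` tdom q)).
Hypotheses (cp : convenient (tmodel p)) (cq : convenient (tmodel q)).

Lemma triv_compatE : triv_compat p q ->
  (forall x, tdom p x -> tdom q x -> exists2 h, is_linear h &
     forall a, tmap q x a = h (tmap p x a)) /\
  (forall g t, msm (fun s => projT1 (g s)) t ->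
     tdom p (projT1 (g t)) -> tdom q (projT1 (g t)) ->
     sm_at (tcoord p g) t -> sm_at (tcoord q g) t).
Proof.
move=> [h [bh hE sh]]; split=> [x px qx|g t gt pg qg sg].
  exists (h (exist _ x (conj px qx))); first by case: (bh (exist _ x (conj px qx))).
  exact: hE (exist _ x (conj px qx)).
have Dg : \forall s \near t, (tdom p `&` tdom q) (projT1 (g s)).
  by move/(mopenP _ aX): oD; apply.
have [b bg] := lift_sub Dg.
have aP : atlased (prod_manifold (sub_manifold (tdom p `&` tdom q))
                                 (model_manifold (tmodel p))).
  by apply: atlased_prod; [exact: atlased_sub|exact: atlased_model].
move/(smooth_mapP _ aP (atlased_model cq)): sh.
move=> /(_ (fun s => (b s, tcoord p g s)) t) H.
have /msm_model : msm ((fun xv => h xv.1 xv.2 : model_manifold (tmodel q)) \o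
    (fun s => (b s, tcoord p g s))) t.
  apply: H; apply/msm_prod; split; last exact/msm_model.
  apply/msm_sub; apply: msm_near gt; near=> s; exact/esym/(near bg s).
apply: sm_at_near; near=> s; rewrite /= /tcoord.
have : sval (b s) = projT1 (g s) by near: s.
case: (b s) (g s) => x Dx [y a] /= e; subst y.
exact/esym/(hE (exist _ x Dx)).
Unshelve. all: by end_near. Qed.

(** The chart change is tmap q after the inverse of tmap p. Its boundedness comes for free: over a
    constant base point it is linear and preserves smooth curves, so [linear_smooth_bounded]
    applies. *)
Lemma triv_compatI : (forall x, tdom p x -> bijective (tmap p x)) ->
  (forall x, tdom p x -> tdom q x -> exists2 h, is_linear h &
     forall a, tmap q x a = h (tmap p x a)) ->
  (forall g t, msm (fun s => projT1 (g s)) t ->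
     tdom p (projT1 (g t)) -> tdom q (projT1 (g t)) ->
     sm_at (tcoord p g) t -> sm_at (tcoord q g) t) -> triv_compat p q.
Proof.
move=> bp lin sm.
have iv (x : sub_manifold (tdom p `&` tdom q)) :
    {g | cancel (tmap p (sval x)) g /\ cancel g (tmap p (sval x))}.
  by apply: cid; have [g ? ?] := bp _ (svalP x).1; exists g.
pose inv x := sval (iv x).
have invK x : cancel (tmap p (sval x)) (inv x) by exact: (svalP (iv x)).1.
have Kinv x : cancel (inv x) (tmap p (sval x)) by exact: (svalP (iv x)).2.
have S (b : R -> sub_manifold (tdom p `&` tdom q)) (v : R -> tmodel p) t : msm b t ->
    sm_at v t -> sm_at (fun s => tmap q (sval (b s)) (inv (b s) (v s))) t.
  move=> /msm_sub mb sv.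
  apply: (sm (fun s => existT F (sval (b s)) (inv (b s) (v s)))) => //.
  - exact: (svalP (b t)).1.
  - exact: (svalP (b t)).2.
  - by apply: sm_at_near sv; near=> s; rewrite /tcoord /= Kinv.
have lin' x : is_linear (fun v => tmap q (sval x) (inv x v)).
  have [h lh hE] := lin _ (svalP x).1 (svalP x).2.
  by move=> r v w; rewrite !hE !Kinv.
exists (fun x v => tmap q (sval x) (inv x v)); split.
- move=> x; apply: linear_smooth_bounded => // c sc.
  apply: smooth_curve_local => // t; apply: (S (fun=> x)); last exact: sm_at_smooth.
  by apply: msm_cst; exact: atlased_sub.
- by move=> x a; rewrite invK.
- apply/smooth_mapP.
  + by apply: atlased_prod; [exact: atlased_sub|exact: atlased_model].
  + exact: atlased_model.
  move=> g t /msm_prod[g1 /msm_model g2]; apply/msm_model; exact: S.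
Unshelve. all: by end_near. Qed.

End TrivCompat.

Section TotalSpace.
Context X (B : bundle X).
Hypothesis bB : is_bundle B.

Let aX : atlased X.
Proof. by case: bB => /manifold_atlased. Qed.

(** Bundle charts are by definition compatible with the given trivializations; two of them are
    compared through a trivialization at the point in question. *)
Lemma bundle_chart_trans p q : is_bundle_chart B p -> is_bundle_chart B q ->
  (forall x, tdom p x -> tdom q x -> exists2 h, is_linear h &
     forall a, tmap q x a = h (tmap p x a)) /\
  (forall g t, msm (fun s => projT1 (g s)) t ->
     tdom p (projT1 (g t)) -> tdom q (projT1 (g t)) ->
     sm_at (tcoord p g) t -> sm_at (tcoord q g) t).
Proof.
move=> [cp op bp Hp] [cq oq bq Hq]; case: bB => _ tB cB.
have K r : trivs B r ->
  [/\ forall x, tdom p x -> tdom r x -> exists2 h, is_linear h &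
        forall a, tmap r x a = h (tmap p x a),
      forall x, tdom r x -> tdom q x -> exists2 h, is_linear h &
        forall a, tmap q x a = h (tmap r x a),
      forall g t, msm (fun s => projT1 (g s)) t ->
        tdom p (projT1 (g t)) -> tdom r (projT1 (g t)) ->
        sm_at (tcoord p g) t -> sm_at (tcoord r g) t &
      forall g t, msm (fun s => projT1 (g s)) t ->
        tdom r (projT1 (g t)) -> tdom q (projT1 (g t)) ->
        sm_at (tcoord r g) t -> sm_at (tcoord q g) t].
  move=> rB; have [cr or' _ _] := tB _ rB.
  have [L1 S1] := triv_compatE aX (mopenI aX op or') cp cr (Hp _ rB).1.
  by have [L2 S2] := triv_compatE aX (mopenI aX or' oq) cr cq (Hq _ rB).2.
split=> [x px qx|g t gt pg qg sg].
  have [r rB rx] := cB x; have [L1 L2 _ _] := K r rB.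
  have [h1 l1 E1] := L1 x px rx; have [h2 l2 E2] := L2 x rx qx.
  by exists (h2 \o h1); [exact: is_linear_comp|move=> a; rewrite E2 E1].
have [r rB rx] := cB (projT1 (g t)); have [_ _ S1 S2] := K r rB.
by apply: S2 => //; exact: S1.
Qed.

Lemma csm_total c p (g : R -> total_space B) t : csm (total_chart c p) g t <->
  [/\ csm c (fun s => projT1 (g s)) t, \forall s \near t, tdom p (projT1 (g s)) &
      sm_at (tcoord p g) t].
Proof.
split=> [[dg /sm_at_pairP[s1 s2]]|[[d1 s1] d2 s2]].
  split => //; first split => //.
    by near=> s; have [] : cdom c (projT1 (g s)) /\ tdom p (projT1 (g s)) by near: s.
  by near=> s; have [] : cdom c (projT1 (g s)) /\ tdom p (projT1 (g s)) by near: s.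
split; last exact/sm_at_pairP.
by near=> s; split; near: s.
Unshelve. all: by end_near. Qed.

Lemma good_chart_total c p : is_chart X c -> is_bundle_chart B p ->
  good_chart (@total_chart R X B c p).
Proof.
move=> hc [cp op bp Hp]; have gc := is_chart_good hc; have [cc ci co] := gc; split.
- exact: convenient_prod.
- move=> [x a] [y b] [/= cx px] [/= cy py] [exy]; have e := ci _ _ cx cy exy; subst y.
  by move=> eab; congr existT; have [h hK _] := bp x px; rewrite -[a]hK eab hK.
- have oW : cinf_open (cmap c @` (cdom c `&` tdom p)).
    apply/(chart_openP _ gc) => g t cg; move/(mopenP _ aX): op; apply.
    exact: csm_msm cg.
  have -> : cmap (@total_chart R X B c p) @` cdom (@total_chart R X B c p) =
      [set uv | (cmap c @` (cdom c `&` tdom p)) uv.1].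
    rewrite eqEsubset; split=> [_ [[x a] [/= cx px] <-]|[u v] [x [cx px] /= xu]].
      by exists x.
    have [h hK Kh] := bp x px; exists (existT _ x (h v)) => //=.
    by rewrite xu Kh.
  move=> u su; apply: open_nearP => t ut.
  apply: (sm_at_near_open oW (c := fun s => (u s).1)) => //.
  exact/sm_at_smooth/smooth_curve_fst.
Qed.

Lemma is_chart_total c p : is_chart X c -> is_bundle_chart B p ->
  is_chart (total_space B) (@total_chart R X B c p).
Proof.
move=> hc hp; apply: is_chartI; first exact: good_chart_total.
have [_ tB _] := bB; have [_ op _ _] := hp.
move=> _ [d [q [ad tq ->]]]; have hd := aX.1 _ ad; have hq := tB _ tq.
have [_ oq _ _] := hq.
split; first exact: good_chart_total.
- move=> g t /csm_total[cg pg sg] [dg qg]; have mg := csm_msm aX hc cg.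
  apply/csm_total; split; first exact: msm_csm.
    by move/(mopenP _ aX): oq; apply.
  apply: (bundle_chart_trans hp hq).2 => //; exact: nbhs_singleton pg.
- move=> g t /csm_total[cg pg sg] [dg qg]; have mg := csm_msm aX hd cg.
  apply/csm_total; split; first exact: msm_csm.
    by move/(mopenP _ aX): op; apply.
  apply: (bundle_chart_trans hq hp).2 => //; exact: nbhs_singleton pg.
Qed.

Lemma atlased_total : atlased (total_space B).
Proof.
have [_ tB cB] := bB; split=> [_ [c [p [ac tp ->]]]|[x a]].
  by apply: is_chart_total; [exact: aX.1|exact: tB].
have [c ac cx] := aX.2 x; have [p tp px] := cB x.
by exists (total_chart c p) => //; exists c, p.
Qed.

(** By [bundle_chart_trans], smoothness in the total space may be tested in any bundle chart at the
    point. *)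
Lemma msm_total p (g : R -> total_space B) t : is_bundle_chart B p ->
  tdom p (projT1 (g t)) ->
  msm g t <-> msm (fun s => projT1 (g s)) t /\ sm_at (tcoord p g) t.
Proof.
move=> hp pg; have [_ tB cB] := bB; split=> [[_ [c [q [ac tq ->]]] /csm_total[cg qg sg]]|[mg sg]].
  have mg : msm (fun s => projT1 (g s)) t by exists c.
  split => //; apply: (bundle_chart_trans (tB _ tq) hp).2 => //.
  exact: nbhs_singleton qg.
have [c ac cg] := aX.2 (projT1 (g t)); have hc := aX.1 _ ac.
apply: (csm_msm atlased_total (is_chart_total hc hp)).
apply/csm_total; split => //; first exact: msm_csm.
by have [_ op _ _] := hp; move/(mopenP _ aX): op; apply.
Qed.

Lemma msm_base (g : R -> total_space B) t : msm g t -> msm (fun s => projT1 (g s)) t.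
Proof. by move=> [_ [c [p [ac tp ->]]] /csm_total[cg _ _]]; exists c. Qed.

Lemma bundle_chart_at (x : X) : exists2 p, is_bundle_chart B p & tdom p x.
Proof.
by have [_ tB cB] := bB; have [p /tB hp px] := cB x; exists p.
Qed.

(** Points over different base points are separated in X. Two points of one fibre are separated in a
    fibre coordinate by open sets of the locally convex topology; their preimages are open because
    smooth curves are continuous. *)
Lemma hausdorff_total (a b : total_space B) : a <> b -> exists U V : set (total_space B),
  [/\ mopen (total_space B) U, mopen (total_space B) V, U a, V b & U `&` V = set0].
Proof.
have aT := atlased_total; case: a b => [x a] [y b] ab.
have [exy|nxy] := pselect (x = y); last first.
  have [[_ _ hX] _ _] := bB; have [U [V [oU oV Ux Vy UV]]] := hX x y nxy.
  have pre (W : set X) : mopen X W -> mopen (total_space B) [set a | W (projT1 a)].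
    move=> /(mopenP _ aX) oW; apply/(mopenP _ aT) => g t mg.
    exact: (oW _ _ (msm_base mg)).
  exists [set a | U (projT1 a)], [set a | V (projT1 a)]; split => //; [exact: pre|exact: pre|].
  by rewrite -subset0 => -[z c] [/= Uz Vz]; rewrite -[False]/(set0 z) -UV.
subst y; have [p hp px] := bundle_chart_at x; have [[hM _] op bp _] := hp.
have nab : tmap p x a <> tmap p x b.
  by move=> e; apply: ab; have [h hK _] := bp x px; rewrite -[a]hK e hK.
move: hM; rewrite open_hausdorff => /(_ _ _ (introN eqP nab)) [[U V]] /=.
rewrite !in_setE => -[Ua Vb] [oU oV /eqP UV].
have {}UV : U `&` V `<=` set0 by rewrite subset0; apply/eqP.
have pre (W : set (tmodel p)) : open W ->
    mopen (total_space B) [set z | tdom p (projT1 z) /\ W (tmap p (projT1 z) (projT2 z))].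
  move=> oW; apply/(mopenP _ aT) => g t mg [pg Wg].
  have [mb sg] := (msm_total hp pg).1 mg.
  have dg : \forall s \near t, tdom p (projT1 (g s)) by move/(mopenP _ aX): op; apply.
  have Wn : \forall s \near t, W (tcoord p g s).
    by have := sm_at_cont sg; apply; exact: open_nbhs_nbhs.
  by near=> s; split; near: s.
exists [set z | tdom p (projT1 z) /\ U (tmap p (projT1 z) (projT2 z))],
       [set z | tdom p (projT1 z) /\ V (tmap p (projT1 z) (projT2 z))].
split => //; [exact: pre|exact: pre|].
rewrite -subset0 => -[z c] [/= [_ Uz] [_ Vz]].
exact: (UV (tmap p z c)).
Unshelve. all: by end_near. Qed.

Lemma is_manifold_total : is_manifold (total_space B).
Proof. by have [h1 h2] := atlased_total; split => //; exact: hausdorff_total. Qed.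

End TotalSpace.

Lemma is_manifold_sub X (U : set X) : is_manifold X -> mopen X U ->
  is_manifold (sub_manifold U).
Proof.
move=> mX oU; have aX := manifold_atlased mX; have aU := atlased_sub aX oU.
have [h1 h2] := aU; split => // x y xy.
have nxy : sval x <> sval y by move=> /sval_inj.
have [_ _ /(_ _ _ nxy)[V [W [oV oW Vx Wy VW]]]] := mX.
have pre (Z : set X) : mopen X Z -> mopen (sub_manifold U) [set z | Z (sval z)].
  move=> /(mopenP _ aX) oZ; apply/(mopenP _ aU) => g t /msm_sub mg; exact: oZ mg.
exists [set z | V (sval z)], [set z | W (sval z)]; split => //; [exact: pre|exact: pre|].
by rewrite -subset0 => z [/= Vz Wz]; rewrite -[False]/(set0 (sval z)) -VW.
Qed.

End BundleCurves.

(** * Bundle morphisms *)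

Section Morphisms.
Context {R : realType} (X : manifold R) (B B' : bundle X).
Hypotheses (bB : is_bundle B) (bB' : is_bundle B').
Variable h : forall x, B x -> B' x.
Implicit Types s t : R.

Definition total_map (a : {x & B x}) : {x & B' x} :=
  existT B' (projT1 a) (h (projT2 a)).

(** One pair of bundle charts at each point suffices for linearity, by the transition maps;
    boundedness follows by pushing forward curves that stay in a single fibre. *)
Lemma is_morphismI :
  (forall x, exists p p', [/\ is_bundle_chart B p, is_bundle_chart B' p',
     tdom p x, tdom p' x & exists2 g, is_linear g &
       forall a, tmap p' x (h a) = g (tmap p x a)]) ->
  (forall (g : R -> total_space B) t, msm g t ->
     msm (total_map \o g : R -> total_space B') t) ->
  is_morphism B B' (@h).
Proof.
move=> lin sm; have [mX tB cB] := bB; have [_ tB' cB'] := bB'.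
have aX := manifold_atlased mX.
split; first by apply/smooth_mapP; [exact: atlased_total|exact: atlased_total|exact: sm].
move=> p q x tp tq px qx; have [p0 [p0' [h0 h0' p0x p0'x [g lg gE]]]] := lin x.
have hp := tB _ tp; have hq := tB' _ tq.
have [k lk kE] := (bundle_chart_trans bB hp h0).1 x px p0x.
have [k' lk' kE'] := (bundle_chart_trans bB' h0' hq).1 x p0'x qx.
have E a : tmap q x (h a) = (k' \o (g \o k)) (tmap p x a) by rewrite kE' gE kE.
exists (k' \o (g \o k)) => //.
have [cp _ bp _] := hp; have [cq _ _ _] := hq.
apply: linear_smooth_bounded => //.
  by apply: is_linear_comp => //; exact: is_linear_comp.
move=> c sc; have [iv ivK Kiv] := bp x px.
apply: smooth_curve_local => // t.
pose gam (s : R) : total_space B := existT B x (iv (c s)).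
have : msm gam t.
  apply/(msm_total bB hp) => //; split; first exact: msm_cst.
  apply: sm_at_near (sm_at_smooth t sc); near=> s; exact/esym/Kiv.
move=> /sm /(msm_total bB' hq) /= /(_ qx) [_].
apply: sm_at_near; near=> s.
transitivity ((k' \o (g \o k)) (tmap p x (iv (c s)))); first exact: E.
by rewrite Kiv.
Unshelve. all: by end_near. Qed.

Lemma morphism_curve : is_morphism B B' (@h) -> forall (g : R -> total_space B) t,
  msm g t -> msm (total_map \o g : R -> total_space B') t.
Proof.
by move=> [sm _]; apply/smooth_mapP => //; [exact: atlased_total|exact: atlased_total].
Qed.

Lemma morphism_linear : is_morphism B B' (@h) -> forall p p' x,
  is_bundle_chart B p -> is_bundle_chart B' p' -> tdom p x -> tdom p' x ->
  exists2 g, is_linear g & forall a, tmap p' x (h a) = g (tmap p x a).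
Proof.
move=> [_ lin] p p' x hp hp' px px'; have [_ tB cB] := bB; have [_ tB' cB'] := bB'.
have [q tq qx] := cB x; have [q' tq' qx'] := cB' x.
have [g [lg _] gE] := lin q q' x tq tq' qx qx'.
have [k lk kE] := (bundle_chart_trans bB hp (tB _ tq)).1 x px qx.
have [k' lk' kE'] := (bundle_chart_trans bB' (tB' _ tq') hp').1 x qx' px'.
exists (k' \o (g \o k)); first by apply: is_linear_comp => //; exact: is_linear_comp.
by move=> a; rewrite kE' gE kE.
Qed.

End Morphisms.

(** * Restriction to a family of subspaces *)

Section Restriction.
Context {R : realType} (X : manifold R) (B : bundle X) (S : forall x, set (B x)).
Hypothesis bB : is_bundle B.
Implicit Types s t : R.

Let aX : atlased X.
Proof. by case: bB => /manifold_atlased. Qed.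

Lemma sm_at_embedding (V W : tvsType R) (j : V -> W) (c : R -> V) t :
  convenient W -> closed_embedding j -> sm_at (j \o c) t -> sm_at c t.
Proof.
move=> cW [_ _ _ Hj] [d sd jd]; have [a sa [aid Pa]] := reparam jd.
exists (fun s => c (a s)); last by near=> s; rewrite (near aid s).
apply: Hj; rewrite (_ : _ \o _ = fun s => d (a s)); first exact: smooth_curve_comp.
by apply/funext => s; exact: Pa.
Unshelve. all: by end_near. Qed.

Definition restr_incl (a : {x & restr_bundle B S x}) : {x & B x} :=
  existT B (projT1 a) (sval (projT2 a)).

Lemma restr_tcoord p (q : triv R (restr_bundle B S)) (j : tmodel q -> tmodel p)
    (g : R -> {x & restr_bundle B S x}) t :
  is_bundle_chart B p -> tdom q = tdom p -> closed_embedding j -> convenient (tmodel q) ->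
  (forall x, tdom p x -> forall a, tmap p x (sval a) = j (tmap q x a)) ->
  msm (fun s => projT1 (g s)) t -> tdom q (projT1 (g t)) ->
  sm_at (tcoord q g) t <-> sm_at (tcoord p (restr_incl \o g)) t.
Proof.
move=> hp qp ej cq pj mg qg; have [cp op _ _] := hp; rewrite qp in qg.
have dg : \forall s \near t, tdom p (projT1 (g s)) by move/(mopenP _ aX): op; apply.
have E : \forall s \near t, tcoord p (restr_incl \o g) s = (j \o tcoord q g) s.
  by near=> s; apply: pj; near: s.
split=> [sq|sp].
  have bj : bounded_linear j by case: ej.
  by apply: sm_at_near (bounded_linear_sm_at cq bj sq); near=> s; rewrite (near E s).
by apply: (sm_at_embedding cp ej); apply: sm_at_near sp.
Unshelve. all: by end_near. Qed.

(** Only the covering has to be supplied. Transition maps are inherited from B: they are linear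
    because the embedding j' is linear and injective, and smooth because embeddings both preserve
    and detect smooth curves. *)
Lemma restr_is_bundle :
  (forall x, exists2 q, trivs (restr_bundle B S) q & tdom q x) ->
  is_bundle (restr_bundle B S).
Proof.
move=> cov; have [mX _ _] := bB; split => // q.
have bij r : trivs (restr_bundle B S) r -> forall x, tdom r x -> bijective (tmap r x).
  move=> [cr [p [j [hp rp [_ ij _ _] H]]]] x rx; rewrite rp in rx.
  have [_ _ bp _] := hp; have [E I] := H x rx.
  apply: injective_surjective_bijective => [a b ab|w].
    apply: sval_inj; apply: (bij_inj (bp x rx)); by rewrite !E ab.
  have : range j (j w) by exists w.
  rewrite -I => -[a Sa aw]; exists (exist _ a Sa).
  by apply: ij; rewrite -E.
have comp r r' : trivs (restr_bundle B S) r -> trivs (restr_bundle B S) r' ->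
    triv_compat r r'.
  move=> tr tr'; have := tr; have := tr'.
  move=> [cr' [p' [j' [hp' rp' ej' H']]]] [cr [p [j [hp rp ej H]]]].
  have [_ op _ _] := hp; have [_ op' _ _] := hp'.
  have [T1 T2] := bundle_chart_trans bB hp hp'.
  apply: triv_compatI => //; [by rewrite rp rp'; exact: mopenI|exact: bij| |].
    move=> x rx rx'; have [iv ivK Kiv] := bij _ tr x rx.
    exists (tmap r' x \o iv); last by move=> a /=; rewrite ivK.
    rewrite rp in rx; rewrite rp' in rx'.
    have [k lk kE] := T1 x rx rx'; have [E _] := H x rx; have [E' _] := H' x rx'.
    have [[lj _] _ _ _] := ej; have [[lj' _] ij' _ _] := ej'.
    move=> a v w; apply: ij'; rewrite lj' /= -!E' !kE !E !Kiv lj; exact: lk.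
  move=> g t mg rg r'g.
  rewrite (restr_tcoord hp rp ej cr _ mg rg); last by move=> x /H[].
  rewrite (restr_tcoord hp' rp' ej' cr' _ mg r'g); last by move=> x /H'[].
  by apply: T2 => //=; [rewrite -rp|rewrite -rp'].
move=> tq; split=> [||x|r tr]; [by case: tq| |exact: bij|by split; exact: comp].
by case: tq => _ [p [j [[_ op _ _] -> _ _]]].
Qed.

Lemma msm_restr (g : R -> total_space (restr_bundle B S)) t :
  is_bundle (restr_bundle B S) ->
  msm g t <-> msm (restr_incl \o g : R -> total_space B) t.
Proof.
move=> bS; have [_ tS cS] := bS; have [q tq qg] := cS (projT1 (g t)).
have := tq; move=> [cq [p [j [hp qp ej H]]]].
have pg : tdom p (projT1 (g t)) by rewrite -qp.
have K : msm (fun s => projT1 (g s)) t ->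
   sm_at (tcoord q g) t <-> sm_at (tcoord p (restr_incl \o g)) t.
  by move=> mg; apply: (restr_tcoord hp qp ej cq) => // x /H[].
have M1 := msm_total bS (tS _ tq) qg.
have M2 := @msm_total _ _ _ bB _ (restr_incl \o g) t hp pg.
split=> [/M1[mg sg]|/M2[mg sg]]; first by apply/M2; split => //; exact/K.
by apply/M1; split => //; exact/K.
Qed.

End Restriction.

(** * Tangent bundles *)

Section Tangent.
Context {R : realType} (X : manifold R).
Hypothesis mX : is_manifold X.
Implicit Types s t : R.

Let aX : atlased X.
Proof. exact: manifold_atlased. Qed.

Definition smooth_fun (F : tvsType R) (W : set X) (f : X -> F) :=
  mopen X W /\ forall (g : R -> X) t, msm g t -> W (g t) -> sm_at (f \o g) t.

Lemma chart_atP (x : X) : atlas X (chart_at x) /\ cdom (chart_at x) x.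
Proof.
rewrite /chart_at; case: pselect => [H|[]]; first exact: (svalP (cid H)).
by have [c ac cx] := aX.2 x; exists c.
Qed.

Lemma is_chart_at (x : X) : is_chart X (chart_at x).
Proof. by apply: aX.1; case: (chart_atP x). Qed.

Lemma smooth_fun_chart c : is_chart X c -> smooth_fun (cdom c) (cmap c).
Proof.
by move=> hc; split; [exact: mopen_cdom|move=> g t mg cg; have [] := msm_csm aX hc mg cg].
Qed.

Lemma chart_rep_smooth (F : tvsType R) c W (f : X -> F) : convenient F ->
  is_chart X c -> smooth_fun W f ->
  cinf_open (cmap c @` (cdom c `&` W)) /\
  smooth_on (cmap c @` (cdom c `&` W)) (chart_rep c f).
Proof.
move=> cF hc [oW sf]; apply/(smooth_in_chartP _ _ (is_chart_good hc) cF) => g t cg Wg.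
have mg := csm_msm aX hc cg; split; last exact: sf.
by move/(mopenP _ aX): oW; apply.
Qed.

Lemma chain_in_chart (F : tvsType R) c W (f : X -> F) (g : R -> X) t v :
  convenient F -> is_chart X c -> smooth_fun W f -> msm g t -> cdom c (g t) -> W (g t) ->
  has_deriv (cmap c \o g) t v ->
  has_deriv (f \o g) t (ddir (chart_rep c f) (cmap c (g t)) v).
Proof.
move=> cF hc sf mg cg Wg dv; have [oO sO] := chart_rep_smooth cF hc sf.
have [dg sg] := msm_csm aX hc mg cg; have gc := is_chart_good hc; have [cc _ _] := gc.
have := chain_rule cc cF oO sO sg _ dv; move=> /(_ (ex_intro2 _ _ (g t) (conj cg Wg) erefl)).
by apply: has_deriv_near; near=> s; rewrite /= chart_repE //; near: s.
Unshelve. all: by end_near. Qed.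

(** Together with [tangent_curve], which realizes every tangent vector by a curve, this reduces
    identities between derivatives to the uniqueness of limits. *)
Lemma tderiv_curve (F : tvsType R) W (f : X -> F) (g : R -> X) t x v :
  convenient F -> smooth_fun W f -> msm g t -> g t = x -> W x ->
  has_deriv (cmap (chart_at x) \o g) t v -> has_deriv (f \o g) t (tderiv f x v).
Proof.
move=> cF sf mg gx; subst x => Wx dv; have [_ cx] := chart_atP (g t).
exact: (chain_in_chart cF (is_chart_at _) sf mg cx Wx dv).
Qed.

Lemma velocity_curve c x v : is_chart X c -> cdom c x ->
  exists g : R -> X, [/\ msm g 0, g 0 = x & has_deriv (cmap c \o g) 0 v].
Proof.
move=> hc cx; have gc := is_chart_good hc; have [cc _ _] := gc.
have [|g [cg gx gu]] := chart_lift gc (sm_at_smooth 0 (smooth_ray (cmap c x) v cc)) cx.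
  by rewrite scale0r addr0.
exists g; split => //; first exact: csm_msm cg.
apply: (@has_deriv_near _ _ (fun r : R => cmap c x + r *: v)).
  by near=> s; rewrite /= (near gu s).
exact: has_deriv_ray.
Unshelve. all: by end_near. Qed.

Lemma tangent_curve (x : X) (v : tangent_space x) :
  exists g : R -> X, [/\ msm g 0, g 0 = x & has_deriv (cmap (chart_at x) \o g) 0 v].
Proof. by apply: velocity_curve; [exact: is_chart_at|case: (chart_atP x)]. Qed.

Lemma tderiv_linear (F : tvsType R) W (f : X -> F) x : convenient F ->
  smooth_fun W f -> W x -> is_linear (tderiv f x).
Proof.
move=> cF sf Wx; have hc := is_chart_at x; have [cc _ _] := is_chart_good hc.
have [oO sO] := chart_rep_smooth cF hc sf; apply: (ddir_linear cc cF oO sO).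
by exists x => //; split => //; case: (chart_atP x).
Qed.

(** Both sides are the velocity of f \o g for a curve g with velocity v. For f a chart map this is
    the change of chart of tangent vectors. *)
Lemma tderiv_factor (F : tvsType R) c W (f : X -> F) x v : convenient F ->
  is_chart X c -> smooth_fun W f -> cdom c x -> W x ->
  tderiv f x v = ddir (chart_rep c f) (cmap c x) (tderiv (cmap c) x v).
Proof.
move=> cF hc sf cx Wx; have [g [mg gx gv]] := tangent_curve v.
have [cc _ _] := is_chart_good hc.
have D1 := tderiv_curve cF sf mg gx Wx gv.
have D2 := tderiv_curve cc (smooth_fun_chart hc) mg gx cx gv.
have := chain_in_chart cF hc sf mg _ _ D2; rewrite gx => /(_ cx Wx) D3.
exact: (has_deriv_unique cF.1 D1 D3).
Qed.

Lemma tderiv_chart_at (x : X) (v : tangent_space x) : tderiv (cmap (chart_at x)) x v = v.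
Proof.
have hc := is_chart_at x; have [cc _ _] := is_chart_good hc.
have [g [mg gx gv]] := tangent_curve v; have [_ cx] := chart_atP x.
exact: (has_deriv_unique cc.1 (tderiv_curve cc (smooth_fun_chart hc) mg gx cx gv) gv).
Qed.

(** By [tderiv_factor] a tangent vector is recovered from its component in c; conversely, a curve
    with prescribed velocity in c also has a velocity in the fixed chart at x. *)
Lemma tderiv_bij (c : chart R X) (x : X) : is_chart X c -> cdom c x -> bijective (tderiv (cmap c) x).
Proof.
move=> hc cx; have [cc _ _] := is_chart_good hc.
have h0 := is_chart_at x; have [c0 _ _] := is_chart_good h0; have [_ c0x] := chart_atP x.
apply: injective_surjective_bijective => [v w vw|v].
  rewrite -(tderiv_chart_at v) -(tderiv_chart_at w).
  by rewrite !(tderiv_factor _ c0 hc (smooth_fun_chart h0) cx c0x) vw.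
have [g [mg gx gv]] := velocity_curve v hc cx.
have [w gw] : exists w, has_deriv (cmap (chart_at x) \o g) 0 w.
  by apply: sm_at_deriv; apply: (smooth_fun_chart h0).2 => //; rewrite gx.
exists w; apply: (has_deriv_unique cc.1 _ gv).
exact: (tderiv_curve cc (smooth_fun_chart hc) mg gx cx gw).
Qed.

Definition tangent_triv c : triv R (tangent X) :=
  @Triv R X (fun x => tangent_space x) (cmodel c) (cdom c) (tderiv (cmap c)).

Lemma tderiv_smooth (F : tvsType R) c W (f : X -> F) (g : R -> total_space (tangent X)) t :
  convenient F -> is_chart X c -> smooth_fun W f ->
  msm (fun s => projT1 (g s)) t -> cdom c (projT1 (g t)) -> W (projT1 (g t)) ->
  sm_at (tcoord (tangent_triv c) g) t ->
  sm_at (fun s => tderiv f (projT1 (g s)) (projT2 (g s))) t.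
Proof.
move=> cF hc sf mg cg Wg sg; have [cc _ _] := is_chart_good hc.
have [oO sO] := chart_rep_smooth cF hc sf.
have [dg sxg] := msm_csm aX hc mg cg.
have dW : \forall s \near t, W (projT1 (g s)).
  by have [oW _] := sf; move/(mopenP _ aX): oW; apply.
have := ddir_smooth cc cF oO sO sxg sg; move=> H.
apply: (@sm_at_near _ _ (fun s => ddir (chart_rep c f) ((cmap c \o (fun s => projT1 (g s))) s)
   (tcoord (tangent_triv c) g s))).
  by near=> s; rewrite -(tderiv_factor _ cF hc sf) //; near: s.
by apply: H; exists (projT1 (g t)).
Unshelve. all: by end_near. Qed.

Lemma tangent_triv_compat c d : is_chart X c -> is_chart X d ->
  triv_compat (tangent_triv c) (tangent_triv d).
Proof.
move=> hc hd; have [cc _ _] := is_chart_good hc; have [cd _ _] := is_chart_good hd.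
apply: triv_compatI => //=.
- by apply: mopenI => //; exact: mopen_cdom.
- by move=> x cx; exact: tderiv_bij.
- move=> x cx dx; exists (ddir (chart_rep c (cmap d)) (cmap c x)).
    have [oO sO] := chart_rep_smooth cd hc (smooth_fun_chart hd).
    by apply: (ddir_linear cc cd oO sO); exists x.
  by move=> a; exact: tderiv_factor (smooth_fun_chart hd) cx dx.
- move=> g t mg cg dg; exact: (tderiv_smooth cd hc (smooth_fun_chart hd) mg cg dg).
Qed.

Lemma is_bundle_chart_tangent c : is_chart X c -> is_bundle_chart (tangent X) (tangent_triv c).
Proof.
move=> hc; have [cc _ _] := is_chart_good hc; split => //=.
- exact: mopen_cdom.
- by move=> x; exact: tderiv_bij.
- by move=> _ [d ad ->]; split; apply: tangent_triv_compat => //; exact: aX.1.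
Qed.

Lemma is_bundle_tangent : is_bundle (tangent X).
Proof.
split => // [_ [c ac ->]|x]; first exact/is_bundle_chart_tangent/aX.1.
by have [c ac cx] := aX.2 x; exists (tangent_triv c) => //; exists c.
Qed.

Lemma msm_tderiv (F : tvsType R) W (f : X -> F) (g : R -> total_space (tangent X)) t :
  convenient F -> smooth_fun W f -> msm g t -> W (projT1 (g t)) ->
  sm_at (fun s => tderiv f (projT1 (g s)) (projT2 (g s))) t.
Proof.
move=> cF sf mg Wg; have [c ac cg] := aX.2 (projT1 (g t)); have hc := aX.1 _ ac.
have [mb sg] := (msm_total is_bundle_tangent (is_bundle_chart_tangent hc) cg).1 mg.
exact: (tderiv_smooth cF hc sf mb cg Wg sg).
Qed.

End Tangent.

(** * Tangent maps *)

Section TangentMap.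
Context {R : realType} (X Y : manifold R) (f : X -> Y).
Hypotheses (mX : is_manifold X) (mY : is_manifold Y).
Hypothesis sf : forall (g : R -> X) (t : R), msm g t -> msm (f \o g) t.

Lemma smooth_fun_comp (F : tvsType R) (W : set Y) (h : Y -> F) :
  smooth_fun W h -> smooth_fun (f @^-1` W) (h \o f).
Proof.
move=> [oW sh]; split=> [|g t mg Wg]; last exact: (sh (f \o g) t (sf mg) Wg).
apply/(mopenP _ (manifold_atlased mX)) => g t mg Wg.
by move/(mopenP _ (manifold_atlased mY)): oW => /(_ _ _ (sf mg)); apply.
Qed.

Lemma tangent_map_comp (F : tvsType R) (W : set Y) (h : Y -> F) x v : convenient F ->
  smooth_fun W h -> W (f x) -> tderiv h (f x) (tangent_map f x v) = tderiv (h \o f) x v.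
Proof.
move=> cF sh Wx; have [g [mg gx gv]] := tangent_curve mX v.
have hc := is_chart_at mY (f x); have [cc _ _] := is_chart_good hc.
have [_ cfx] := chart_atP mY (f x).
have D1 := tderiv_curve mX cF (smooth_fun_comp sh) mg gx Wx gv.
have D2 := tderiv_curve mX cc (smooth_fun_comp (smooth_fun_chart mY hc)) mg gx cfx gv.
have gfx : (f \o g) 0 = f x by rewrite /= gx.
have D3 := tderiv_curve mY cF sh (sf mg) gfx Wx D2.
exact: (has_deriv_unique cF.1 D3 D1).
Qed.

End TangentMap.

(** * Pairs, zero vectors and pull-backs *)

Section Generic.
Context {R : realType}.
Implicit Types (s t : R) (V W : tvsType R).

Lemma tderiv_pair (X : manifold R) (F G : tvsType R) (W : set X) (f : X -> F) (g : X -> G)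
    (x : X) (v : tangent_space x) : is_manifold X -> convenient F -> convenient G ->
  smooth_fun W f -> smooth_fun W g -> W x ->
  tderiv (fun n => (f n, g n) : (F * G)%type) x v = (tderiv f x v, tderiv g x v).
Proof.
move=> mX cF cG sf sg Wx; have [oW _] := sf.
have sfg : smooth_fun W (fun n => (f n, g n) : (F * G)%type).
  by split=> // c t mc Wc; apply/sm_at_pairP; split; [exact: sf.2|exact: sg.2].
have [c [mc cx cv]] := tangent_curve mX v.
have D := tderiv_curve mX (convenient_prod cF cG) sfg mc cx Wx cv.
have D1 := tderiv_curve mX cF sf mc cx Wx cv.
have D2 := tderiv_curve mX cG sg mc cx Wx cv.
rewrite [LHS]surjective_pairing; congr pair.
  apply: (has_deriv_unique cF.1 _ D1).
  apply: (has_deriv_linear (l := fst) _ _ D) => //; exact: cvg_fst.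
apply: (has_deriv_unique cG.1 _ D2).
apply: (has_deriv_linear (l := snd) _ _ D) => //; exact: cvg_snd.
Qed.

(** In adapted charts the kernel of [p_A_tilde] and the vertical bundle are both the second factor.
    Its complement is the preimage of the nonzero vectors under the first projection, open along
    curves because V is Hausdorff. *)
Lemma closed_embedding_snd V W : convenient V -> convenient W ->
  closed_embedding (fun z : W => (0, z) : (V * W)%type).
Proof.
move=> cV cW; split.
- apply: linear_smooth_bounded => // [r x y|c sc].
    transitivity ((r *: 0 + 0, r *: x + y) : (V * W)%type) => //.
    by rewrite scaler0 addr0.
  by apply: smooth_curve_pair => //; exact: smooth_curve_cst.
- by move=> x y [].
- move=> c sc.
  have -> : c @^-1` (~` range (fun z : W => (0, z) : (V * W)%type)) =
      (fun t => (c t).1) @^-1` (~` [set 0]).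
    rewrite eqEsubset; split=> t /= H e; apply: H.
      by exists (c t).2 => //; rewrite -[in LHS]e -surjective_pairing.
    by case: e => z _ <-.
  apply: open_comp; first by move=> x _; exact: (smooth_curve_cont (smooth_curve_fst sc)).
  apply: closed_openC; exact: (accessible_closed_set1 (hausdorff_accessible cV.1)).
- by move=> c /smooth_curve_snd.
Qed.

Section Zero.
Context (X : manifold R) (B : bundle X).
Hypothesis bB : is_bundle B.

Lemma is_zeroP p x a : is_bundle_chart B p -> tdom p x ->
  is_zero B x a <-> tmap p x a = 0.
Proof.
move=> hp px; have [_ tB cB] := bB; split=> [[q [tq qx q0]]|p0].
  have [h lh hE] := (bundle_chart_trans bB (tB _ tq) hp).1 x qx px.
  by rewrite hE q0 is_linear0.
have [q tq qx] := cB x; exists q; split=> //.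
have [h lh hE] := (bundle_chart_trans bB hp (tB _ tq)).1 x px qx.
by rewrite hE p0 is_linear0.
Qed.

Lemma zero_exists x : exists a, is_zero B x a.
Proof.
have [p hp px] := bundle_chart_at bB x; have [_ _ bp _] := hp.
by have [iv _ Kiv] := bp x px; exists (iv 0); apply/(is_zeroP _ hp px); rewrite Kiv.
Qed.

Lemma is_zero_unique x a b : is_zero B x a -> is_zero B x b -> a = b.
Proof.
have [p hp px] := bundle_chart_at bB x; have [_ _ bp _] := hp.
move=> /(is_zeroP _ hp px) a0 /(is_zeroP _ hp px) b0.
by apply: (bij_inj (bp x px)); rewrite a0.
Qed.

End Zero.

Section Pullback.
Context (X Y : manifold R) (f : X -> Y) (B : bundle Y).
Hypotheses (mX : is_manifold X) (bB : is_bundle B).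
Hypothesis sf : forall (g : R -> X) t, msm g t -> msm (f \o g) t.

Definition pull_triv (p : triv R B) : triv R (pullback f B) :=
  @Triv R X (fun x => B (f x)) (tmodel p) (f @^-1` tdom p) (fun x => tmap p (f x)).

Definition pull_map (a : {x & pullback f B x}) : {y & B y} := existT B (f (projT1 a)) (projT2 a).

Lemma mopen_preimage (W : set Y) : mopen Y W -> mopen X (f @^-1` W).
Proof.
have [mY _ _] := bB; move=> /(mopenP _ (manifold_atlased mY)) oW.
by apply/(mopenP _ (manifold_atlased mX)) => g t /sf mg; exact: oW mg.
Qed.

Lemma is_bundle_chart_pull p : is_bundle_chart B p -> is_bundle_chart (pullback f B) (pull_triv p).
Proof.
move=> hp; have [cp op bp _] := hp; have [_ tB _] := bB.
have comp q q' : is_bundle_chart B q -> is_bundle_chart B q' ->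
    triv_compat (pull_triv q) (pull_triv q').
  move=> hq hq'; have [cq oq bq _] := hq; have [cq' oq' bq' _] := hq'.
  have [L S] := bundle_chart_trans bB hq hq'.
  apply: triv_compatI => //=; first exact: manifold_atlased.
  - by apply: mopenI; [exact: manifold_atlased|exact: mopen_preimage|exact: mopen_preimage].
  - by move=> x; exact: bq.
  - by move=> x; exact: L.
  - by move=> g t mg qg qg' sg; apply: (S (pull_map \o g)) => //; exact: sf.
split => //=; first exact: mopen_preimage.
  by move=> x; exact: bp.
by move=> _ [q tq ->]; split; apply: comp => //; exact: tB.
Qed.

Lemma is_bundle_pullback : is_bundle (pullback f B).
Proof.
have [_ tB cB] := bB; split => // [_ [p tp ->]|x].
  exact/is_bundle_chart_pull/tB.
by have [p tp px] := cB (f x); exists (pull_triv p) => //; exists p.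
Qed.

Lemma msm_pullback (g : R -> total_space (pullback f B)) t :
  msm g t <-> msm (fun s => projT1 (g s)) t /\ msm (pull_map \o g : R -> total_space B) t.
Proof.
have [p hp pg] := bundle_chart_at bB (f (projT1 (g t))).
have M1 := @msm_total _ _ _ is_bundle_pullback _ g t (is_bundle_chart_pull hp) pg.
have M2 := @msm_total _ _ _ bB _ (pull_map \o g) t hp pg.
split=> [/M1[mg sg]|[mg /M2[_ sg]]]; last by apply/M1.
by split=> //; apply/M2; split => //; exact: sf mg.
Qed.

End Pullback.
End Generic.

(** * The prolongation *)

Section Prolongation.
Context {R : realType} (M : manifold R) (A E : bundle M).
Variables (rho : forall x : M, A x -> tangent M x) (N : set (total_space E)).
Hypotheses (hA : is_anchored A rho) (hE : is_bundle E) (hN : mopen (total_space E) N).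
Implicit Types (s t : R) (p : triv R A) (q : triv R E).

Let bA : is_bundle A. Proof. by case: hA. Qed.
Let mM : is_manifold M. Proof. by case: bA. Qed.
Let aM : atlased M. Proof. exact: manifold_atlased. Qed.
Let X := sub_manifold N.
Let aE : atlased (total_space E). Proof. exact: atlased_total. Qed.

Lemma is_manifold_domain : is_manifold X.
Proof. by apply: is_manifold_sub => //; exact: is_manifold_total. Qed.

Let mX := is_manifold_domain.
Let aX : atlased X. Proof. exact: manifold_atlased. Qed.
Let bTM : is_bundle (tangent M). Proof. exact: is_bundle_tangent. Qed.
Let bTX : is_bundle (tangent X). Proof. exact: is_bundle_tangent. Qed.

Lemma base_smooth (g : R -> X) t : msm g t -> msm (base N \o g) t.
Proof. by move=> /msm_sub /msm_base. Qed.

Definition fibre_coord q (n : X) : tmodel q := tmap q (base N n) (projT2 (sval n)).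

Definition domain_chart c q : chart R X := sub_chart N (@total_chart R M E c q).

Lemma is_chart_domain c q : is_chart M c -> is_bundle_chart E q ->
  is_chart X (domain_chart c q).
Proof. by move=> hc hq; apply: is_chart_sub => //; exact: is_chart_total. Qed.

Lemma mopen_base (W : set M) : mopen M W -> mopen X (base N @^-1` W).
Proof. exact: (mopen_preimage mX bA base_smooth). Qed.

Lemma fibre_coord_smooth q : is_bundle_chart E q ->
  smooth_fun (base N @^-1` tdom q) (fibre_coord q).
Proof.
move=> hq; have [_ oq _ _] := hq; split; first exact: mopen_base.
move=> g t /msm_sub mg qg.
by have [_ ] := (msm_total hE hq (g := fun s => sval (g s)) qg).1 mg.
Qed.

Lemma base_chart_smooth c : is_chart M c ->
  smooth_fun (base N @^-1` cdom c) (cmap c \o base N).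
Proof. by move=> hc; apply: (smooth_fun_comp mX mM base_smooth); exact: smooth_fun_chart. Qed.

Lemma smooth_funS (F : tvsType R) (W W' : set X) (f : X -> F) :
  mopen X W' -> W' `<=` W -> smooth_fun W f -> smooth_fun W' f.
Proof. by move=> oW' W'W [_ sf]; split => // g t mg /W'W; exact: sf. Qed.

(** For every mu the first component is Tp(mu) read in c; the anchor condition makes it rho(a), and
    for vertical mu it is 0. *)
Lemma tderiv_domain c q (m : X) (mu : tangent X m) : is_chart M c ->
  is_bundle_chart E q -> cdom c (base N m) -> tdom q (base N m) ->
  tderiv (cmap (domain_chart c q)) m mu =
  (tderiv (cmap c) (base N m) (tangent_map (base N) m mu), tderiv (fibre_coord q) m mu).
Proof.
move=> hc hq cm qm; have [cc _ _] := is_chart_good hc; have [cq oq _ _] := hq.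
rewrite (tangent_map_comp mX mM base_smooth mu cc (smooth_fun_chart mM hc) cm).
have oW : mopen X (base N @^-1` (cdom c `&` tdom q)).
  by apply: mopen_base; apply: mopenI => //; exact: mopen_cdom.
apply: (@tderiv_pair _ X _ _ (base N @^-1` (cdom c `&` tdom q)) (cmap c \o base N)
          (fibre_coord q)) => //.
- by apply: smooth_funS (base_chart_smooth hc) => // x [].
- by apply: smooth_funS (fibre_coord_smooth hq) => // x [].
Qed.

Lemma chart_base (m : X) : exists2 c, is_chart M c & cdom c (base N m).
Proof. by have [c ac cm] := aM.2 (base N m); exists c => //; exact: aM.1. Qed.

Lemma anchor_linear c p x : is_chart M c -> is_bundle_chart A p -> cdom c x -> tdom p x ->
  exists2 r, is_linear r & forall a, tderiv (cmap c) x (rho a) = r (tmap p x a).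
Proof.
move=> hc hp cx px.
exact: (morphism_linear bA bTM hA.2 hp (is_bundle_chart_tangent mM hc) px cx).
Qed.

Lemma prol_eq (m : X) (u v : prolongation rho N m) :
  (sval u).1 = (sval v).1 -> (sval u).2 = (sval v).2 -> u = v.
Proof.
move=> e1 e2; apply: sval_inj.
by rewrite [LHS]surjective_pairing [RHS]surjective_pairing e1 e2.
Qed.

(** Injectivity: a determines Tp(mu) by the anchor condition, and z the rest of mu. Surjectivity: mu
    is defined by the components (rho(a), z), and the equality of rho(a) and Tp(mu) is then read off
    in c. *)
Lemma prol_bij p q (m : X) : is_bundle_chart A p -> is_bundle_chart E q ->
  tdom p (base N m) -> tdom q (base N m) -> bijective (tmap (prol_triv rho N p q) m).
Proof.
move=> hp hq pm qm; have [_ _ bp _] := hp; have [c hc cm] := chart_base m.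
have hC := is_chart_domain hc hq.
have bC := tderiv_bij mX hC (conj cm qm); have bc := tderiv_bij mM hc cm.
apply: injective_surjective_bijective => [u v [] e1 e2|[al z]].
  have e1' : (sval u).1 = (sval v).1 by exact: (bij_inj (bp _ pm) e1).
  apply: prol_eq => //; apply: (bij_inj bC); rewrite !tderiv_domain //.
  have e3 : tangent_map (base N) m (sval u).2 = tangent_map (base N) m (sval v).2.
    by have := svalP u; have := svalP v; rewrite e1' => <- <-.
  rewrite e3; congr pair; exact: e2.
have [iv _ Kiv] := bp _ pm; have [jv _ Kjv] := bC; have [a al_a] : exists a, tmap p (base N m) a = al.
  by exists (iv al).
pose mu := jv (tderiv (cmap c) (base N m) (rho a), z).
have Emu := Kjv (tderiv (cmap c) (base N m) (rho a), z).
rewrite -/mu tderiv_domain // in Emu; case: Emu => E1 E2.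
have com : rho a = tangent_map (base N) m mu by apply: (bij_inj bc); rewrite E1.
by exists (exist _ (a, mu) com); rewrite /= al_a -E2.
Qed.

Definition anchored_part (a : {m & prolongation rho N m}) : {x & A x} :=
  existT A (base N (projT1 a)) (sval (projT2 a)).1.

Definition tangent_part (a : {m & prolongation rho N m}) : {m & tangent X m} :=
  existT (tangent X) (projT1 a) (sval (projT2 a)).2.

(** The right-hand side does not involve p and q, so two uses of the equivalence give the smoothness
    of transition maps. Since this precedes the bundle property, the left-hand side spells out base
    and fibre coordinates instead of using [msm] on the total space. *)
Lemma prol_curve p q (g : R -> {m & prolongation rho N m}) t :
  is_bundle_chart A p -> is_bundle_chart E q ->
  tdom p (base N (projT1 (g t))) -> tdom q (base N (projT1 (g t))) ->
  msm (fun s => projT1 (g s)) t /\ sm_at (tcoord (prol_triv rho N p q) g) t <->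
  msm (anchored_part \o g : R -> total_space A) t /\
  msm (tangent_part \o g : R -> total_space (tangent X)) t.
Proof.
move=> hp hq pg qg; have [cp op _ _] := hp; have [cq oq _ _] := hq.
have MA := @msm_total _ _ _ bA _ (anchored_part \o g) t hp pg.
split=> [[mg /sm_at_pairP[s1 s2]]|[/MA[mb sa] mT]].
  have mgA : msm (anchored_part \o g : R -> total_space A) t.
    by apply/MA; split=> //; exact: base_smooth mg.
  split => //; have [c hc cg] := chart_base (projT1 (g t)).
  have hC := is_chart_domain hc hq; have [cc _ _] := is_chart_good hc.
  apply/(@msm_total _ _ _ bTX _ (tangent_part \o g) t (is_bundle_chart_tangent mX hC)
     (conj cg qg)); split => //.
  have mrho := morphism_curve bA bTM hA.2 mgA.
  have := msm_tderiv mM cc (smooth_fun_chart mM hc) mrho cg => s3.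
  have := proj2 (sm_at_pairP _ _ _) (conj s3 s2); apply: sm_at_near.
  have W : \forall s \near t, (base N @^-1` (cdom c `&` tdom q)) (projT1 (g s)).
    have oW : mopen X (base N @^-1` (cdom c `&` tdom q)).
      by apply: mopen_base; apply: mopenI => //; exact: mopen_cdom.
    by move/(mopenP _ aX): oW; apply.
  near=> s; have [cgs qgs] : (base N @^-1` (cdom c `&` tdom q)) (projT1 (g s)) by near: s.
  rewrite /tcoord /= tderiv_domain //; congr (_, _).
  by congr (tderiv _ _ _); exact: (svalP (projT2 (g s))).
have mg := msm_base mT; split => //; apply/sm_at_pairP; split => //.
exact: (msm_tderiv mX cq (fibre_coord_smooth hq) mT qg).
Unshelve. all: by end_near. Qed.

Lemma prol_compat p q p' q' : is_bundle_chart A p -> is_bundle_chart E q ->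
  is_bundle_chart A p' -> is_bundle_chart E q' ->
  triv_compat (prol_triv rho N p q) (prol_triv rho N p' q').
Proof.
move=> hp hq hp' hq'; have [cp op _ _] := hp; have [cq oq _ _] := hq.
have [cp' op' _ _] := hp'; have [cq' oq' _ _] := hq'.
have oD (r : triv R A) (r' : triv R E) : mopen M (tdom r) -> mopen M (tdom r') ->
    mopen X [set m : X | tdom r (base N m) /\ tdom r' (base N m)].
  by move=> o1 o2; exact: (mopen_base (mopenI aM o1 o2)).
apply: triv_compatI => //=.
- by apply: mopenI => //; exact: oD.
- exact: convenient_prod.
- exact: convenient_prod.
- by move=> m [pm qm]; exact: prol_bij.
- move=> m [pm qm] [pm' qm']; have [c hc cm] := chart_base m.
  have hC := is_chart_domain hc hq; have [cC _ _] := is_chart_good hC.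
  have [r lr rE] := anchor_linear hc hp cm pm.
  have [k lk kE] := (bundle_chart_trans bA hp hp').1 _ pm pm'.
  pose d := ddir (chart_rep (domain_chart c q) (fibre_coord q')) (cmap (domain_chart c q) m).
  have ld : is_linear d.
    have [oO sO] := chart_rep_smooth mX cq' hC (fibre_coord_smooth hq').
    by apply: (ddir_linear cC cq' oO sO); exists m.
  (* The transition is triangular: the new a depends on a alone, the new z on z and, through the
     anchor, on a. *)
  exists (fun az => (k az.1, d (r az.1, az.2))) => [b [a z] [a' z']|u].
    transitivity ((b *: k a + k a', d (b *: (r a, z) + (r a', z'))) : (tmodel p' * tmodel q')%type).
      by rewrite -lk; congr (_, d _); rewrite /= lr.
    by rewrite ld.
  congr (_, _); first exact: kE.
  rewrite (tderiv_factor mX _ cq' hC (fibre_coord_smooth hq')) //.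
  have e : tderiv (cmap c) (base N m) (tangent_map (base N) m (sval u).2) =
      r (tmap p (base N m) (sval u).1) by have := svalP u => /= <-; exact: rE.
  rewrite (tderiv_domain _ hc hq cm qm) e; exact: erefl.
- move=> g t mg [pg qg] [pg' qg'] sg.
  by have [] := (prol_curve hp' hq' pg' qg').2 ((prol_curve hp hq pg qg).1 (conj mg sg)).
Qed.

Lemma is_bundle_chart_prol p q : is_bundle_chart A p -> is_bundle_chart E q ->
  is_bundle_chart (prolongation rho N) (prol_triv rho N p q).
Proof.
move=> hp hq; have [cp op _ _] := hp; have [cq oq _ _] := hq; split => //=.
- exact: convenient_prod.
- exact: (mopen_base (mopenI aM op oq)).
- by move=> m [pm qm]; exact: prol_bij.
- have [_ tA _] := bA; have [_ tE _] := hE.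
  by move=> _ [p' [q' [tp' tq' ->]]]; split; apply: prol_compat => //; [exact: tA|exact: tE|exact: tA|exact: tE].
Qed.

Lemma is_bundle_prol : is_bundle (prolongation rho N).
Proof.
have [_ tA cA] := bA; have [_ tE cE] := hE; split => // [_ [p [q [tp tq ->]]]|m].
  by apply: is_bundle_chart_prol; [exact: tA|exact: tE].
have [p tp pm] := cA (base N m); have [q tq qm] := cE (base N m).
by exists (prol_triv rho N p q) => //; exists p, q.
Qed.

Lemma prol_charts (m : X) : exists p q, [/\ is_bundle_chart A p, is_bundle_chart E q,
  tdom p (base N m) & tdom q (base N m)].
Proof.
have [p hp pm] := bundle_chart_at bA (base N m).
by have [q hq qm] := bundle_chart_at hE (base N m); exists p, q.
Qed.

Lemma msm_prol (g : R -> total_space (prolongation rho N)) t :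
  msm g t <-> msm (anchored_part \o g : R -> total_space A) t /\
  msm (tangent_part \o g : R -> total_space (tangent X)) t.
Proof.
have [p [q [hp hq pg qg]]] := prol_charts (projT1 (g t)).
rewrite -(prol_curve hp hq pg qg).
exact: (msm_total is_bundle_prol (is_bundle_chart_prol hp hq) (conj pg qg)).
Qed.

Lemma typical_fiber_prol (AA EE : tvsType R) : typical_fiber A AA -> typical_fiber E EE ->
  typical_fiber (prolongation rho N) (AA * EE)%type.
Proof.
move=> [cA fA] [cE fE]; split=> [|m]; first exact: convenient_prod.
have [U [a [Um ha]]] := fA (base N m); have [V [e [Vm he]]] := fE (base N m).
have := is_bundle_chart_prol ha he.
by move=> H; exists [set m : X | U (base N m) /\ V (base N m)], (tmap (prol_triv rho N (Triv U a) (Triv V e))).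
Qed.

Lemma rho_hat_morphism : is_morphism (prolongation rho N) (tangent X) (rho_hat rho N).
Proof.
apply: (is_morphismI is_bundle_prol bTX) => [m|g t /msm_prol[_ mT] //].
have [p [q [hp hq pm qm]]] := prol_charts m; have [c hc cm] := chart_base m.
exists (prol_triv rho N p q), (tangent_triv (domain_chart c q)); split => //.
- exact: is_bundle_chart_prol.
- exact/(is_bundle_chart_tangent mX)/is_chart_domain.
have [r lr rE] := anchor_linear hc hp cm pm.
exists (fun az => (r az.1, az.2)) => [b [a z] [a' z']|u].
  by transitivity ((r (b *: a + a'), b *: z + z') : (cmodel c * tmodel q)%type) => //; rewrite lr.
by rewrite [LHS]tderiv_domain // /rho_hat -(svalP u) rE.
Qed.

Lemma is_bundle_A_tilde : is_bundle (A_tilde A N).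
Proof. exact: (is_bundle_pullback mX bA base_smooth). Qed.

Lemma p_A_tilde_morphism :
  is_morphism (prolongation rho N) (A_tilde A N) (p_A_tilde rho N).
Proof.
apply: (is_morphismI is_bundle_prol is_bundle_A_tilde) => [m|g t].
  have [p [q [hp hq pm qm]]] := prol_charts m.
  exists (prol_triv rho N p q), (pull_triv (base N) p); split => //.
  - exact: is_bundle_chart_prol.
  - exact: (is_bundle_chart_pull mX bA base_smooth).
  by exists fst.
move=> /msm_prol[mA mT]; apply/(msm_pullback mX bA base_smooth); split => //.
exact: msm_base mT.
Qed.

Lemma p_A_tilde_surjective (m : X) (b : A_tilde A N m) :
  exists u : prolongation rho N m, p_A_tilde rho N m u = b.
Proof.
have [p [q [hp hq pm qm]]] := prol_charts m; have [_ _ bp _] := hp.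
have [iv _ Kiv] := prol_bij hp hq pm qm.
(* Any value of z gives a preimage; 0 is the choice made here. *)
exists (iv (tmap p (base N m) b, 0)); apply: (bij_inj (bp _ pm)).
by have := Kiv (tmap p (base N m) b, 0) => -[].
Qed.

End Prolongation.

(** * The kernel and the vertical bundle *)

Section KernelAndSections.
Context {R : realType} (M : manifold R) (A E : bundle M).
Variables (rho : forall x : M, A x -> tangent M x) (N : set (total_space E)).
Hypotheses (hA : is_anchored A rho) (hE : is_bundle E) (hN : mopen (total_space E) N).
Implicit Types (s t : R) (p : triv R A) (q : triv R E).

Let bA : is_bundle A. Proof. by case: hA. Qed.
Let mM : is_manifold M. Proof. by case: bA. Qed.
Let X := sub_manifold N.
Let mX : is_manifold X := is_manifold_domain hE hN.
Let aX : atlased X. Proof. exact: manifold_atlased. Qed.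
Let bTX : is_bundle (tangent X). Proof. exact: is_bundle_tangent. Qed.
Let bP : is_bundle (prolongation rho N) := is_bundle_prol hA hE hN.
Let K := ker_p_A_tilde rho N.
Let V := vertical N.

Lemma is_zero_A_tilde p (m : X) (a : A_tilde A N m) : is_bundle_chart A p ->
  tdom p (base N m) -> is_zero (A_tilde A N) m a <-> tmap p (base N m) a = 0.
Proof.
move=> hp pm; have bs := @base_smooth R M E N.
exact: (is_zeroP (is_bundle_A_tilde hA hE hN) a (is_bundle_chart_pull mX bA bs hp) pm).
Qed.

Lemma rho_zero x (a : A x) : is_zero A x a -> rho a = 0.
Proof.
have [p hp px] := bundle_chart_at bA x; move=> /(is_zeroP bA _ hp px) a0.
have [c ac cx] := (manifold_atlased mM).2 x; have hc := (manifold_atlased mM).1 _ ac.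
have [r lr rE] := anchor_linear hA hc hp cx px; have [cc _ _] := is_chart_good hc.
apply: (bij_inj (tderiv_bij mM hc cx)).
by rewrite rE a0 is_linear0 // (is_linear0 (tderiv_linear mM cc (smooth_fun_chart mM hc) cx)).
Qed.

Lemma ker_zero (m : X) (u : prolongation rho N m) : K u -> is_zero A (base N m) (sval u).1.
Proof.
have [p hp pm] := bundle_chart_at bA (base N m).
by move=> /(is_zero_A_tilde _ hp pm) u0; apply/(is_zeroP bA _ hp pm).
Qed.

Lemma zero_ker (m : X) (u : prolongation rho N m) : is_zero A (base N m) (sval u).1 -> K u.
Proof.
have [p hp pm] := bundle_chart_at bA (base N m).
by move=> /(is_zeroP bA _ hp pm) u0; apply/(is_zero_A_tilde _ hp pm).
Qed.

Definition ker_triv p q : triv R (restr_bundle (prolongation rho N) K) :=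
  @Triv R X (fun m => {u : prolongation rho N m | K u}) (tmodel q)
    (tdom (prol_triv rho N p q))
    (fun m u => tderiv (fibre_coord (N := N) q) m (sval (sval u)).2).

Lemma ker_trivP p q : is_bundle_chart A p -> is_bundle_chart E q ->
  trivs (restr_bundle (prolongation rho N) K) (ker_triv p q).
Proof.
move=> hp hq; have [cp _ _ _] := hp; have [cq _ _ _] := hq; split => //.
exists (prol_triv rho N p q), (fun z => (0, z)); split => //.
- exact: is_bundle_chart_prol.
- exact: closed_embedding_snd.
move=> m [pm qm]; have E1 (u : prolongation rho N m) : K u ->
    tmap (prol_triv rho N p q) m u = (0, tderiv (fibre_coord (N := N) q) m (sval u).2).
  by move=> /(is_zero_A_tilde _ hp pm) u0; congr (_, _).
split=> [u|]; first by rewrite E1 //; exact: svalP.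
rewrite eqEsubset; split=> [_ [u Ku <-]|_ [z _ <-]].
  by rewrite E1 //; exists (tderiv (fibre_coord (N := N) q) m (sval u).2).
have [iv _ Kiv] := prol_bij hA hE hN hp hq pm qm.
have Ez := Kiv (0, z); exists (iv (0, z)) => //.
by apply/(is_zero_A_tilde _ hp pm); case: Ez.
Qed.

Lemma is_subbundle_ker : is_subbundle (prolongation rho N) K.
Proof.
apply: restr_is_bundle => // m.
have [p [q [hp hq pm qm]]] := prol_charts hA hE m.
by exists (ker_triv p q) => //; exact: ker_trivP.
Qed.

(** The fibre coordinate z is that of [ker_triv], so the isomorphism between the kernel and the
    vertical bundle is the identity in coordinates. *)
Definition vertical_triv c q : triv R (restr_bundle (tangent X) V) :=
  @Triv R X (fun m => {mu : tangent X m | V mu}) (tmodel q)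
    (cdom (domain_chart N c q)) (fun m mu => tderiv (fibre_coord (N := N) q) m (sval mu)).

Lemma vertical_trivP c q : is_chart M c -> is_bundle_chart E q ->
  trivs (restr_bundle (tangent X) V) (vertical_triv c q).
Proof.
move=> hc hq; have [cc _ _] := is_chart_good hc; have [cq _ _ _] := hq; split => //.
have hC := is_chart_domain hE hN hc hq.
exists (tangent_triv (domain_chart N c q)), (fun z => (0, z)); split => //.
- exact: (is_bundle_chart_tangent mX).
- exact: closed_embedding_snd.
move=> m [cm qm].
have c0 := is_linear0 (tderiv_linear mM cc (smooth_fun_chart mM hc) cm).
have E1 (mu : tangent X m) : V mu -> tmap (tangent_triv (domain_chart N c q)) m mu =
    (0, tderiv (fibre_coord (N := N) q) m mu).
  move=> mu0; rewrite [LHS](tderiv_domain hA hE hN mu hc hq cm qm).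
  by congr (_, _); rewrite -c0; congr (tderiv _ _ _).
split=> [mu|]; first by rewrite E1 //; exact: svalP.
rewrite eqEsubset; split=> [_ [mu Vmu <-]|_ [z _ <-]].
  by rewrite E1 //; exists (tderiv (fibre_coord (N := N) q) m mu).
have [iv _ Kiv] := tderiv_bij mX hC (conj cm qm).
have Ez := Kiv (0, z); exists (iv (0, z)) => //.
rewrite (tderiv_domain hA hE hN _ hc hq cm qm) in Ez; case: Ez => E0 _.
by apply: (bij_inj (tderiv_bij mM hc cm)); rewrite E0 c0.
Qed.

Lemma is_subbundle_vertical : is_subbundle (tangent X) V.
Proof.
apply: restr_is_bundle => // m; have [c hc cm] := chart_base hA m.
have [q hq qm] := bundle_chart_at hE (base N m).
by exists (vertical_triv c q) => //; exact: vertical_trivP.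
Qed.

Let bK : is_bundle (restr_bundle (prolongation rho N) K) := is_subbundle_ker.
Let bV : is_bundle (restr_bundle (tangent X) V) := is_subbundle_vertical.

Lemma ker_vertical (m : X) (u : restr_bundle (prolongation rho N) K m) :
  V (rho_hat rho N m (sval u)).
Proof.
by rewrite /V /vertical /= /rho_hat -(svalP (sval u)); exact/rho_zero/ker_zero/(svalP u).
Qed.

Definition ker_to_vertical (m : X) (u : restr_bundle (prolongation rho N) K m) :
  restr_bundle (tangent X) V m := exist _ (rho_hat rho N m (sval u)) (ker_vertical u).

(** Fibres are bare types without a distinguished zero; the zero vector is chosen from its
    description in bundle charts, which determines it. *)
Definition zero_of (m : X) : A (base N m) := sval (cid (zero_exists bA (base N m))).

Lemma zero_ofP (m : X) : is_zero A (base N m) (zero_of m).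
Proof. exact: svalP (cid (zero_exists bA (base N m))). Qed.

Lemma vertical_anchored (m : X) (mu : restr_bundle (tangent X) V m) :
  rho (zero_of m) = tangent_map (base N) m (sval mu).
Proof. by rewrite rho_zero ?(svalP mu) //; exact: zero_ofP. Qed.

Definition vertical_lift (m : X) (mu : restr_bundle (tangent X) V m) : prolongation rho N m :=
  exist (fun am : A (base N m) * tangent X m => rho am.1 = tangent_map (base N) m am.2)
    (zero_of m, sval mu) (vertical_anchored mu).

Lemma vertical_lift_ker (m : X) (mu : restr_bundle (tangent X) V m) : K (vertical_lift mu).
Proof. by apply: zero_ker; exact: zero_ofP. Qed.

Definition vertical_to_ker (m : X) (mu : restr_bundle (tangent X) V m) :
  restr_bundle (prolongation rho N) K m := exist _ (vertical_lift mu) (vertical_lift_ker mu).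

Lemma restr_charts (m : X) : exists c p q, [/\ is_chart M c, is_bundle_chart E q,
  is_bundle_chart (restr_bundle (prolongation rho N) K) (ker_triv p q),
  is_bundle_chart (restr_bundle (tangent X) V) (vertical_triv c q) &
  tdom (ker_triv p q) m /\ tdom (vertical_triv c q) m].
Proof.
have [p [q [hp hq pm qm]]] := prol_charts hA hE m; have [c hc cm] := chart_base hA m.
have [_ tK _] := bK; have [_ tV _] := bV; exists c, p, q; split => //.
- exact/tK/ker_trivP.
- exact/tV/vertical_trivP.
Qed.

Lemma ker_to_vertical_morphism : is_morphism (restr_bundle (prolongation rho N) K)
  (restr_bundle (tangent X) V) ker_to_vertical.
Proof.
apply: (is_morphismI bK bV) => [m|g t].
  have [c [p [q [hc hq h1 h2 [d1 d2]]]]] := restr_charts m.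
  by exists (ker_triv p q), (vertical_triv c q); split => //; exists id.
move=> /(msm_restr bP _ _ bK) /(msm_prol hA hE hN)[_ mT].
by apply/(msm_restr bTX _ _ bV).
Qed.

Lemma vertical_to_ker_morphism : is_morphism (restr_bundle (tangent X) V)
  (restr_bundle (prolongation rho N) K) vertical_to_ker.
Proof.
apply: (is_morphismI bV bK) => [m|g t].
  have [c [p [q [hc hq h1 h2 [d1 d2]]]]] := restr_charts m.
  by exists (vertical_triv c q), (ker_triv p q); split => //; exists id.
move=> /(msm_restr bTX _ _ bV) mT; apply/(msm_restr bP _ _ bK)/(msm_prol hA hE hN); split => //.
have mb : msm (fun s => base N (projT1 (g s))) t.
  by apply: (base_smooth (g := fun s => projT1 (g s))); exact: msm_base mT.
have [p hp pg] := bundle_chart_at bA (base N (projT1 (g t))).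
refine ((msm_total bA hp _).2 _); first exact: pg.
split => //.
(* The zero section has constant fibre coordinate 0 in the bundle chart p, whatever the base
   curve. *)
apply: (@sm_at_near _ _ (fun=> 0)); last exact/sm_at_smooth/smooth_curve_cst.
have [_ op _ _] := hp.
have dg : \forall s \near t, tdom p (base N (projT1 (g s))).
  by move/(mopenP _ (manifold_atlased mM)): op; apply.
near=> s; symmetry; have pgs : tdom p (base N (projT1 (g s))) by near: s.
exact: ((is_zeroP bA (zero_of (projT1 (g s))) hp pgs).1 (zero_ofP _)).
Unshelve. all: by end_near. Qed.

Lemma ker_vertical_isomorphism : is_isomorphism (restr_bundle (prolongation rho N) K)
  (restr_bundle (tangent X) V) ker_to_vertical.
Proof.
split; first exact: ker_to_vertical_morphism.
exists vertical_to_ker; split => [|m u|m mu]; first exact: vertical_to_ker_morphism.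
  apply/sval_inj/prol_eq => //=.
  by apply: (is_zero_unique bA (zero_ofP m)); exact/ker_zero/(svalP u).
exact: sval_inj.
Qed.

(** * Sections of the prolongation *)

Section Sections.
Variable W : set M.
Hypothesis oW : mopen M W.

Let VV : set X := [set m | W (base N m)].
Let aVV : atlased (sub_manifold VV).
Proof. by apply: atlased_sub => //; exact: (mopen_base hA hE hN). Qed.

Lemma section_curve (B : bundle X) (u : forall m : sub_manifold VV, B (sval m)) :
  is_bundle B -> is_section B VV u <-> forall (g : R -> sub_manifold VV) t, msm g t ->
    msm ((fun m => existT B (sval m) (u m)) \o g : R -> total_space B) t.
Proof. by move=> bB; apply: smooth_mapP => //; exact: atlased_total. Qed.

(** Along a curve of points m, [msm_prol] splits the smoothness of (m, a, mu) into that of (p(m), a)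
    in A and of (m, mu) in the tangent bundle; [msm_pullback] trades the former for (m, a) in the
    pull-back. *)
Lemma section_pair (u : forall m : sub_manifold VV, prolongation rho N (sval m)) :
  is_section (prolongation rho N) VV u <->
  is_section (A_tilde A N) VV (fun m => p_A_tilde rho N (sval m) (u m)) /\
  is_section (tangent X) VV (fun m => rho_hat rho N (sval m) (u m)).
Proof.
have bs := @base_smooth R M E N.
rewrite !section_curve //; last exact: (is_bundle_A_tilde hA hE hN).
split=> [H|[H1 H2] g t mg].
  split=> g t mg; have /(msm_prol hA hE hN)[mA mT] := H g t mg => //.
  by apply/(msm_pullback mX bA bs); split; [exact: (proj1 (msm_sub g t) mg)|exact: mA].
apply/(msm_prol hA hE hN); split; last exact: H2.
by have /(msm_pullback mX bA bs)[] := H1 g t mg.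
Qed.

End Sections.
End KernelAndSections.

Theorem theorem25 (R : realType) (M : manifold R) (A E : bundle M)
    (AA EE : tvsType R)
    (rho : forall x : M, A x -> tangent M x)
    (N : set (total_space E)) (O : set EE)
    (hA : is_anchored A rho) (hAA : typical_fiber A AA)
    (hE : is_bundle E) (hEE : typical_fiber E EE)
    (hN : mopen (total_space E) N)
    (hO : cinf_open O)
    (hsurj : forall x : M, exists m : sub_manifold N, base N m = x)
    (hfib : is_fibration A N AA O) :
  (* (1) *)
  [/\ is_bundle (prolongation rho N),
      typical_fiber (prolongation rho N) (AA * EE)%type &
      is_anchored (prolongation rho N) (rho_hat rho N)] /\
  (* (2) *)
  [/\ is_morphism (prolongation rho N) (A_tilde A N) (p_A_tilde rho N),
      forall (m : sub_manifold N) (b : A_tilde A N m),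
        exists t : prolongation rho N m, p_A_tilde rho N m t = b,
      is_subbundle (prolongation rho N) (ker_p_A_tilde rho N),
      is_subbundle (tangent (sub_manifold N)) (vertical N) &
      exists h : forall m : sub_manifold N,
          restr_bundle (prolongation rho N) (ker_p_A_tilde rho N) m ->
          restr_bundle (tangent (sub_manifold N)) (vertical N) m,
        (forall m t, sval (h m t) = rho_hat rho N m (sval t)) /\
        is_isomorphism
          (restr_bundle (prolongation rho N) (ker_p_A_tilde rho N))
          (restr_bundle (tangent (sub_manifold N)) (vertical N)) h] /\
  (* (3) *)
  (forall V : set M, mopen M V ->
     let VV : set (sub_manifold N) := [set m | V (base N m)] in
     let compatible
         (a : forall m : sub_manifold VV, A_tilde A N (sval m))
         (X : forall m : sub_manifold VV, tangent (sub_manifold N) (sval m)) :=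
       forall m : sub_manifold VV,
         tangent_map (base N) (sval m) (X m) =
         rho (base N (sval m)) (p_tilde A N (sval m) (a m)) in
     (forall s : forall m : sub_manifold VV, prolongation rho N (sval m),
        is_section (prolongation rho N) VV s ->
        exists (a : forall m : sub_manifold VV, A_tilde A N (sval m))
               (X : forall m : sub_manifold VV, tangent (sub_manifold N) (sval m)),
          [/\ is_section (A_tilde A N) VV a,
              is_section (tangent (sub_manifold N)) VV X,
              compatible a X,
              forall m, p_A_tilde rho N (sval m) (s m) = a m &
              forall m, rho_hat rho N (sval m) (s m) = X m]) /\
     (forall (a : forall m : sub_manifold VV, A_tilde A N (sval m))
             (X : forall m : sub_manifold VV, tangent (sub_manifold N) (sval m)),
        is_section (A_tilde A N) VV a ->
        is_section (tangent (sub_manifold N)) VV X ->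
        compatible a X ->
        exists! s : forall m : sub_manifold VV, prolongation rho N (sval m),
          [/\ is_section (prolongation rho N) VV s,
              forall m, p_A_tilde rho N (sval m) (s m) = a m &
              forall m, rho_hat rho N (sval m) (s m) = X m])).
Proof.
split; [|split].
- split; [exact: is_bundle_prol|exact: typical_fiber_prol|split].
    exact: is_bundle_prol.
  exact: rho_hat_morphism.
- split.
  + exact: p_A_tilde_morphism.
  + exact: p_A_tilde_surjective.
  + exact: is_subbundle_ker.
  + exact: (is_subbundle_vertical hA hE hN).
  + exists (ker_to_vertical hA hE hN); split => //; exact: ker_vertical_isomorphism.
- move=> V oV VV compatible; split=> [s /(section_pair hA hE hN oV)[sa sX]|a X sa sX com].
    exists (fun m => p_A_tilde rho N (sval m) (s m)), (fun m => rho_hat rho N (sval m) (s m)).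
    by split => // m; exact: (esym (svalP (s m))).
  (* Compatibility of the pair is, pointwise, the proof that (a m, X m) lies in the prolongation. As
     this membership is a proposition, the pair determines the section, which gives uniqueness. *)
  pose s (m : sub_manifold VV) : prolongation rho N (sval m) :=
    exist (fun am : A (base N (sval m)) * tangent (sub_manifold N) (sval m) =>
             rho (base N (sval m)) am.1 = tangent_map (base N) (sval m) am.2)
      (a m, X m) (esym (com m)).
  exists s; split=> [|s' [_ s'a s'X]]; first by split => //; exact/(section_pair hA hE hN oV).
  by apply: functional_extensionality_dep => m; apply: prol_eq; [rewrite [RHS]s'a|rewrite [RHS]s'X].
Qed.
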